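(* For every $\gamma>0$ there is a randomized algorithm running in time $n^{O(\log n/\gamma^2)}$ that, given an instance $(V,I,w,k,h)$ of Submodular Densest $k$-Subgraph with $|V|=n$, outputs a set $T$ with $|T|=k$ and $I\subseteq T\subseteq V$ such that for every set $T^{\mathrm{OPT}}$ with $|T^{\mathrm{OPT}}|=k$ and $I\subseteq T^{\mathrm{OPT}}\subseteq V$, $$\mathbb{E}[h(T)+\mathrm{den}(T)]\ge (1-1/e-\gamma)\,h(T^{\mathrm{OPT}})+\mathrm{den}(T^{\mathrm{OPT}})-\gamma.$$
   Context: Submodular Densest $k$-Subgraph: the input is a finite set $V$ of $n$ vertices, a set $I\subseteq V$ of vertices that must be chosen, weights $w:\binom{V}{2}\to[0,1]$, an integer $k$ with $|I|\le k\le n$, and a monotone submodular set function $h:2^V\to\mathbb{R}_{\ge0}$ accessible via a value oracle. For $T\subseteq V$ with $|T|\ge2$, $\mathrm{den}(T):=\frac{1}{|T|(|T|-1)/2}\sum_{\{u,v\}\subseteq T}w(\{u,v\})$. The goal is to find $T$ of size $k$ with $I\subseteq T\subseteq V$ maximizing $h(T)+\mathrm{den}(T)$. *)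

(* Defs.v *)
From mathcomp Require Import all_boot all_order all_algebra.
From mathcomp Require Import reals.

Set Implicit Arguments.
Unset Strict Implicit.
Unset Printing Implicit Defensive.

Import Order.TTheory GRing.Theory Num.Theory.
Local Open Scope ring_scope.

Section SetFunctions.
Variables (R : realType) (V : finType).
Implicit Types (h w : {set V} -> R).

Definition monotone_setfun h : Prop :=
  forall A B : {set V}, A \subset B -> h A <= h B.

Definition submodular h : Prop :=
  forall A B : {set V}, h (A :|: B) + h (A :&: B) <= h A + h B.

(* [w] is only ever read on two-element sets.  When #|T| <= 1 the sum is
   empty, so that den w T = 0. *)
Definition den w (T : {set V}) : R :=
  (#|T|%:R * (#|T|%:R - 1) / 2)^-1 *
  \sum_(e : {set V} | (e \subset T) && (#|e| == 2)%N) w e.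

End SetFunctions.

(* The vertices are numbered 0, ..., n-1, as they are presented to the
   machine below. *)
Record instance (R : realType) := Instance {
  nvert : nat;
  forced : {set 'I_nvert};
  weight : {set 'I_nvert} -> R;
  target : nat;
  reward : {set 'I_nvert} -> R;
  weight_itv : forall e : {set 'I_nvert}, (#|e| == 2)%N -> 0 <= weight e <= 1;
  target_range : (#|forced| <= target <= nvert)%N;
  reward_ge0 : forall T, 0 <= reward T;
  reward_monotone : monotone_setfun reward;
  reward_submodular : submodular reward }.

Arguments weight {R} i _.
Arguments reward {R} i _.

Definition feasible (R : realType) (J : instance R) (T : {set 'I_(nvert J)}) :
  bool := (#|T| == target J) && (forced J \subset T).

Arguments feasible {R} J T.

(* A randomized real RAM with a value oracle.  A program is a finite piece of
   syntax that mentions neither the instance nor any real constant; it works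
   on finitely many unbounded arrays, each named by a number, holding natural
   numbers or real numbers.  Natural numbers can only be added, subtracted
   (truncated at 0) and compared: unit-cost multiplication or division of
   unbounded integers is not available.  Real numbers support the field
   operations and comparison, but not rounding to an integer. *)

Inductive nexp : Type :=
| NLit of nat
| NVert
| NTarget
| NForced of nexp
| NGet of nat & nexp
| NAdd of nexp & nexp
| NSub of nexp & nexp.

Inductive rexp : Type :=
| RNat of nexp
| RWeight of nexp & nexp
| RGet of nat & nexp
| RAdd of rexp & rexp
| RSub of rexp & rexp
| RMul of rexp & rexp
| RDiv of rexp & rexp.

Inductive bexp : Type :=
| BNatLe of nexp & nexp
| BRealLe of rexp & rexp
| BNot of bexp
| BAnd of bexp & bexp.

(* SetNat a i e    : a[i] := e, in an array of natural numbers
   SetReal a i e   : a[i] := e, in an array of real numbers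
   Draw a i e      : a[i] := a uniformly random element of {0, ..., e}
   Query a i b     : a[i] := value of the oracle on the set of the vertices v
                     such that b[v] is nonzero *)
Inductive cmd : Type :=
| Skip
| Seq of cmd & cmd
| SetNat of nat & nexp & nexp
| SetReal of nat & nexp & rexp
| If of bexp & cmd & cmd
| While of bexp & cmd
| Draw of nat & nexp & nexp
| Query of nat & nexp & nat.

Fixpoint ncost (e : nexp) : nat :=
  match e with
  | NLit _ | NVert | NTarget => 1
  | NForced e1 | NGet _ e1 => (ncost e1).+1
  | NAdd e1 e2 | NSub e1 e2 => (ncost e1 + ncost e2).+1
  end.

Fixpoint rcost (e : rexp) : nat :=
  match e with
  | RNat e1 | RGet _ e1 => (ncost e1).+1
  | RWeight e1 e2 => (ncost e1 + ncost e2).+1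
  | RAdd e1 e2 | RSub e1 e2 | RMul e1 e2 | RDiv e1 e2 =>
      (rcost e1 + rcost e2).+1
  end.

Fixpoint bcost (b : bexp) : nat :=
  match b with
  | BNatLe e1 e2 => (ncost e1 + ncost e2).+1
  | BRealLe e1 e2 => (rcost e1 + rcost e2).+1
  | BNot b1 => (bcost b1).+1
  | BAnd b1 b2 => (bcost b1 + bcost b2).+1
  end.

Section Machine.
Variables (R : realType) (J : instance R).

Record memory := Memory {
  nmem : nat -> nat -> nat;
  rmem : nat -> nat -> R }.

Definition memory0 : memory := Memory (fun _ _ => 0%N) (fun _ _ => 0).

Definition update (X : Type) (m : nat -> nat -> X) (a i : nat) (x : X) :
    nat -> nat -> X :=
  fun b j => if (b == a) && (j == i) then x else m b j.

Definition set_nat (s : memory) (a i x : nat) : memory :=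
  Memory (update (nmem s) a i x) (rmem s).

Definition set_real (s : memory) (a i : nat) (x : R) : memory :=
  Memory (nmem s) (update (rmem s) a i x).

Definition vertex_set (s : memory) (a : nat) : {set 'I_(nvert J)} :=
  [set v : 'I_(nvert J) | nmem s a v != 0%N].

Fixpoint neval (s : memory) (e : nexp) : nat :=
  match e with
  | NLit c => c
  | NVert => nvert J
  | NTarget => target J
  | NForced e1 =>
      if insub (neval s e1) is Some v then (v \in forced J : nat) else 0%N
  | NGet a e1 => nmem s a (neval s e1)
  | NAdd e1 e2 => (neval s e1 + neval s e2)%N
  | NSub e1 e2 => (neval s e1 - neval s e2)%N
  end.

Definition read_weight (i j : nat) : R :=
  match insub i, insub j with
  | Some u, Some v => if u != v then weight J [set u; v] else 0
  | _, _ => 0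
  end.

Fixpoint reval (s : memory) (e : rexp) : R :=
  match e with
  | RNat e1 => (neval s e1)%:R
  | RWeight e1 e2 => read_weight (neval s e1) (neval s e2)
  | RGet a e1 => rmem s a (neval s e1)
  | RAdd e1 e2 => reval s e1 + reval s e2
  | RSub e1 e2 => reval s e1 - reval s e2
  | RMul e1 e2 => reval s e1 * reval s e2
  | RDiv e1 e2 => reval s e1 / reval s e2
  end.

Fixpoint beval (s : memory) (b : bexp) : bool :=
  match b with
  | BNatLe e1 e2 => (neval s e1 <= neval s e2)%N
  | BRealLe e1 e2 => reval s e1 <= reval s e2
  | BNot b1 => ~~ beval s b1
  | BAnd b1 b2 => beval s b1 && beval s b2
  end.

(* [todo] is the stack of the commands still to be executed. *)
Record config := Config {
  clock : nat;
  todo : seq cmd;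
  mem : memory }.

(* [Branch m next] moves to [next i] for a uniformly random i in 'I_m.+1. *)
Inductive transition : Type :=
| Stop
| Branch (m : nat) of 'I_m.+1 -> config.

Definition det (x : config) : transition := @Branch 0 (fun=> x).

Definition step (x : config) : transition :=
  let s := mem x in
  match todo x with
  | [::] => Stop
  | c :: K =>
    let go cost K' s' := Config (clock x + cost.+1) K' s' in
    match c with
    | Skip => det (go 0%N K s)
    | Seq c1 c2 => det (go 0%N (c1 :: c2 :: K) s)
    | SetNat a i e =>
        det (go (ncost i + ncost e)%N K
               (set_nat s a (neval s i) (neval s e)))
    | SetReal a i e =>
        det (go (ncost i + rcost e)%N K
               (set_real s a (neval s i) (reval s e)))
    | If b c1 c2 =>
        det (go (bcost b) ((if beval s b then c1 else c2) :: K) s)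
    | While b c1 =>
        det (go (bcost b)
               (if beval s b then c1 :: While b c1 :: K else K) s)
    | Draw a i e =>
        @Branch (neval s e) (fun r =>
          go (ncost i + ncost e)%N K (set_nat s a (neval s i) r))
    | Query a i b =>
        det (go (ncost i) K
               (set_real s a (neval s i) (reward J (vertex_set s b))))
    end
  end.

(* [Q] holds of every configuration that the machine, started in [x], can be
   in after [t] steps (or when it stops, if it stops earlier). *)
Fixpoint always (t : nat) (x : config) (Q : config -> Prop) : Prop :=
  if t is t'.+1 then
    match step x with
    | Stop => Q x
    | Branch m next => forall i : 'I_m.+1, always t' (next i) Q
    end
  else Q x.

(* The expected value of [f] on that configuration. *)
Fixpoint expect (t : nat) (x : config) (f : config -> R) : R :=
  if t is t'.+1 then
    match step x with
    | Stop => f x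
    | Branch m next => m.+1%:R^-1 * \sum_(i < m.+1) expect t' (next i) f
    end
  else f x.

Definition start (p : cmd) : config := Config 0 [:: p] memory0.

Definition halted (x : config) : bool := nilp (todo x).

Definition output (x : config) : {set 'I_(nvert J)} := vertex_set (mem x) 0.

(* Every step advances the clock by at least one, so a run of total cost at
   most [t] has stopped after at most [t] steps. *)
Definition halts_within (p : cmd) (t : nat) : Prop :=
  always t (start p) (fun x => halted x /\ (clock x <= t)%N).

Definition output_always (p : cmd) (t : nat) (Q : {set 'I_(nvert J)} -> Prop) :
  Prop := always t (start p) (fun x => Q (output x)).

Definition output_expect (p : cmd) (t : nat) (f : {set 'I_(nvert J)} -> R) :
  R := expect t (start p) (fun x => f (output x)).

End Machine.

Arguments output_always {R} J p t Q.
Arguments output_expect {R} J p t f.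

(* Main.v *)
(* Write A for the weight matrix, O for the optimum, and normalise fractional
   solutions x to total mass k.  A random multiset S of O(log n / gamma^2)
   vertices of O satisfies y := k A 1_S / |S| = A 1_O up to gamma k in every
   coordinate, and there are only n^O(log n / gamma^2) candidates for S, so that
   all of them can be tried.

   Given S, a discretised continuous greedy algorithm averages N sets Z_i of
   size k: Z_i maximises the linear score
     (weighted gradient of the multilinear extension of h at x)
       + c_i A + (N - i) y,     c_i := 1_{Z_1} + ... + 1_{Z_{i-1}}.
   Comparing Z_i with O, the term O A c_i is the sum over j < i of Z_j y; summed
   over i this is exactly what the weights N - i of y contribute on the other
   side, so that the quadratic form of the average is at least that of O, while
   h is approximated within 1 - 1/e as usual.  The gradient is estimated by
   sampling.

   Independent rounding keeps the expectations of h and of the quadratic form;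
   the size of the rounded set deviates from k by about sqrt (k - |I|), which is
   repaired greedily at a small relative cost.  When k - |I| is too small for
   this, O is the union of I and S for some S, and is found directly. *)

Require Import Defs.
From mathcomp Require Import all_boot all_order all_algebra.
From mathcomp Require Import reals sequences exp.
From mathcomp Require Import zify ring lra.
Import Order.TTheory GRing.Theory Num.Theory.
Set Implicit Arguments.
Unset Strict Implicit.
Unset Printing Implicit Defensive.
Local Open Scope ring_scope.

(** * A Hoare logic for expected values *)

Fixpoint nwrites (c : cmd) : seq nat :=
  match c with
  | SetNat a _ _ | Draw a _ _ => [:: a]
  | Seq c1 c2 | If _ c1 c2 => nwrites c1 ++ nwrites c2
  | While _ c1 => nwrites c1
  | _ => [::]
  end.

Fixpoint rwrites (c : cmd) : seq nat :=
  match c with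
  | SetReal a _ _ | Query a _ _ => [:: a]
  | Seq c1 c2 | If _ c1 c2 => rwrites c1 ++ rwrites c2
  | While _ c1 => rwrites c1
  | _ => [::]
  end.

(* Bounds the cost of [c] when each of its loops makes at most [U] rounds
   whenever it is entered. *)
Fixpoint loop_cost (U : nat) (c : cmd) : nat :=
  match c with
  | Skip => 1
  | Seq c1 c2 => (loop_cost U c1 + loop_cost U c2).+1
  | SetNat _ i e | Draw _ i e => (ncost i + ncost e).+1
  | SetReal _ i e => (ncost i + rcost e).+1
  | If b c1 c2 => (bcost b + loop_cost U c1 + loop_cost U c2).+1
  | While b c1 => U.+1 * (bcost b + loop_cost U c1).+1
  | Query _ i _ => (ncost i).+1
  end.

Definition For (i : nat) (e : nexp) (c : cmd) : cmd :=
  Seq (SetNat i (NLit 0) (NLit 0))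
    (While (BNot (BNatLe e (NGet i (NLit 0))))
      (Seq c (SetNat i (NLit 0) (NAdd (NGet i (NLit 0)) (NLit 1))))).

Section Runs.
Variables (R : realType) (J : instance R).
Local Notation config := (config R).

(* From the configuration the machine surely reaches [Q], and there [f] is worth
   at least the last argument on average. *)
Inductive run (Q : config -> Prop) (f : config -> R) : config -> R -> Prop :=
| run_stop x g of Q x & g <= f x : run Q f x g
| run_step x m (next : 'I_m.+1 -> config) (gs : 'I_m.+1 -> R) g of
    step J x = Branch next & (forall i, run Q f (next i) (gs i)) &
    g <= m.+1%:R^-1 * \sum_i gs i : run Q f x g.

Lemma uniform_mean_const m (a : R) : m.+1%:R^-1 * \sum_(i < m.+1) a = a.
Proof. by rewrite sumr_const card_ord -[a *+ _]mulr_natl mulKf ?pnatr_eq0. Qed.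

Lemma run_det Q f x y g : step J x = det y -> run Q f y g -> run Q f x g.
Proof.
by move=> sx ry; apply: (run_step (gs := fun=> g) sx) => //; rewrite uniform_mean_const.
Qed.

Lemma run_le Q f x g g' : run Q f x g -> g' <= g -> run Q f x g'.
Proof.
case=> {x g}[x g Qx le_g|x m next gs g sx rn le_g] le_g'.
  by apply: run_stop => //; apply: le_trans le_g' le_g.
by apply: run_step sx rn _; apply: le_trans le_g' le_g.
Qed.

Lemma run_bind Q f Q' f' x g : run Q f x g ->
  (forall y, Q y -> run Q' f' y (f y)) -> run Q' f' x g.
Proof.
move=> rx Q_run; elim: rx => {x g}[x g Qx le_g|x m next gs g sx _ IH le_g].
  by apply: run_le le_g; apply: Q_run.
exact: run_step sx IH le_g.
Qed.

Lemma run_const Q f f' x g g' : run Q f x g ->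
  (forall y, Q y -> g' <= f' y) -> run Q f' x g'.
Proof.
move=> rx le_f'; elim: rx => {x g}[x g Qx le_g|x m next gs g sx _ IH le_g].
  by apply: run_stop => //; apply: le_f'.
by apply: (run_step sx IH); rewrite uniform_mean_const.
Qed.

Lemma run_addr Q f x g a : run Q f x g -> run Q (fun y => f y + a) x (g + a).
Proof.
elim=> {x g}[x g Qx le_g|x m next gs g sx _ IH le_g].
  by apply: run_stop => //; rewrite lerD2r.
apply: (run_step sx IH).
by rewrite big_split /= mulrDr uniform_mean_const lerD2r.
Qed.

(* Reading off the transition avoids inverting equations between dependent
   constructors. *)
Definition on_transition (P : config -> Prop) (tr : transition R) : Prop :=
  if tr is Branch m next then forall i : 'I_m.+1, P (next i) else True.

Lemma on_transitionP P x m (next : 'I_m.+1 -> config) i :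
  on_transition P (step J x) -> step J x = Branch next -> P (next i).
Proof. by move=> Px sx; move: Px; rewrite sx. Qed.

Lemma step_clock x : on_transition (fun y => clock x < clock y)%N (step J x).
Proof.
by case: x => t [|[|c1 c2|a j e|a j e|b c1 c2|b c1|a j e|a j b] K] s //= k;
  rewrite addnS ltnS leq_addr.
Qed.

Lemma run_clock Q f x g T : run Q f x g ->
  (forall y, Q y -> clock y <= T)%N -> (clock x <= T)%N.
Proof.
move=> rx le_T; elim: rx => {x g}[x g Qx _|x m next gs g sx _ IH _]; first exact: le_T.
exact/ltnW/(leq_trans (on_transitionP ord0 (step_clock x) sx) (IH ord0)).
Qed.

Lemma run_sound Q f x g T t : run Q f x g ->
  (forall y, Q y -> halted y /\ clock y <= T)%N -> (T <= clock x + t)%N ->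
  always J t x Q /\ g <= expect J t x f.
Proof.
move=> rx stops; elim: rx t => {x g}[x g Qx le_g|x m next gs g sx rn IH le_g] [|t] //=.
- by have [+ _] := stops _ Qx; case: x Qx le_g => c [|? ?] s.
- have le_T i : (clock (next i) <= T)%N := run_clock (rn i) (fun y Qy => (stops y Qy).2).
  have lt_next := on_transitionP ord0 (step_clock x) sx.
  by rewrite addn0 => /(leq_trans (leq_trans lt_next (le_T ord0))); rewrite ltnn.
rewrite sx => le_T.
have next_sound i : always J t (next i) Q /\ gs i <= expect J t (next i) f.
  apply: IH; apply: leq_trans le_T _; rewrite addnS -addSn leq_add2r.
  exact: on_transitionP (step_clock x) sx.
split=> [i|]; first by case: (next_sound i).
apply: le_trans le_g _; rewrite ler_pM2l ?invr_gt0 ?ltr0Sn //.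
by apply: ler_sum => i _; case: (next_sound i).
Qed.

Lemma always_imp t x (Q Q' : config -> Prop) :
  (forall y, Q y -> Q' y) -> always J t x Q -> always J t x Q'.
Proof.
move=> QQ'; elim: t x => [|t IH] x /=; first exact: QQ'.
by case: (step J x) => [|m next]; [exact: QQ'|move=> Q_next i; apply: IH].
Qed.

Definition push (K : seq cmd) (x : config) : config :=
  Config (clock x) (todo x ++ K) (Defs.mem x).

Definition push_transition K (tr : transition R) : transition R :=
  if tr is Branch m next then Branch (fun i : 'I_m.+1 => push K (next i))
  else Stop R.

Lemma step_push x K : todo x <> [::] ->
  step J (push K x) = push_transition K (step J x).
Proof.
case: x => t [|c L] s //= _; rewrite /push /step /=.
by case: c => //= b c; case: beval.
Qed.

Definition same_outside (na ra : seq nat) (s s' : memory R) : Prop :=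
  (forall a i, a \notin na -> nmem s' a i = nmem s a i) /\
  (forall a i, a \notin ra -> rmem s' a i = rmem s a i).

Definition agree (c : cmd) : memory R -> memory R -> Prop :=
  same_outside (nwrites c) (rwrites c).

Lemma agree_nmem c s s' a i :
  agree c s s' -> a \notin nwrites c -> nmem s' a i = nmem s a i.
Proof. by case=> same _; apply: same. Qed.

Lemma agree_rmem c s s' a i :
  agree c s s' -> a \notin rwrites c -> rmem s' a i = rmem s a i.
Proof. by case=> _ same; apply: same. Qed.

Lemma agree_refl c s : agree c s s.
Proof. by split. Qed.

Lemma same_outside_trans na ra na' ra' s s' s'' :
  {subset na' <= na} -> {subset ra' <= ra} ->
  same_outside na ra s s' -> same_outside na' ra' s' s'' -> same_outside na ra s s''.
Proof.
move=> sub_n sub_r [same_n same_r] [same_n' same_r']; split=> a i a_out.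
- by rewrite same_n' ?same_n //; apply: contra a_out; apply: sub_n.
- by rewrite same_r' ?same_r //; apply: contra a_out; apply: sub_r.
Qed.

Lemma set_nat_same_outside a i k s : same_outside [:: a] [::] s (set_nat s a i k).
Proof. by split=> b j //=; rewrite inE /update => /negPf->. Qed.

Lemma set_real_same_outside a i z s : same_outside [::] [:: a] s (set_real s a i z).
Proof. by split=> b j //=; rewrite inE /update => /negPf->. Qed.

Definition pending_nwrites (x : config) : seq nat := flatten (map nwrites (todo x)).
Definition pending_rwrites (x : config) : seq nat := flatten (map rwrites (todo x)).

Lemma step_frame x : on_transition (fun y =>
  [/\ {subset pending_nwrites y <= pending_nwrites x},
      {subset pending_rwrites y <= pending_rwrites x} &
      same_outside (pending_nwrites x) (pending_rwrites x) (Defs.mem x) (Defs.mem y)])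
  (step J x).
Proof.
have cat_sub (A B : seq nat) : {subset B <= A ++ B} by move=> a; rewrite mem_cat orbC => ->.
have widen na ra A B s s' : same_outside na ra s s' -> same_outside (na ++ A) (ra ++ B) s s'.
  by case=> sn sr; split=> a i; rewrite mem_cat negb_or => /andP[]; [move/sn|move/sr].
rewrite /pending_nwrites /pending_rwrites.
case: x => t [//|[|c1 c2|a j e|a j e|b c1 c2|b c1|a j e|a j b] K] s /= k; split=> //=;
  try solve [exact: cat_sub | by rewrite catA
            | exact: widen (set_nat_same_outside _ _ _ _)
            | exact: widen (set_real_same_outside _ _ _ _)
            | exact: (cat_sub [:: a])
            | exact: (cat_sub [:: a])].
all: by move=> z; case: beval; rewrite /= !mem_cat; do !case: (z \in _).
Qed.

Lemma run_frame Q f x g : run Q f x g ->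
  run (fun y => Q y /\
    same_outside (pending_nwrites x) (pending_rwrites x) (Defs.mem x) (Defs.mem y)) f x g.
Proof.
elim=> {x g}[x g Qx le_g|x m next gs g sx rn IH le_g]; first by apply: run_stop.
apply: (run_step sx _ le_g) => i.
have [sub_n sub_r same] := on_transitionP i (step_frame x) sx.
apply: (run_bind (IH i)) => y [Qy same_y]; apply: run_stop => //.
by split=> //; apply: same_outside_trans sub_n sub_r same same_y.
Qed.

End Runs.

(* Rewrites the cells that the commands executed so far cannot have changed. *)
Ltac frame := repeat match goal with
  | ag : agree ?c _ ?s |- context [nmem ?s ?a ?i] =>
      rewrite (agree_nmem i ag (isT : a \notin nwrites c))
  | ag : agree ?c _ ?s |- context [rmem ?s ?a ?i] =>
      rewrite (agree_rmem i ag (isT : a \notin rwrites c))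
  | |- _ => progress rewrite /= /update /=
  end.

Section Triples.
Variables (R : realType) (J : instance R) (U : nat).
Local Notation memory := (memory R).
Local Notation config := (config R).

Definition finished K T (Q : memory -> Prop) (y : config) : Prop :=
  [/\ todo y = K, (clock y <= T)%N & Q (Defs.mem y)].

Lemma finished_imp K T T' (Q Q' : memory -> Prop) y : finished K T Q y ->
  (T <= T')%N -> (forall s, Q s -> Q' s) -> finished K T' Q' y.
Proof.
by case=> ? le_T Qy le_T' QQ'; split=> //; [apply: leq_trans le_T le_T'|apply: QQ'].
Qed.

Lemma run_push T Q f x g K :
  run J (finished [::] T Q) (fun y => f (Defs.mem y)) x g ->
  run J (finished K T Q) (fun y => f (Defs.mem y)) (push K x) g.
Proof.
elim=> {x g}[x g [tx le_T Qx] le_g|x m next gs g sx _ IH le_g].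
  by apply: run_stop => //; rewrite /finished /= tx.
apply: run_step IH le_g; rewrite step_push ?sx //.
by move=> tx; move: sx; rewrite /step tx.
Qed.

Definition triple (c : cmd) (s : memory) (Q : memory -> Prop) (f : memory -> R)
    (g : R) : Prop :=
  forall t, run J (finished [::] (t + loop_cost U c) Q) (fun y => f (Defs.mem y))
    (Config t [:: c] s) g.

Definition ensures c s Q := triple c s Q (fun=> 0) 0.

Lemma triple_conseq c s (Q Q' : memory -> Prop) f f' g g' : triple c s Q f g ->
  (forall s', Q s' -> Q' s' /\ f s' <= f' s') -> g' <= g -> triple c s Q' f' g'.
Proof.
move=> tr conseq le_g t; apply: run_le le_g.
apply: run_bind (tr t) _ => y [ty cy /conseq[Q'y le_f]].
exact: run_stop.
Qed.

Lemma triple_addr c s Q f g a : triple c s Q f g ->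
  triple c s Q (fun s' => f s' + a) (g + a).
Proof. by move=> tr t; apply: run_addr (tr t). Qed.

Lemma triple_post c s (Q Q' : memory -> Prop) f g : triple c s Q f g ->
  (forall s', Q s' -> Q' s') -> triple c s Q' f g.
Proof. by move=> tr QQ'; apply: triple_conseq tr _ _ => // s' /QQ'. Qed.

Lemma triple_const c s Q f f' g g' : triple c s Q f g ->
  (forall s', Q s' -> g' <= f' s') -> triple c s Q f' g'.
Proof. by move=> tr le_f' t; apply: (run_const (tr t)) => y [_ _ /le_f']. Qed.

Lemma triple_ensures c s Q f g : triple c s Q f g -> ensures c s Q.
Proof. by move/triple_const; apply. Qed.

Lemma triple_frame c s (Q : memory -> Prop) f g : triple c s Q f g ->
  triple c s (fun s' => Q s' /\ agree c s s') f g.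
Proof.
move=> tr t; apply: run_bind (run_frame (tr t)) _ => y [[ty cy Qy] same].
apply: run_stop => //; split=> //; split=> //.
by move: same; rewrite /pending_nwrites /pending_rwrites /= !cats0.
Qed.

Lemma triple_skip s (Q : memory -> Prop) f g : Q s -> g <= f s ->
  triple Skip s Q f g.
Proof. by move=> Qs le_g t; apply: run_det; first exact: erefl; apply: run_stop. Qed.

Lemma triple_set_nat a i e s (Q : memory -> Prop) f g :
  Q (set_nat s a (neval J s i) (neval J s e)) ->
  g <= f (set_nat s a (neval J s i) (neval J s e)) ->
  triple (SetNat a i e) s Q f g.
Proof. by move=> Qs le_g t; apply: run_det; first exact: erefl; apply: run_stop. Qed.

Lemma triple_set_real a i e s (Q : memory -> Prop) f g :
  Q (set_real s a (neval J s i) (reval J s e)) ->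
  g <= f (set_real s a (neval J s i) (reval J s e)) ->
  triple (SetReal a i e) s Q f g.
Proof. by move=> Qs le_g t; apply: run_det; first exact: erefl; apply: run_stop. Qed.

Lemma triple_query a i b s (Q : memory -> Prop) f g :
  Q (set_real s a (neval J s i) (reward J (vertex_set J s b))) ->
  g <= f (set_real s a (neval J s i) (reward J (vertex_set J s b))) ->
  triple (Query a i b) s Q f g.
Proof. by move=> Qs le_g t; apply: run_det; first exact: erefl; apply: run_stop. Qed.

Lemma triple_draw a i e s (Q : memory -> Prop) f g :
  (forall k : 'I_(neval J s e).+1, Q (set_nat s a (neval J s i) k)) ->
  g <= (neval J s e).+1%:R^-1 *
       \sum_(k < (neval J s e).+1) f (set_nat s a (neval J s i) k) ->
  triple (Draw a i e) s Q f g.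
Proof.
move=> Qs le_g t.
apply: (run_step (gs := fun k => f (set_nat s a (neval J s i) k)) _ _ le_g).
  exact: erefl.
by move=> k; apply: run_stop => //; split=> //=; apply: Qs.
Qed.

Lemma triple_seq c1 c2 s (Q1 Q2 : memory -> Prop) f1 f2 g :
  triple c1 s Q1 f1 g -> (forall s', Q1 s' -> triple c2 s' Q2 f2 (f1 s')) ->
  triple (Seq c1 c2) s Q2 f2 g.
Proof.
move=> tr1 tr2 t; apply: run_det; first exact: erefl.
apply: run_bind (run_push [:: c2] (tr1 (t + 1)%N)) _.
case=> t' K' s' [/= -> le_t' Qs']; apply: run_bind (tr2 s' Qs' t') _ => y fin.
by apply: run_stop => //; apply: finished_imp fin _ _ => //=; move: le_t'; lia.
Qed.

Lemma triple_seq_ensures c1 c2 s (Q1 Q2 : memory -> Prop) f g : ensures c1 s Q1 ->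
  (forall s', agree c1 s s' -> Q1 s' -> triple c2 s' Q2 f g) ->
  triple (Seq c1 c2) s Q2 f g.
Proof.
move=> tr1 tr2; apply: triple_seq (triple_const (f' := fun=> g) (triple_frame tr1) _) _ => //.
by move=> s' [Q1s' ag]; apply: tr2.
Qed.

Lemma triple_seq_set_nat a i e c s Q f g :
  triple c (set_nat s a (neval J s i) (neval J s e)) Q f g ->
  triple (Seq (SetNat a i e) c) s Q f g.
Proof.
set s1 := set_nat _ _ _ _ => tr.
apply: (triple_seq (Q1 := eq^~ s1) (f1 := fun=> g)) => [|_ -> //].
exact: triple_set_nat.
Qed.

Lemma triple_seq_set_real a i e c s Q f g :
  triple c (set_real s a (neval J s i) (reval J s e)) Q f g ->
  triple (Seq (SetReal a i e) c) s Q f g.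
Proof.
set s1 := set_real _ _ _ _ => tr.
apply: (triple_seq (Q1 := eq^~ s1) (f1 := fun=> g)) => [|_ -> //].
exact: triple_set_real.
Qed.

Lemma triple_seq_query a i b c s Q f g :
  triple c (set_real s a (neval J s i) (reward J (vertex_set J s b))) Q f g ->
  triple (Seq (Query a i b) c) s Q f g.
Proof.
set s1 := set_real _ _ _ _ => tr.
apply: (triple_seq (Q1 := eq^~ s1) (f1 := fun=> g)) => [|_ -> //].
exact: triple_query.
Qed.

Lemma triple_if b c1 c2 s (Q : memory -> Prop) f g :
  triple (if beval J s b then c1 else c2) s Q f g -> triple (If b c1 c2) s Q f g.
Proof.
move=> tr t; apply: run_det; first exact: erefl.
apply: run_bind (tr (t + (bcost b).+1)%N) _ => y fin; apply: run_stop => //.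
by apply: finished_imp fin _ _ => //=; case: beval; lia.
Qed.

Lemma triple_while b c s m (Inv : nat -> memory -> Prop) (phi : nat -> memory -> R) :
  (m <= U)%N -> Inv 0%N s ->
  (forall j s', (j <= m)%N -> Inv j s' -> beval J s' b = (j < m)%N) ->
  (forall j s', (j < m)%N -> Inv j s' ->
     triple c s' (Inv j.+1) (phi j.+1) (phi j s')) ->
  triple (While b c) s (Inv m) (phi m) (phi 0%N s).
Proof.
move=> le_m Inv0 Hb Hc t; set w := While b c; set T := (bcost b + loop_cost U c).+1.
have loop d j s' t' : (j + d = m)%N -> Inv j s' ->
    run J (finished [::] (t' + d.+1 * T) (Inv m)) (fun y => phi m (Defs.mem y))
      (Config t' [:: w] s') (phi j s').
  elim: d j s' t' => [|d IH] j s' t' Em Ij; (apply: run_det; first exact: erefl).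
    have Ejm : j = m by rewrite -Em addn0.
    rewrite Ejm in Ij *; rewrite /= (Hb m) // ltnn; apply: run_stop => //.
    by split=> //=; rewrite mul1n leq_add2l /T; lia.
  have lt_jm : (j < m)%N by lia.
  rewrite /= (Hb j s' (ltnW lt_jm) Ij) lt_jm.
  apply: run_bind (run_push [:: w] (Hc j s' lt_jm Ij _)) _.
  case=> t1 K s1 [/= -> le_t1 I1]; apply: run_bind (IH j.+1 s1 t1 _ I1) _; first by lia.
  move=> y fin; apply: run_stop => //; apply: finished_imp fin _ _ => //.
  by move: le_t1; rewrite /T; nia.
apply: run_bind (loop m 0%N s t (add0n m) Inv0) _ => y fin; apply: run_stop => //.
by apply: finished_imp fin _ _ => //; rewrite leq_add2l /= leq_mul2r ltnS le_m orbT.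
Qed.

Lemma triple_for i e c s m (Inv : nat -> memory -> Prop) (phi : nat -> memory -> R) :
  (m <= U)%N -> i \notin nwrites c ->
  (forall s', agree (For i e c) s s' -> neval J s' e = m) ->
  Inv 0%N (set_nat s i 0 0) ->
  (forall j s', agree (For i e c) s s' -> (j < m)%N -> nmem s' i 0 = j -> Inv j s' ->
     triple c s' (fun s'' => Inv j.+1 (set_nat s'' i 0 j.+1))
       (fun s'' => phi j.+1 (set_nat s'' i 0 j.+1)) (phi j s')) ->
  triple (For i e c) s (Inv m) (phi m) (phi 0%N (set_nat s i 0 0)).
Proof.
move=> le_m fresh He Inv0 Hc; apply: triple_seq_set_nat => /=.
pose Inv' j s' := [/\ agree (For i e c) s s', nmem s' i 0 = j & Inv j s'].
have agree_set j s' : agree (For i e c) s s' -> agree (For i e c) s (set_nat s' i 0 j).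
  move=> ag; apply: same_outside_trans ag (set_nat_same_outside _ _ _ _) => //.
  by move=> a; rewrite !inE => ->.
have Inv'0 : Inv' 0%N (set_nat s i 0 0).
  by split=> //; [exact: agree_set (agree_refl _ _)|rewrite /= /update !eqxx].
apply: triple_post (triple_while (phi := phi) le_m Inv'0 _ _) _ => [j s' le_j||s' []] //.
  by case=> ag Ej _; rewrite /= (He s' ag) Ej ltnNge.
move=> j s' lt_j [ag Ej Ij].
apply: triple_seq (triple_frame (Hc j s' ag lt_j Ej Ij)) _ => s'' [Ij' ag'].
have Ej' : nmem s'' i 0 = j by rewrite (agree_nmem 0 ag' fresh).
apply: triple_set_nat; rewrite /= Ej' addn1 //; split=> //.
  apply: agree_set; apply: same_outside_trans ag ag' => a; rewrite /= ?inE !mem_cat => ->;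
    by rewrite ?orbT.
by rewrite /= /update !eqxx.
Qed.

Lemma ensures_for i e c s m (Inv : nat -> memory -> Prop) :
  (m <= U)%N -> i \notin nwrites c ->
  (forall s', agree (For i e c) s s' -> neval J s' e = m) ->
  Inv 0%N (set_nat s i 0 0) ->
  (forall j s', agree (For i e c) s s' -> (j < m)%N -> nmem s' i 0 = j -> Inv j s' ->
     ensures c s' (fun s'' => Inv j.+1 (set_nat s'' i 0 j.+1))) ->
  ensures (For i e c) s (Inv m).
Proof. exact: (triple_for (phi := fun _ _ => 0)). Qed.

Lemma triple_output (P : cmd) (Q : pred {set 'I_(nvert J)}) (f : {set 'I_(nvert J)} -> R) g :
  triple P (memory0 R) (fun s => Q (vertex_set J s 0)) (fun s => f (vertex_set J s 0)) g ->
  [/\ halts_within J P (loop_cost U P), output_always J P (loop_cost U P) Q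
    & g <= output_expect J P (loop_cost U P) f].
Proof.
move=> /(_ 0%N)/run_sound; rewrite add0n => /(_ (loop_cost U P) (loop_cost U P)).
case=> [y [ty cy _]|//|runs le_g]; first by rewrite /halted ty.
split=> //; apply: always_imp runs => y [ty cy Qy] //.
by rewrite /halted ty.
Qed.

End Triples.

(** * Submodular functions and product measures *)

Lemma finset_ind (V : finType) (P : {set V} -> Prop) : P set0 ->
  (forall v (X : {set V}), v \notin X -> P X -> P (v |: X)) -> forall X, P X.
Proof.
move=> P0 PU X; elim: {X}#|X| {-2}X (erefl #|X|) => [X /cards0_eq-> //|m IH X cX].
have /card_gt0P[v vX] : (0 < #|X|)%N by rewrite cX.
rewrite -(setD1K vX); apply: PU; rewrite ?setD11 //; apply: IH.
by move: cX; rewrite (cardsD1 v) vX => -[].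
Qed.

Section Gain.
Variables (R : realType) (V : finType) (h : {set V} -> R).
Hypotheses (h_mono : monotone_setfun h) (h_sub : submodular h).

Definition gain (X : {set V}) (v : V) : R := h (v |: X) - h X.

Lemma gain_ge0 X v : 0 <= gain X v.
Proof. by rewrite subr_ge0; apply/h_mono/subsetUr. Qed.

Lemma gain_antimono (X Y : {set V}) v : X \subset Y -> gain Y v <= gain X v.
Proof.
move=> sXY; have := h_sub (v |: X) Y.
rewrite -setUA (setUidPr sXY).
have : h X <= h ((v |: X) :&: Y) by apply/h_mono; rewrite subsetI subsetUr.
rewrite /gain; lra.
Qed.

Lemma diff_le_sum_gain (X O : {set V}) : h O - h X <= \sum_(v in O) gain X v.
Proof.
have : h (X :|: O) - h X <= \sum_(v in O) gain X v.
  elim/finset_ind: O => [|v O vO IH]; first by rewrite big_set0 setU0 subrr.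
  rewrite big_setU1 //= setUCA.
  have := gain_antimono v (subsetUl X O); rewrite {1}/gain; lra.
by apply: le_trans; rewrite lerD2r; apply/h_mono/subsetUr.
Qed.

Lemma sum_loss_le (X D : {set V}) : (forall Y, 0 <= h Y) -> D \subset X ->
  \sum_(v in D) (h X - h (X :\ v)) <= h X.
Proof.
move=> h_ge0; suff : D \subset X -> \sum_(v in D) (h X - h (X :\ v)) <= h X - h (X :\: D).
  by move=> telescope /telescope/le_trans; apply; rewrite gerBl.
elim/finset_ind: D => [_|v D vD IH]; first by rewrite big_set0 setD0 subrr.
rewrite subUset sub1set => /andP[vX /IH {}IH]; rewrite big_setU1 //=.
have := gain_antimono v (setDS X (subsetUl [set v] D)); rewrite /gain setD1K //.
have -> : v |: X :\: (v |: D) = X :\: D.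
  by apply/setP => u; rewrite !inE; case: eqP => [->|] //=; rewrite vX (negPf vD).
lra.
Qed.

(* Removing the best of m.+1 vertices keeps a fraction m / m.+1 of the value. *)
Lemma best_removal_ratio (I X : {set V}) b (c A : R) : (forall Y, 0 <= h Y) ->
  I \subset X -> b \in X :\: I -> {in X :\: I, forall u, h (X :\ u) <= h (X :\ b)} ->
  0 <= A -> (#|X| - #|I|)%:R * c <= A * h X ->
  (#|X :\ b| - #|I|)%:R * c <= A * h (X :\ b).
Proof.
move=> h_ge0 sIX bXI best A0 ratio; have cXI : #|X :\: I| = (#|X| - #|I|)%N.
  by rewrite cardsD (setIidPr sIX).
set m := (#|X :\ b| - #|I|)%N.
have Em : (#|X| - #|I|)%N = m.+1.
  have XI_gt0 : (0 < #|X :\: I|)%N by apply/card_gt0P; exists b.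
  have /setDP[bX _] := bXI; rewrite /m (cardsD1 b X) bX add1n subSn //.
  by move: XI_gt0; rewrite cXI (cardsD1 b X) bX; lia.
have loss : m.+1%:R * (h X - h (X :\ b)) <= h X.
  apply: le_trans (sum_loss_le h_ge0 (subsetDl X I)).
  rewrite -Em -cXI mulr_natl -sumr_const; apply: ler_sum => u uXI.
  by rewrite lerD2l lerN2 best.
rewrite -(ler_pM2l (ltr0Sn R m)); move: loss ratio; rewrite Em -natr1.
have : 0 <= m%:R :> R by [].
set M : R := m%:R => M0 loss ratio.
have := ler_wpM2l M0 ratio; have := ler_wpM2l A0 loss; lra.
Qed.

End Gain.

Section ProductMean.
Variables (R : realType) (V : finType).
Implicit Types (p : V -> R) (psi : {set V} -> R) (X Y : {set V}).

(* The probability of [X] when each [v] is drawn independently with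
   probability [p v]. *)
Definition inclusion_weight p X : R := \prod_v (if v \in X then p v else 1 - p v).

Definition mean p psi : R := \sum_X inclusion_weight p X * psi X.

Definition unit_range p : Prop := forall v, 0 <= p v <= 1.

Lemma eq_mean p p' psi psi' : p =1 p' -> psi =1 psi' -> mean p psi = mean p' psi'.
Proof.
move=> eq_p eq_psi; apply: eq_bigr => X _; rewrite eq_psi; congr (_ * _).
by apply: eq_bigr => v _; rewrite eq_p.
Qed.

Lemma mean_le p psi psi' : unit_range p -> (forall Y, psi Y <= psi' Y) ->
  mean p psi <= mean p psi'.
Proof.
move=> p01 le_psi; apply: ler_sum => X _; apply: ler_wpM2l => //.
apply: prodr_ge0 => v _; have /andP[p0 p1] := p01 v.
by case: ifP => // _; rewrite subr_ge0.
Qed.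

Lemma mean_lin p a psi psi' :
  mean p (fun Y => a * psi Y + psi' Y) = a * mean p psi + mean p psi'.
Proof.
by rewrite mulr_sumr -big_split; apply: eq_bigr => X _ /=; rewrite mulrDr mulrCA.
Qed.

Lemma meanZ p a psi : mean p (fun Y => a * psi Y) = a * mean p psi.
Proof. by rewrite mulr_sumr; apply: eq_bigr => X _; rewrite mulrCA. Qed.

Lemma mean_sum p (I : Type) (r : seq I) (P : pred I) (psi : I -> {set V} -> R) :
  mean p (fun Y => \sum_(i <- r | P i) psi i Y) = \sum_(i <- r | P i) mean p (psi i).
Proof. by rewrite exchange_big; apply: eq_bigr => X _; rewrite mulr_sumr. Qed.

Lemma mean_prod p (F : V -> bool -> R) :
  mean p (fun X => \prod_v F v (v \in X)) =
  \prod_v (p v * F v true + (1 - p v) * F v false).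
Proof.
rewrite bigA_distr; apply: eq_bigr => X _; rewrite -big_split.
by apply: eq_bigr => v _; case: (v \in X).
Qed.

Lemma mean_const p a : mean p (fun=> a) = a.
Proof.
have mean1 : mean p (fun=> \prod_(v : V) 1) = 1.
  by rewrite (mean_prod p (fun=> fun=> 1)) big1 // => v _; ring.
by rewrite -[RHS]mulr1 -mean1 -meanZ; apply: eq_mean => // X; rewrite big1 // mulr1.
Qed.

Lemma mean_subset p X : mean p (fun Y => (X \subset Y)%:R) = \prod_(v in X) p v.
Proof.
rewrite [RHS]big_mkcond.
transitivity (mean p (fun Y => \prod_v (if v \in X then (v \in Y)%:R else 1))).
  apply: eq_mean => // Y; case: (boolP (X \subset Y)) => [/subsetP sXY|].
    by rewrite big1 // => v _; case: ifP => // /sXY->.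
  by case/subsetPn => v vX vY; rewrite (bigD1 v) //= vX (negPf vY) mul0r.
rewrite (mean_prod p (fun v b => if v \in X then b%:R else 1)).
by apply: eq_bigr => v _; case: ifP => _ /=; ring.
Qed.

Lemma mean_mem p v : mean p (fun Y => (v \in Y)%:R) = p v.
Proof.
transitivity (\prod_(u in [set v]) p u); last by rewrite big_set1.
by rewrite -mean_subset; apply: eq_mean => // Y; rewrite sub1set.
Qed.

Lemma mean_mem2 p u v : u != v ->
  mean p (fun Y => ((u \in Y) && (v \in Y))%:R) = p u * p v.
Proof.
move=> uv; transitivity (\prod_(x in [set u; v]) p x).
  by rewrite -mean_subset; apply: eq_mean => // Y; rewrite subUset !sub1set.
by rewrite big_setU1 ?inE // big_set1.
Qed.

Lemma mean_sqr_card p :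
  mean p (fun X => #|X|%:R ^+ 2) = (\sum_v p v) ^+ 2 + \sum_v p v * (1 - p v).
Proof.
transitivity (\sum_u \sum_v mean p (fun X => ((u \in X) && (v \in X))%:R)).
  under eq_bigr do rewrite -mean_sum.
  rewrite -mean_sum; apply: eq_mean => // X; under eq_bigr do under eq_bigr do rewrite -mulnb natrM.
  under eq_bigr do rewrite -mulr_sumr; rewrite -mulr_suml -expr2 -natr_sum.
  by rewrite -sum1_card big_mkcond; congr (_%:R ^+ 2); apply: eq_bigr => u _; case: (u \in X).
rewrite expr2 mulr_suml -big_split; apply: eq_bigr => u _ /=.
rewrite mulr_sumr (bigD1 u) //= [in RHS](bigD1 u) //= (eq_bigr (fun v => p u * p v)) => [|v vu].
  rewrite (_ : mean p _ = p u); first by ring.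
  by rewrite -[RHS]mean_mem; apply: eq_mean => // X; rewrite andbb.
by rewrite mean_mem2 // eq_sym.
Qed.

Lemma mean_sqr_dev p t :
  mean p (fun Y => (#|Y|%:R - t) ^+ 2) =
    (\sum_v p v - t) ^+ 2 + \sum_v p v * (1 - p v).
Proof.
have mean_card : mean p (fun Y => #|Y|%:R) = \sum_v p v.
  transitivity (mean p (fun Y => \sum_v (v \in Y)%:R)).
    apply: eq_mean => // Y; rewrite -sum1_card natr_sum big_mkcond.
    by apply: eq_bigr => v _; case: (v \in Y).
  by rewrite mean_sum; apply: eq_bigr => v _; apply: mean_mem.
transitivity (mean p (fun Y => (- (2 * t)) * #|Y|%:R + (1 * #|Y|%:R ^+ 2 + t ^+ 2))).
  by apply: eq_mean => // Y; ring.
by rewrite !mean_lin mean_card mean_sqr_card mean_const; ring.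
Qed.

Lemma big_toggle v (F : {set V} -> R) :
  \sum_X F X = \sum_(X : {set V} | v \notin X) (F (v |: X) + F X).
Proof.
rewrite (bigID (fun X => v \notin X)) /= addrC big_split; congr (_ + _).
rewrite (reindex_onto (fun X => v |: X) (fun X => X :\ v)) /= => [|X]; last first.
  by rewrite negbK; apply: setD1K.
apply: eq_bigl => X; rewrite negbK setU11 /=.
by apply/eqP/idP => [<-|/setU1K //]; rewrite setD11.
Qed.

Lemma mean_toggle p psi v : mean p psi =
  \sum_(X : {set V} | v \notin X) (\prod_(u | u != v) (if u \in X then p u else 1 - p u)) *
     (p v * psi (v |: X) + (1 - p v) * psi X).
Proof.
rewrite /mean (big_toggle v); apply: eq_bigr => X vX; rewrite /inclusion_weight.
rewrite !(bigD1 (P := xpredT) v) //= setU11 (negPf vX).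
rewrite (eq_bigr (fun u => if u \in X then p u else 1 - p u)) => [|u uv]; first by ring.
by rewrite in_setU1 (negPf uv).
Qed.

Lemma mean_change p p' psi v : (forall u, u != v -> p' u = p u) ->
  mean p' psi = mean p psi +
    (p' v - p v) * mean p (fun Y => psi (v |: Y) - psi (Y :\ v)).
Proof.
move=> eq_p; rewrite !(mean_toggle _ _ v) mulr_sumr -big_split; apply: eq_bigr => X vX /=.
rewrite setUA setUid (setU1K vX) (setDidPl _); last by rewrite disjoint_sym disjoints1.
rewrite (eq_bigr (fun u => if u \in X then p u else 1 - p u)) => [|u /eq_p-> //].
by ring.
Qed.

Definition pin p v (a : R) : V -> R := fun u => if u == v then a else p u.

Lemma mean_pin p psi v :
  mean p psi = p v * mean (pin p v 1) psi + (1 - p v) * mean (pin p v 0) psi.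
Proof.
have pinE a : mean (pin p v a) psi =
    mean p psi + (a - p v) * mean p (fun Y => psi (v |: Y) - psi (Y :\ v)).
  rewrite (@mean_change p (pin p v a) psi v) /pin ?eqxx // => u uv.
  by rewrite (negPf uv).
by rewrite !pinE; ring.
Qed.

Lemma mean_indicator X psi : mean (fun v => (v \in X)%:R) psi = psi X.
Proof.
rewrite /mean (bigD1 X) //= big1 ?addr0 => [|Y].
  by rewrite /inclusion_weight big1 ?mul1r // => v _; case: (v \in X); rewrite ?subr0.
rewrite eqEsubset negb_and => /orP[] /subsetPn[v vA vB]; rewrite /inclusion_weight (bigD1 v) //=.
  by rewrite vA (negPf vB) !mul0r.
by rewrite vA (negPf vB) subrr !mul0r.
Qed.

End ProductMean.

Section MultilinearExtension.
Variables (R : realType) (V : finType) (h : {set V} -> R) (B : R).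
Hypotheses (h_mono : monotone_setfun h) (h_sub : submodular h).
Hypothesis gain_le : forall X v, gain h X v <= B.
Implicit Types (p : V -> R) (Z O : {set V}).

Definition mean_gain p v : R := mean p (fun X => gain h X v).

Definition raise p (d : R) Z : V -> R := fun v => p v + d * (v \in Z)%:R.

Lemma raise_unit_range p d Z : unit_range p -> 0 <= d ->
  (forall v, v \in Z -> p v + d <= 1) -> unit_range (raise p d Z).
Proof.
move=> p01 d0 pd v; rewrite /raise; have /andP[? ?] := p01 v.
by case: (boolP (v \in Z)) => [/pd ?|_] /=; lra.
Qed.

Lemma mean_raise0 p d psi : mean (raise p d set0) psi = mean p psi.
Proof. by apply: eq_mean => // v; rewrite /raise inE mulr0 addr0. Qed.

Lemma mean_raiseU1 p d Z v psi : v \notin Z ->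
  mean (raise p d (v |: Z)) psi = mean (raise p d Z) psi +
    d * mean (raise p d Z) (fun Y => psi (v |: Y) - psi (Y :\ v)).
Proof.
move=> vZ; rewrite (@mean_change _ _ (raise p d Z) _ _ v) => [|u uv]; last first.
  by rewrite /raise in_setU1 (negPf uv).
by congr (_ + _ * _); rewrite /raise setU11 (negPf vZ) /=; ring.
Qed.

Lemma mean_gain_raise p d Z v : unit_range p -> 0 <= d ->
  (forall u, u \in Z -> p u + d <= 1) ->
  mean_gain p v - d * #|Z|%:R * B <= mean_gain (raise p d Z) v.
Proof.
move=> p01 d0; elim/finset_ind: Z => [_|u Z uZ IH pd].
  by rewrite cards0 mulr0 mul0r subr0 /mean_gain mean_raise0.
have pdZ x : x \in Z -> p x + d <= 1 by move=> xZ; apply/pd/setU1r.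
have drop : - B <= mean (raise p d Z) (fun Y => gain h (u |: Y) v - gain h (Y :\ u) v).
  rewrite -[X in X <= _](mean_const (raise p d Z)).
  apply: mean_le => [|Y]; first exact: raise_unit_range.
  by have := gain_ge0 h_mono (u |: Y) v; have := gain_le (Y :\ u) v; lra.
have := IH pdZ; have := ler_wpM2l d0 drop.
by rewrite /mean_gain mean_raiseU1 // cardsU1 uZ add1n -natr1; lra.
Qed.

Lemma mean_raise_ge p d Z : unit_range p -> 0 <= d ->
  (forall v, v \in Z -> p v + d <= 1) ->
  mean p h + d * \sum_(v in Z) mean_gain p v - (d * #|Z|%:R) ^+ 2 * B <=
  mean (raise p d Z) h.
Proof.
move=> p01 d0; elim/finset_ind: Z => [_|u Z uZ IH pd].
  by rewrite big_set0 cards0 !mulr0 expr2 !mul0r addr0 subr0 mean_raise0.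
have pdZ x : x \in Z -> p x + d <= 1 by move=> xZ; apply/pd/setU1r.
have marginal : mean_gain (raise p d Z) u <=
    mean (raise p d Z) (fun Y => h (u |: Y) - h (Y :\ u)).
  apply: mean_le => [|Y]; first exact: raise_unit_range.
  by rewrite lerD2l lerN2; apply/h_mono/subsetDl.
have le_marginal := le_trans (mean_gain_raise u p01 d0 pdZ) marginal.
have B0 : 0 <= B by apply: le_trans (gain_le set0 u); apply: gain_ge0.
have slack : 0 <= d * d * B * (#|Z|%:R + 1) by rewrite !mulr_ge0 // addr_ge0.
have := ler_wpM2l d0 le_marginal; have := IH pdZ.
rewrite mean_raiseU1 // big_setU1 //= cardsU1 uZ add1n -natr1; lra.
Qed.

Lemma diff_le_sum_mean_gain p O : unit_range p ->
  h O - mean p h <= \sum_(v in O) mean_gain p v.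
Proof.
move=> p01; rewrite /mean_gain -mean_sum.
have -> : h O - mean p h = mean p (fun Y => -1 * h Y + h O).
  by rewrite mean_lin mean_const; ring.
by apply: mean_le => // Y; rewrite mulN1r addrC; apply: diff_le_sum_gain.
Qed.

Lemma mean_gain_range p v : unit_range p -> 0 <= mean_gain p v <= B.
Proof.
move=> p01; rewrite -{1}(mean_const p 0) -(mean_const p B).
by apply/andP; split; apply: mean_le => // Y; apply: gain_ge0.
Qed.

(* One more sample raises the expected squared error by a variance at most B^2. *)
Lemma mean_sqr_error p v (a j : R) : unit_range p ->
  mean p (fun X => (a + gain h X v - (j + 1) * mean_gain p v) ^+ 2) <=
  (a - j * mean_gain p v) ^+ 2 + B ^+ 2.
Proof.
move=> p01; set m := mean_gain p v; have /andP[m0 mB] := mean_gain_range v p01.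
have second_moment : mean p (fun X => gain h X v ^+ 2) <= B * m.
  rewrite -meanZ; apply: mean_le => // Y; rewrite expr2.
  by apply: ler_wpM2r (gain_le Y v); apply: gain_ge0.
have -> : mean p (fun X => (a + gain h X v - (j + 1) * m) ^+ 2) =
    (2 * (a - (j + 1) * m)) * m +
    (1 * mean p (fun X => gain h X v ^+ 2) + (a - (j + 1) * m) ^+ 2).
  rewrite -[X in _ = _ + (_ + X)](mean_const p) -!mean_lin.
  by apply: eq_mean => // Y; ring.
nra.
Qed.

Lemma mean_sum_sqr_error p (a : V -> R) (j : R) : unit_range p ->
  mean p (fun X => \sum_v (a v + gain h X v - (j + 1) * mean_gain p v) ^+ 2) <=
  \sum_v (a v - j * mean_gain p v) ^+ 2 + #|V|%:R * B ^+ 2.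
Proof.
move=> p01; rewrite mean_sum mulr_natl -sumr_const -big_split.
by apply: ler_sum => v _; apply: mean_sqr_error.
Qed.

End MultilinearExtension.

(** * Sparsification by random sampling *)

Section RandomSample.
Variable R : realType.

Lemma expR_le_quadratic (z : R) : `|z| <= 2^-1 -> expR z <= 1 + z + 2 * z ^+ 2.
Proof.
rewrite ler_norml => /andP[z1 z2].
have := expR_ge1Dx (- z); rewrite expRN => inv_ge; have e0 := expR_gt0 z.
have : (1 - z) * expR z <= 1.
  by have := ler_wpM2r (ltW e0) inv_ge; rewrite mulVf ?gt_eqF.
have : 0 <= z ^+ 2 * (1 - 2 * z) by rewrite mulr_ge0 ?sqr_ge0 //; lra.
by move=> ? ?; rewrite -(ler_pM2l (_ : 0 < 1 - z)); [nra|lra].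
Qed.

Lemma exists_le_average (T : finType) (P : pred T) (G : T -> R) (a : R) :
  (exists x, P x) -> \sum_(x | P x) G x <= \sum_(x | P x) a ->
  exists2 x, P x & G x <= a.
Proof.
move=> [x0 Px0]; case: (arg_minP G Px0) => x Px min_x le_sum.
exists x => //; rewrite leNgt; apply/negP => lt_a; move: le_sum; apply/negP.
rewrite -ltNge; apply: ltr_sum => [|y Py]; first by apply/hasP; exists x; rewrite ?mem_index_enum.
exact: lt_le_trans lt_a (min_x y Py).
Qed.

Variables (V : finType) (O : {set V}).

Lemma sum_expR_centred (A : V -> R) (eta : R) :
  0 <= eta <= 2^-1 -> (forall u, `|A u| <= 1) -> \sum_(u in O) A u = 0 ->
  \sum_(u in O) expR (eta * A u) <= #|O|%:R * expR (2 * eta ^+ 2).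
Proof.
move=> /andP[e0 e1] A1 sA.
have : \sum_(u in O) expR (eta * A u) <= \sum_(u in O) (1 + eta * A u + 2 * eta ^+ 2).
  apply: ler_sum => u _; apply: le_trans (expR_le_quadratic _) _.
    by rewrite normrM ger0_norm //; apply: le_trans (ler_wpM2l e0 (A1 u)) _; rewrite mulr1.
  rewrite lerD2l ler_pM2l // exprMn ler_piMr ?sqr_ge0 //.
  by rewrite -real_normK ?num_real // expr_le1.
move/le_trans; apply.
rewrite !big_split /= -mulr_sumr sA mulr0 addr0 !sumr_const -mulrnDl -[X in X <= _]mulr_natl.
by rewrite ler_wpM2l // expR_ge1Dx.
Qed.

Lemma sum_prod_expR_centred r (A : V -> R) (eta : R) :
  0 <= eta <= 2^-1 -> (forall u, `|A u| <= 1) -> \sum_(u in O) A u = 0 ->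
  \sum_(f : {ffun 'I_r -> V} | f \in ffun_on (mem O)) \prod_(t < r) expR (eta * A (f t))
    <= (#|O|%:R * expR (2 * eta ^+ 2)) ^+ r.
Proof.
move=> eta_range A1 sA.
rewrite -(bigA_distr_big _ (fun=> fun u => expR (eta * A u))) prodr_const card_ord.
rewrite lerXn2r ?nnegrE ?mulr_ge0 ?expR_ge0 ?sumr_ge0 // => [u _|]; first exact: expR_ge0.
exact: sum_expR_centred.
Qed.

(* Chernoff's bound and a union bound over the family [A]. *)
Lemma exists_sample_le (T : finType) (A : T -> V -> R) (r s L : nat) :
  (0 < #|O|)%N -> (0 < s)%N -> (#|T| <= 2 ^ L)%N -> (8 * s ^ 2 * L <= r)%N ->
  (forall i u, `|A i u| <= 1) -> (forall i, \sum_(u in O) A i u = 0) ->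
  exists2 f : 'I_r -> V, (forall t, f t \in O) &
    forall i, \sum_(t < r) A i (f t) <= r%:R / s%:R.
Proof.
move=> O0 s0 TL rL A1 sA; have sR : 1 <= s%:R :> R by rewrite ler1n.
pose eta : R := (4 * s%:R)^-1; have eta0 : 0 < eta by rewrite invr_gt0; lra.
have etas : eta * (4 * s%:R) = 1 by rewrite mulVf // gt_eqF //; lra.
have eta_range : 0 <= eta <= 2^-1 by apply/andP; split; [exact: ltW|nra].
pose G (f : {ffun 'I_r -> V}) := \sum_i \prod_(t < r) expR (eta * A i (f t)).
have [f fO Gf] : exists2 f, f \in ffun_on (mem O) & G f <= #|T|%:R * expR (2 * eta ^+ 2) ^+ r.
  apply: exists_le_average.
    by have /card_gt0P[o oO] := O0; exists [ffun=> o]; apply/ffun_onP => t; rewrite ffunE.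
  rewrite exchange_big /= sumr_const card_ffun_on card_ord.
  have -> : #|T|%:R * expR (2 * eta ^+ 2) ^+ r *+ #|O| ^ r =
      \sum_(i : T) (#|O|%:R * expR (2 * eta ^+ 2)) ^+ r.
    by rewrite sumr_const -[LHS]mulr_natl -[RHS]mulr_natl natrX exprMn; ring.
  apply: ler_sum => i _.
  exact: sum_prod_expR_centred.
exists f => [t|i]; first by move/ffun_onP: fO; apply.
have G_le : G f <= expR (4 * eta ^+ 2 * r%:R).
  have TR : #|T|%:R <= expR L%:R :> R.
    apply: (@le_trans _ _ (2 ^+ L)); first by rewrite -natrX ler_nat.
    rewrite -[L%:R]mulr1 expRM_natl lerXn2r ?nnegrE ?expR_ge0 //.
    by have := expR_ge1Dx (1 : R); lra.
  apply: le_trans Gf _; rewrite -expRM_natl; apply: le_trans (ler_wpM2r (expR_ge0 _) TR) _.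
  rewrite -expRD ler_expR.
  have : 2 * eta ^+ 2 * (8 * s ^ 2 * L)%:R <= 2 * eta ^+ 2 * r%:R.
    by rewrite ler_wpM2l ?ler_nat // mulr_ge0 // sqr_ge0.
  have -> : 2 * eta ^+ 2 * (8 * s ^ 2 * L)%:R = (eta * (4 * s%:R)) ^+ 2 * L%:R.
    by rewrite 2!natrM natrX; ring.
  by rewrite etas expr1n mul1r; lra.
have : expR (eta * \sum_(t < r) A i (f t)) <= expR (4 * eta ^+ 2 * r%:R).
  apply: le_trans G_le; rewrite /G (bigD1 i) //= mulr_sumr expR_sum lerDl.
  by apply: sumr_ge0 => j _; apply: prodr_ge0 => t _; apply: expR_ge0.
rewrite ler_expR (_ : 4 * eta ^+ 2 * r%:R = eta * (4 * eta * r%:R)); last by ring.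
rewrite ler_pM2l // => /le_trans; apply; rewrite ler_pdivlMr ?(lt_le_trans ltr01) //.
have -> : 4 * eta * r%:R * s%:R = eta * (4 * s%:R) * r%:R by ring.
by rewrite etas mul1r.
Qed.

Lemma exists_sample_abs_le (T : finType) (A : T -> V -> R) (r s L : nat) :
  (0 < #|O|)%N -> (0 < s)%N -> (#|T| <= 2 ^ L)%N -> (8 * s ^ 2 * L.+1 <= r)%N ->
  (forall i u, `|A i u| <= 1) -> (forall i, \sum_(u in O) A i u = 0) ->
  exists2 f : 'I_r -> V, (forall t, f t \in O) &
    forall i, `|\sum_(t < r) A i (f t)| <= r%:R / s%:R.
Proof.
move=> O0 s0 TL rL A1 sA.
pose signedA (ib : T * bool) u : R := (-1) ^+ ib.2 * A ib.1 u.
have [|ib u|ib|f fO sum_le] := @exists_sample_le _ signedA r s L.+1 O0 s0 _ rL.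
- by rewrite card_prod card_bool expnSr leq_mul2r.
- by rewrite /signedA normrM normrX normrN1 expr1n mul1r.
- by rewrite /signedA -mulr_sumr sA mulr0.
exists f => // i; have := sum_le (i, false); have := sum_le (i, true).
rewrite /signedA -!mulr_sumr expr0 expr1 mulN1r mul1r ler_norml => ? ?.
by apply/andP; split; lra.
Qed.

Lemma sparse_neighbourhood (w : V -> V -> R) (r s L : nat) :
  (forall u v, 0 <= w u v <= 1) ->
  (0 < #|O|)%N -> (0 < s)%N -> (#|V| <= 2 ^ L)%N -> (8 * s ^ 2 * L.+1 <= r)%N ->
  exists2 f : 'I_r -> V, (forall t, f t \in O) &
  forall v, `|#|O|%:R / r%:R * (\sum_(t < r) w (f t) v) - \sum_(u in O) w u v|
            <= #|O|%:R / s%:R.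
Proof.
move=> w01 O0 s0 VL rL.
have r0 : 0 < r%:R :> R by rewrite ltr0n; apply: leq_trans rL; rewrite !muln_gt0 /= s0.
have k0 : 0 < #|O|%:R :> R by rewrite ltr0n.
pose deg v : R := \sum_(x in O) w x v.
pose A v u : R := w u v - deg v / #|O|%:R.
have [u v|v|f fO sum_le] := exists_sample_abs_le O0 s0 VL rL (A := A).
- have : 0 <= deg u / #|O|%:R <= 1.
    rewrite divr_ge0 ?sumr_ge0 ?(ltW k0) //=; last by move=> x _; case/andP: (w01 x u).
    rewrite ler_pdivrMr // mul1r -sum1_card natr_sum.
    by apply: ler_sum => x _; case/andP: (w01 x u).
  have /andP[? ?] := w01 v u.
  by move=> /andP[? ?]; rewrite ler_norml; apply/andP; split; rewrite /A; lra.
- rewrite big_split /= sumr_const -[_ *+ _]mulr_natl mulrN [_ * (_ / _)]mulrC divfK ?subrr //.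
  by rewrite gt_eqF.
exists f => // v.
have -> : #|O|%:R / r%:R * (\sum_(t < r) w (f t) v) - \sum_(u in O) w u v =
    #|O|%:R / r%:R * \sum_(t < r) A v (f t).
  rewrite /A big_split /= sumr_const card_ord -/(deg v) -[_ *+ r]mulr_natl.
  by field; rewrite !gt_eqF.
have kr0 : 0 <= #|O|%:R / r%:R :> R by rewrite divr_ge0 // ltW.
rewrite normrM ger0_norm //; apply: le_trans (ler_wpM2l kr0 (sum_le v)) _.
by rewrite mulrA divfK // gt_eqF.
Qed.

End RandomSample.

(** * The greedy potential *)

Definition pair_scale (R : realType) (k : nat) : R := 1 / (k%:R * (k%:R - 1)).

Section PairScale.
Variables (R : realType) (k : nat).
Local Notation kappa := (pair_scale R k).

Lemma pair_scale_small : (k <= 1)%N -> kappa = 0.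
Proof.
by rewrite /pair_scale; case: k => [|[|]] //; rewrite ?mul0r ?subrr ?mulr0 invr0 mulr0.
Qed.

Lemma pair_scale_ge0 : 0 <= kappa.
Proof.
have [/pair_scale_small-> //|k_gt1] := leqP k 1.
by rewrite divr_ge0 // mulr_ge0 // subr_ge0 ler1n ltnW.
Qed.

Hypothesis k_gt1 : (1 < k)%N.

Lemma pair_scaleK : kappa * (k%:R * (k%:R - 1)) = 1.
Proof.
have k2 : 2 <= k%:R :> R by rewrite ler_nat.
by rewrite /pair_scale mul1r mulVf // mulf_neq0 // gt_eqF //; lra.
Qed.

Lemma pair_scale_sqr_le2 : kappa * k%:R ^+ 2 <= 2.
Proof.
have k2 : 2 <= k%:R :> R by rewrite ler_nat.
have : kappa * k%:R ^+ 2 <= kappa * (2 * (k%:R * (k%:R - 1))).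
  by apply: ler_wpM2l; [exact: pair_scale_ge0|nra].
by have := pair_scaleK; lra.
Qed.

End PairScale.

Section QuadraticForm.
Variables (R : realType) (V : finType) (w : V -> V -> R).
Hypothesis w01 : forall u v, 0 <= w u v <= 1.
Implicit Types (z p : V -> R) (X T Z : {set V}).

Definition quad z : R := \sum_u \sum_v z u * z v * w u v.

Definition pairs X : R := \sum_(u in X) \sum_(v in X) w u v.

Lemma pairs_quad X : pairs X = quad (fun v => (v \in X)%:R).
Proof.
rewrite /pairs big_mkcond; apply: eq_bigr => u _; case: (u \in X); last first.
  by rewrite big1 // => v _; rewrite !mul0r.
rewrite big_mkcond; apply: eq_bigr => v _.
by case: (v \in X); rewrite ?mul1r ?mulr0 ?mul0r.
Qed.

Lemma quadZ a z : quad (fun v => a * z v) = a ^+ 2 * quad z.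
Proof.
rewrite /quad mulr_sumr; apply: eq_bigr => u _; rewrite mulr_sumr.
by apply: eq_bigr => v _; ring.
Qed.

Lemma quad_ge0 z : (forall v, 0 <= z v) -> 0 <= quad z.
Proof.
move=> z0; apply: sumr_ge0 => u _; apply: sumr_ge0 => v _.
by rewrite !mulr_ge0 //; case/andP: (w01 u v).
Qed.

Lemma pairs_ge0 X : 0 <= pairs X.
Proof. by rewrite pairs_quad quad_ge0. Qed.

Lemma quad_add_set_ge z Z : (forall u v, w u v = w v u) ->
  quad z + 2 * \sum_(v in Z) \sum_u z u * w u v <= quad (fun v => z v + (v \in Z)%:R).
Proof.
move=> wC; pose e v : R := (v \in Z)%:R.
have -> : quad (fun v => z v + e v) =
    quad z + (\sum_u \sum_v z u * e v * w u v + \sum_u \sum_v e u * z v * w u v) + quad e.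
  rewrite /quad -!big_split; apply: eq_bigr => u _ /=; rewrite -!big_split.
  by apply: eq_bigr => v _ /=; ring.
have -> : \sum_u \sum_v e u * z v * w u v = \sum_u \sum_v z u * e v * w u v.
  rewrite exchange_big; apply: eq_bigr => u _; apply: eq_bigr => v _.
  by rewrite (wC v u); ring.
have -> : \sum_u \sum_v z u * e v * w u v = \sum_(v in Z) \sum_u z u * w u v.
  rewrite exchange_big [RHS]big_mkcond; apply: eq_bigr => v _ /=; rewrite /e.
  case: (v \in Z); last by rewrite big1 // => u _; rewrite mulr0 mul0r.
  by apply: eq_bigr => u _; rewrite mulr1.
have : 0 <= quad e by apply: quad_ge0 => v.
lra.
Qed.

Lemma mean_pairs p : (forall v, w v v = 0) -> mean p pairs = quad p.
Proof.
move=> wxx; transitivity (mean p (fun X => \sum_u \sum_v w u v * ((u \in X) && (v \in X))%:R)).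
  apply: eq_mean => // X; rewrite pairs_quad; apply: eq_bigr => u _; apply: eq_bigr => v _.
  by case: (u \in X); case: (v \in X); rewrite ?mulr1 ?mulr0 ?mul1r ?mul0r.
rewrite mean_sum; apply: eq_bigr => u _; rewrite mean_sum; apply: eq_bigr => v _.
rewrite meanZ; have [->|uv] := eqVneq u v; first by rewrite wxx mul0r mulr0.
by rewrite mean_mem2 // mulrC.
Qed.

Lemma pairs_mono X T : X \subset T -> pairs X <= pairs T.
Proof.
move=> sXT; rewrite !pairs_quad; apply: ler_sum => u _; apply: ler_sum => v _.
have /andP[w0 _] := w01 u v; apply: ler_wpM2r => //.
have le_mem x : (x \in X)%:R <= (x \in T)%:R :> R.
  by case: (boolP (x \in X)) => [/(subsetP sXT)->|].
by apply: ler_pM.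
Qed.

Lemma pairs_diff_le X T : T \subset X ->
  pairs X - pairs T <= #|X|%:R ^+ 2 - #|T|%:R ^+ 2.
Proof.
move=> sTX.
have sqr_card (S : {set V}) : #|S|%:R ^+ 2 = \sum_u \sum_v (u \in S)%:R * (v \in S)%:R :> R.
  under eq_bigr do rewrite -mulr_sumr.
  by rewrite -mulr_suml -natr_sum -expr2 -sum1_card [in LHS]big_mkcond;
    congr (_%:R ^+ 2); apply: eq_bigr => u _; case: (u \in S).
rewrite !pairs_quad !sqr_card /quad -!sumrB; apply: ler_sum => u _; rewrite -!sumrB.
apply: ler_sum => v _; have /andP[w0 w1] := w01 u v; rewrite -mulrBl ler_piMr //.
by rewrite subr_ge0; apply: ler_pM => //; case: (boolP (_ \in T)) => // /(subsetP sTX)->.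
Qed.

Lemma pairs_le1 T : (forall v, w v v = 0) -> pair_scale R #|T| * pairs T <= 1.
Proof.
move=> wxx; have [/pair_scale_small->|T_gt1] := leqP #|T| 1; first by rewrite mul0r ler01.
rewrite -(pair_scaleK R T_gt1) ler_wpM2l ?pair_scale_ge0 //.
apply: (@le_trans _ _ (\sum_(u in T) \sum_(v in T | v != u) 1)).
  apply: ler_sum => u uT; rewrite (bigD1 u) //= wxx add0r.
  by apply: ler_sum => v _; case/andP: (w01 u v).
rewrite mulr_natl -sumr_const le_eqVlt; apply/orP; left; apply/eqP.
apply: eq_bigr => u uT; rewrite -[#|T|]sum1_card natr_sum [in RHS](bigD1 u) //=; ring.
Qed.

End QuadraticForm.

Definition add_set (V : finType) (c : {ffun V -> nat}) (Z : {set V}) : {ffun V -> nat} :=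
  [ffun v => c v + (v \in Z)]%N.

Definition fractional (R : realType) (V : finType) (N : nat) (c : {ffun V -> nat}) : V -> R :=
  fun v => N%:R^-1 * (c v)%:R.

Lemma fractional_add_set (R : realType) (V : finType) N (c : {ffun V -> nat}) Z :
  fractional R N (add_set c Z) =1 raise (fractional R N c) N%:R^-1 Z.
Proof. by move=> v; rewrite /fractional /raise ffunE natrD mulrDr. Qed.

Lemma fractional_unit_range (R : realType) (V : finType) N (c : {ffun V -> nat}) :
  (0 < N)%N -> (forall v, c v <= N)%N -> unit_range (fractional R N c).
Proof.
move=> N0 cN v; rewrite /fractional mulr_ge0 ?invr_ge0 //=.
by rewrite mulrC ler_pdivrMr ?ltr0n // mul1r ler_nat.
Qed.

Section Potential.
Variables (R : realType) (V : finType) (h : {set V} -> R) (w : V -> V -> R).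
Hypotheses (h_ge0 : forall X, 0 <= h X) (h_mono : monotone_setfun h) (h_sub : submodular h).
Hypotheses (w01 : forall u v, 0 <= w u v <= 1) (wC : forall u v, w u v = w v u).

(* [y] approximates within [E] the degrees into the optimum [O], [B] bounds the
   gains of [h], and [tau] is the tolerance for sampling errors. *)
Variables (N k : nat) (y : V -> R) (O : {set V}) (B E tau : R).
Hypotheses (gain_le : forall X v, gain h X v <= B) (kO : #|O| = k).
Hypothesis yE : forall u, `|y u - \sum_(v in O) w u v| <= E.

Local Notation fractional := (fractional R N).
Local Notation kappa := (pair_scale R k).
Local Notation marginal c v := (mean_gain h (fractional c) v).
Implicit Types (c : {ffun V -> nat}) (acc : V -> R) (Z : {set V}) (j : nat).

Definition decay j : R := (1 - N%:R^-1) ^+ (N - j).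

Definition pair_score j c v : R :=
  \sum_u (c u)%:R * w u v + (N - j - 1)%N%:R * y v.

Definition greedy_score j acc c v : R :=
  decay j.+1 * acc v + 2 * kappa * pair_score j c v.

Definition noise_rate : R := (2 * tau * N%:R ^+ 2)^-1.

Definition step_error : R := 2 * kappa * k%:R * E / N%:R + (N%:R^-1 * k%:R) ^+ 2 * B +
  #|V|%:R * tau / (2 * N%:R ^+ 2) + noise_rate * (N%:R * #|V|%:R) * B ^+ 2.

Definition reward_part j c : R :=
  decay j * mean (fractional c) h + (1 - decay j) * h O.

(* The pairs already formed, and those that the remaining N - j steps would
   form if each of them took [O], the latter being estimated through [y]. *)
Definition pair_part j c : R :=
  quad w (fun v => (c v)%:R) + 2 * (N - j)%N%:R * \sum_v (c v)%:R * y v +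
  (N - j)%N%:R * ((N - j)%N%:R - 1) * (pairs w O - k%:R * E).

Definition potential j c : R :=
  reward_part j c + kappa / N%:R ^+ 2 * pair_part j c - (N - j)%N%:R * step_error.

Lemma pair_part_step j c Z : (j < N)%N -> (\sum_v c v = j * k)%N ->
  pair_part j c +
    2 * (\sum_(v in Z) pair_score j c v - \sum_(v in O) pair_score j c v) -
    2 * (j%:R * k%:R * E) <= pair_part j.+1 (add_set c Z).
Proof.
move=> jN csum; have := quad_add_set_ge w01 (fun v => (c v)%:R) Z wC.
have quadE : quad w (fun v => (c v)%:R + (v \in Z)%:R) = quad w (fun v => (add_set c Z v)%:R).
  by apply: eq_bigr => u _; apply: eq_bigr => v _; rewrite !ffunE !natrD.
have yE' : \sum_v (add_set c Z v)%:R * y v = \sum_v (c v)%:R * y v + \sum_(v in Z) y v.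
  rewrite [X in _ + X]big_mkcond -big_split; apply: eq_bigr => v _ /=.
  by rewrite ffunE natrD mulrDl; case: (v \in Z); rewrite ?mul1r ?mul0r.
have scoreE (S : {set V}) : \sum_(v in S) pair_score j c v =
    \sum_(v in S) \sum_u (c u)%:R * w u v + (N - j - 1)%N%:R * \sum_(v in S) y v.
  by rewrite /pair_score big_split /= -mulr_sumr.
have degree_le : \sum_v (c v)%:R * y v - j%:R * k%:R * E <=
    \sum_(v in O) \sum_u (c u)%:R * w u v.
  rewrite exchange_big /= -natrM -csum natr_sum mulr_suml -sumrB.
  apply: ler_sum => u _; rewrite -mulrBr -mulr_sumr ler_wpM2l //.
  by have := yE u; rewrite ler_norml => /andP[_]; lra.
have estimate_ge : pairs w O - k%:R * E <= \sum_(v in O) y v.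
  rewrite /pairs -kO mulr_natl -sumr_const -sumrB; apply: ler_sum => u _.
  by have := yE u; rewrite ler_norml => /andP[lo _]; lra.
rewrite /pair_part quadE yE' !scoreE (subnS N j) -subn1.
have -> : (N - j)%N%:R = (N - j - 1)%N%:R + 1 :> R by rewrite natr1; congr (_%:R); lia.
set m : R := (N - j - 1)%N%:R; have m0 : 0 <= m by [].
have := ler_wpM2l m0 estimate_ge; lra.
Qed.

Hypothesis N_gt0 : (0 < N)%N.

Let N_gt0R : 0 < N%:R :> R.
Proof. by rewrite ltr0n. Qed.

Lemma decay_range j : 0 <= decay j <= 1.
Proof.
have i1 : N%:R^-1 <= 1 :> R by rewrite invf_le1 // ler1n.
have i0 : 0 <= N%:R^-1 :> R by rewrite invr_ge0.
by rewrite /decay exprn_ge0 ?exprn_ile1 //; lra.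
Qed.

Lemma decayS j : (j < N)%N -> decay j = decay j.+1 * (1 - N%:R^-1).
Proof. by move=> jN; rewrite /decay -exprSr -subSn. Qed.

Lemma decay0_le : decay 0 <= (expR 1)^-1.
Proof.
have i1 : N%:R^-1 <= 1 :> R by rewrite invf_le1 // ler1n.
have <- : expR (- N%:R^-1) ^+ N = (expR 1)^-1 :> R.
  by rewrite -expRM_natl mulrN mulfV ?gt_eqF // expRN.
by rewrite /decay subn0 lerXn2r ?nnegrE ?expR_ge0 ?subr_ge0 // expR_ge1Dx.
Qed.

Lemma reward_part_step j c Z : (j < N)%N -> (forall v, c v <= j)%N -> #|Z| = k ->
  reward_part j c +
    decay j.+1 / N%:R * (\sum_(v in Z) marginal c v - \sum_(v in O) marginal c v) -
    (N%:R^-1 * k%:R) ^+ 2 * B <= reward_part j.+1 (add_set c Z).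
Proof.
move=> jN cj kZ; set i : R := N%:R^-1; have i0 : 0 <= i by rewrite invr_ge0.
have x01 : unit_range (fractional c).
  by apply: fractional_unit_range => // v; apply: leq_trans (cj v) (ltnW jN).
have xi v : v \in Z -> fractional c v + i <= 1.
  move=> _; rewrite /fractional -[X in _ + X]mulr1 -mulrDr natr1.
  by rewrite mulrC ler_pdivrMr // mul1r ler_nat (leq_ltn_trans (cj v)).
have := mean_raise_ge h_mono gain_le x01 i0 xi.
rewrite -(eq_mean (fractional_add_set R N c Z) (frefl h)) kZ.
have := diff_le_sum_mean_gain h_mono h_sub O x01.
rewrite /reward_part (decayS jN).
set GO := \sum_(v in O) _; set GZ := \sum_(v in Z) _; set F := mean (fractional c) h.
set F' := mean _ h; set a := decay j.+1; set err := (i * _) ^+ 2 * B => gO gZ.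
have /andP[a0 a1] : 0 <= a <= 1 := decay_range j.+1.
have err0 : 0 <= (1 - a) * err.
  case: (posnP k) => [k0|k_gt0]; first by rewrite /err k0 mulr0 expr2 !mul0r mulr0.
  have /card_gt0P[o _] : (0 < #|O|)%N by rewrite kO.
  have B0 : 0 <= B by apply: le_trans (gain_le O o); apply: gain_ge0.
  by rewrite !mulr_ge0 ?sqr_ge0 // subr_ge0.
have := ler_wpM2l a0 gZ; have := ler_wpM2l (mulr_ge0 a0 i0) gO; rewrite -/i; lra.
Qed.

Hypothesis tau_gt0 : 0 < tau.

Lemma sum_diff_le_sqr (e : V -> R) (X Y : {set V}) :
  \sum_(v in X) e v - \sum_(v in Y) e v <=
  (2 * tau)^-1 * \sum_v e v ^+ 2 + #|V|%:R * tau / 2.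
Proof.
have -> : #|V|%:R * tau / 2 = \sum_(v : V) tau / 2.
  by rewrite -mulr_suml sumr_const mulr_natl.
rewrite mulr_sumr -big_split /= [\sum_(v in X) _]big_mkcond.
rewrite [\sum_(v in Y) _]big_mkcond -sumrB /=; apply: ler_sum => v _.
have amgm : `|e v| <= (2 * tau)^-1 * e v ^+ 2 + tau / 2.
  rewrite -(ler_pM2l (_ : 0 < 2 * tau)) ?mulr_gt0 // mulrDr mulrA mulfV ?mul1r; last first.
    by rewrite mulf_neq0 ?gt_eqF.
  by rewrite -[e v ^+ 2]real_normK ?num_real //; have := sqr_ge0 (`|e v| - tau); nra.
have := ler_norm (e v); have := ler_norm (- e v); rewrite normrN.
by have := normr_ge0 (e v); case: (v \in X); case: (v \in Y); lra.
Qed.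

Lemma score_gap j acc c Z :
  \sum_(v in O) greedy_score j acc c v <= \sum_(v in Z) greedy_score j acc c v ->
  decay j.+1 / N%:R * (\sum_(v in O) marginal c v - \sum_(v in Z) marginal c v) +
    kappa / N%:R ^+ 2 *
      (2 * (\sum_(v in O) pair_score j c v - \sum_(v in Z) pair_score j c v)) <=
  noise_rate * \sum_v (acc v - N%:R * marginal c v) ^+ 2 + #|V|%:R * tau / (2 * N%:R ^+ 2).
Proof.
pose e v := acc v - N%:R * marginal c v.
have scoreE (S : {set V}) : \sum_(v in S) greedy_score j acc c v =
    decay j.+1 * (\sum_(v in S) e v + N%:R * \sum_(v in S) marginal c v) +
    2 * kappa * \sum_(v in S) pair_score j c v.
  rewrite [N%:R * _]mulr_sumr -big_split !mulr_sumr -big_split /=.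
  by apply: eq_bigr => v _; rewrite /greedy_score /e subrK.
rewrite !scoreE; set GO := \sum_(v in O) mean_gain _ _ _; set GZ := \sum_(v in Z) mean_gain _ _ _.
set PO := \sum_(v in O) pair_score _ _ _; set PZ := \sum_(v in Z) pair_score _ _ _ => top.
have /andP[a0 a1] := decay_range j.+1; set a := decay j.+1 in a0 a1 top *.
have noise := sum_diff_le_sqr e Z O; have noise0 := sum_diff_le_sqr e set0 set0.
rewrite !big_set0 subr0 in noise0.
set S := \sum_v _ ^+ 2 in noise noise0 *.
set NS := (2 * tau)^-1 * S + #|V|%:R * tau / 2 in noise noise0.
have a_noise := le_trans (ler_wpM2l a0 noise) (ler_piMl noise0 a1).
have i20 : 0 <= N%:R ^- 2 :> R by rewrite invr_ge0 sqr_ge0.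
have -> : noise_rate * S + #|V|%:R * tau / (2 * N%:R ^+ 2) = N%:R ^- 2 * NS.
  by rewrite /noise_rate /NS; field; rewrite !gt_eqF.
have -> : a / N%:R * (GO - GZ) + kappa / N%:R ^+ 2 * (2 * (PO - PZ)) =
    N%:R ^- 2 * (a * (N%:R * (GO - GZ)) + 2 * kappa * (PO - PZ)) by field; rewrite gt_eqF.
by apply: ler_wpM2l => //; lra.
Qed.

Lemma potential_step j acc c Z : (j < N)%N ->
  (forall v, (c v <= j)%N) -> (\sum_v c v = j * k)%N -> #|Z| = k ->
  \sum_(v in O) greedy_score j acc c v <= \sum_(v in Z) greedy_score j acc c v ->
  potential j c + noise_rate * (N%:R * #|V|%:R) * B ^+ 2 <=
  potential j.+1 (add_set c Z) +
    noise_rate * \sum_v (acc v - N%:R * marginal c v) ^+ 2.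
Proof.
move=> jN cj csum kZ /score_gap gap.
have reward_step := reward_part_step jN cj kZ.
have scale0 : 0 <= kappa / N%:R ^+ 2 by rewrite divr_ge0 ?sqr_ge0 ?pair_scale_ge0.
have pair_step := ler_wpM2l scale0 (pair_part_step Z jN csum).
have kE0 : 0 <= k%:R * E.
  case: (posnP k) => [->|k_gt0]; first by rewrite mul0r.
  have /card_gt0P[o _] : (0 < #|O|)%N by rewrite kO.
  by rewrite mulr_ge0 //; apply: le_trans (yE o); apply: normr_ge0.
have estimate_error : kappa / N%:R ^+ 2 * (j%:R * k%:R * E) <= kappa * k%:R * E / N%:R.
  have -> : kappa * k%:R * E / N%:R = kappa / N%:R ^+ 2 * (N%:R * (k%:R * E)).
    by field; rewrite gt_eqF.
  by rewrite -[j%:R * _ * E]mulrA ler_wpM2l // ler_wpM2r // ler_nat ltnW.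
rewrite /potential; have -> : (N - j)%N%:R = (N - j.+1)%N%:R + 1 :> R.
  by rewrite natr1; congr (_%:R); lia.
have errE : step_error = 2 * (kappa * k%:R * E / N%:R) + (N%:R^-1 * k%:R) ^+ 2 * B +
    #|V|%:R * tau / (2 * N%:R ^+ 2) + noise_rate * (N%:R * #|V|%:R) * B ^+ 2.
  by rewrite /step_error !mulrA.
move: reward_step pair_step gap estimate_error; rewrite {2}errE.
by rewrite !(mulrBr, mulrDr, mulrDl); lra.
Qed.

Lemma potential_start :
  (1 - (expR 1)^-1) * h O + (1 - N%:R^-1) * (kappa * (pairs w O - k%:R * E))
    - N%:R * step_error <= potential 0 [ffun=> 0%N].
Proof.
set c : {ffun V -> nat} := [ffun=> 0%N]; have c0 v : c v = 0%N by rewrite ffunE.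
have mean0 : 0 <= mean (fractional c) h.
  rewrite -(mean_const (fractional c) 0); apply: mean_le => // v.
  by rewrite /fractional c0 mulr0 lexx ler01.
have /andP[a0 a1] := decay_range 0.
have := mulr_ge0 a0 mean0; have := ler_wpM2r (h_ge0 O) decay0_le.
rewrite /potential /pair_part /reward_part subn0.
have -> : quad w (fun v => (c v)%:R) = 0.
  by apply: big1 => u _; apply: big1 => v _; rewrite c0 !mul0r.
have -> : \sum_v (c v)%:R * y v = 0 by apply: big1 => u _; rewrite c0 mul0r.
have -> : kappa / N%:R ^+ 2 * (0 + 2 * N%:R * 0 +
      N%:R * (N%:R - 1) * (pairs w O - k%:R * E)) =
    (1 - N%:R^-1) * (kappa * (pairs w O - k%:R * E)) by field; rewrite gt_eqF.
lra.
Qed.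

Lemma potential_end c : potential N c = mean (fractional c) h + kappa * quad w (fractional c).
Proof.
by rewrite /potential /reward_part /pair_part /decay subnn expr0 quadZ exprVn; ring.
Qed.

End Potential.

Lemma sum_le_top (R : realType) (V : finType) (I O Z : {set V}) (f : V -> R) :
  I \subset O -> #|O| = #|Z| ->
  (forall u v, u \in Z -> u \notin I -> v \notin Z -> f v <= f u) ->
  \sum_(v in O) f v <= \sum_(v in Z) f v.
Proof.
move=> sIO eOZ top.
rewrite (big_setID Z) /= [X in _ <= X](big_setID O) /= setIC lerD2l.
have eD : #|O :\: Z| = #|Z :\: O|.
  by apply/eqP; rewrite -(eqn_add2l #|O :&: Z|) cardsID setIC cardsID eOZ.
have [OZ0|[v0 v0D]] := set_0Vmem (O :\: Z).
  by rewrite OZ0 cards0 in eD *; rewrite big_set0 (cards0_eq (esym eD)) big_set0.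
case: (arg_maxP f v0D) => v vD vmax.
apply: (@le_trans _ _ (\sum_(u in O :\: Z) f v)); first by apply: ler_sum => u /vmax.
rewrite sumr_const eD -sumr_const; apply: ler_sum => u; rewrite inE => /andP[uO uZ].
have /setDP[_ vZ] : v \in O :\: Z := vD; apply: top => //.
by apply: contra uO; apply: (subsetP sIO).
Qed.

(** * Rounding *)

(* [T] arises from [X] by adding vertices, or by removing one vertex outside [I]
   at a time, each time one whose loss is at most the average. *)
Definition resized (R : realType) (V : finType) (h : {set V} -> R) (I : {set V}) (k : nat)
    (X T : {set V}) : Prop :=
  [/\ I \subset T, #|T| = k, ((#|X| <= k)%N -> X \subset T) &
      ((k <= #|X|)%N -> T \subset X /\
         (k - #|I|)%:R * h X <= (#|X| - #|I|)%:R * h T)].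

Section Rounding.
Variables (R : realType) (V : finType) (h : {set V} -> R) (w : V -> V -> R).
Hypothesis h_mono : monotone_setfun h.
Hypothesis w01 : forall u v, 0 <= w u v <= 1.
Hypothesis wxx : forall v, w v v = 0.
Variables (I : {set V}) (k : nat) (H : R) (s : nat).
Hypotheses (H_ge0 : 0 <= H) (s_gt0 : (0 < s)%N) (I_lt_k : (#|I| < k)%N).
Local Notation kappa := (pair_scale R k).
Implicit Types (X T : {set V}) (p : V -> R).

Definition free_places : R := (k - #|I|)%:R.
Local Notation m := free_places.

Definition loss_per_vertex : R := H / m + 2 * kappa * k%:R.

Definition excess_bound (a : R) : R := s%:R / (2 * m) * a ^+ 2 + m / (2 * s%:R).

Definition rounded_value X : R :=
  h X + kappa * pairs w X -
  (excess_bound (#|X|%:R - k%:R) * loss_per_vertex + kappa * (#|X|%:R - k%:R) ^+ 2).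

Let m_gt0 : 0 < m.
Proof. by rewrite ltr0n subn_gt0. Qed.

Let s_gt0R : 0 < s%:R :> R.
Proof. by rewrite ltr0n. Qed.

Lemma loss_per_vertex_ge0 : 0 <= loss_per_vertex.
Proof.
apply: addr_ge0; first by rewrite divr_ge0 // ltW.
by rewrite mulr_ge0 // mulr_ge0 // pair_scale_ge0.
Qed.

Lemma le_excess_bound a : a <= excess_bound a.
Proof.
rewrite -subr_ge0.
have -> : excess_bound a - a = (s%:R * a - m) ^+ 2 / (2 * s%:R * m).
  by rewrite /excess_bound; field; rewrite !gt_eqF.
by rewrite divr_ge0 ?sqr_ge0 // !mulr_ge0 ?ltW.
Qed.

Lemma excess_bound_ge0 a : 0 <= excess_bound a.
Proof.
apply: addr_ge0; last by rewrite divr_ge0 ?mulr_ge0 ?ltW.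
by rewrite mulr_ge0 ?sqr_ge0 // divr_ge0 ?mulr_ge0 ?ltW.
Qed.

Lemma removal_loss X T : I \subset X -> #|T| = k -> (k <= #|X|)%N -> T \subset X ->
  (k - #|I|)%:R * h X <= (#|X| - #|I|)%:R * h T -> h T <= H ->
  h X + kappa * pairs w X <= h T + kappa * pairs w T +
    (#|X|%:R - k%:R) * loss_per_vertex + kappa * (#|X|%:R - k%:R) ^+ 2.
Proof.
move=> sIX kT le_kX sTX; set a : R := _ - _.
have a0 : 0 <= a by rewrite subr_ge0 ler_nat.
have -> : (#|X| - #|I|)%:R = m + a.
  by rewrite /free_places /a natrB ?subset_leq_card // natrB ?(ltnW I_lt_k) //; ring.
rewrite -/m => hXT hT.
have h_loss : h X - h T <= a * (H / m).
  rewrite -(ler_pM2l m_gt0) (_ : m * (a * (H / m)) = a * H); last by field; rewrite gt_eqF.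
  by have := ler_wpM2l a0 hT; lra.
have pair_loss : kappa * (pairs w X - pairs w T) <= kappa * (2 * k%:R * a + a ^+ 2).
  apply: ler_wpM2l; first exact: pair_scale_ge0.
  apply: le_trans (pairs_diff_le w01 sTX) _.
  by rewrite kT /a le_eqVlt; apply/orP; left; apply/eqP; ring.
by rewrite /loss_per_vertex; lra.
Qed.

Lemma rounded_value_le X T : I \subset X -> resized h I k X T -> h T <= H ->
  rounded_value X <= h T + kappa * pairs w T.
Proof.
move=> sIX [sIT kT up down] hT; rewrite /rounded_value.
have loss0 := loss_per_vertex_ge0; have kappa0 := pair_scale_ge0 R k.
case: (leqP #|X| k) => [le_Xk|/ltnW le_kX].
  have h_le : h X <= h T := h_mono (up le_Xk).
  have pairs_le : kappa * pairs w X <= kappa * pairs w T.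
    by rewrite ler_wpM2l // pairs_mono // up.
  have := mulr_ge0 (excess_bound_ge0 (#|X|%:R - k%:R)) loss0.
  by have := mulr_ge0 kappa0 (sqr_ge0 (#|X|%:R - k%:R)); lra.
have [sTX hXT] := down le_kX.
have := removal_loss sIX kT le_kX sTX hXT hT.
by have := ler_wpM2r loss0 (le_excess_bound (#|X|%:R - k%:R)); lra.
Qed.

Lemma mean_rounded_value_ge p : unit_range p -> \sum_v p v = k%:R ->
  (forall v, v \in I -> p v = 1) ->
  mean p h + kappa * quad w p -
    ((s%:R / 2 + m / (2 * s%:R)) * loss_per_vertex + kappa * m)
  <= mean p rounded_value.
Proof.
move=> p01 sp pI; have kappa0 := pair_scale_ge0 R k.
set sqr_coef := s%:R / (2 * m) * loss_per_vertex + kappa.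
set fixed_loss := m / (2 * s%:R) * loss_per_vertex.
have sqr_coef_ge0 : 0 <= sqr_coef.
  by rewrite addr_ge0 // mulr_ge0 ?loss_per_vertex_ge0 // divr_ge0 // mulr_ge0 // ltW.
have -> : mean p rounded_value = 1 * mean p h + (kappa * mean p (pairs w) +
    (- sqr_coef * mean p (fun X => (#|X|%:R - k%:R) ^+ 2) + - fixed_loss)).
  rewrite -[X in _ = _ + (_ + (_ + X))](mean_const p) -!mean_lin.
  by apply: eq_mean => // X; rewrite /rounded_value /excess_bound /sqr_coef /fixed_loss; ring.
rewrite (mean_pairs _ wxx) mean_sqr_dev sp subrr expr2 mul0r add0r.
have variance_le : \sum_v p v * (1 - p v) <= m.
  have -> : m = \sum_v p v * (v \notin I)%:R.
    rewrite /free_places natrB ?(ltnW I_lt_k) // -sp -sum1_card natr_sum.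
    rewrite [\sum_(i in I) _]big_mkcond -sumrB; apply: eq_bigr => v _.
    by case: (boolP (v \in I)) => [/pI->|_] /=; ring.
  apply: ler_sum => v _; have /andP[? ?] := p01 v.
  by case: (boolP (v \in I)) => [/pI->|_] /=; nra.
have -> : (s%:R / 2 + m / (2 * s%:R)) * loss_per_vertex + kappa * m = sqr_coef * m + fixed_loss.
  by rewrite /sqr_coef /fixed_loss; field; rewrite !gt_eqF.
by have := ler_wpM2l sqr_coef_ge0 variance_le; lra.
Qed.

Lemma rounding_error_le : (1 < k)%N -> (s ^ 2 <= k - #|I|)%N ->
  (s%:R / 2 + m / (2 * s%:R)) * loss_per_vertex + kappa * m <= (H + 6) / s%:R.
Proof.
move=> k1 sk; have sR : 1 <= s%:R :> R by rewrite ler1n.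
have sm : s%:R ^+ 2 <= m by rewrite -natrX ler_nat.
have mk : m <= k%:R by rewrite ler_nat leq_subr.
have kappa0 := pair_scale_ge0 R k; have kappa2 := pair_scale_sqr_le2 R k1.
have avg_le : s%:R / 2 + m / (2 * s%:R) <= m / s%:R.
  rewrite -(ler_pM2r s_gt0R) divfK ?gt_eqF //.
  have -> : (s%:R / 2 + m / (2 * s%:R)) * s%:R = (s%:R ^+ 2 + m) / 2 by field; rewrite gt_eqF.
  by lra.
apply: le_trans (lerD (ler_wpM2r loss_per_vertex_ge0 avg_le) (lexx _)) _.
have -> : m / s%:R * loss_per_vertex = (H + 2 * (kappa * k%:R * m)) / s%:R.
  by rewrite /loss_per_vertex; field; rewrite !gt_eqF.
have km_le : kappa * k%:R * m <= 2.
  by apply: le_trans kappa2; rewrite expr2 mulrA ler_wpM2l // mulr_ge0.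
have kappa_m_le : kappa * m <= 2 / s%:R.
  rewrite ler_pdivlMr //; apply: le_trans km_le.
  rewrite mulrAC ler_wpM2r ?(ltW m_gt0) // ler_wpM2l //.
  by apply: le_trans mk; apply: le_trans sm; rewrite expr2 ler_peMr //; lra.
have -> : (H + 6) / s%:R = (H + 4) / s%:R + 2 / s%:R by ring.
by apply: lerD kappa_m_le; rewrite ler_wpM2r ?invr_ge0 //; lra.
Qed.

End Rounding.

Section Density.
Variables (R : realType) (V : finType) (w : {set V} -> R).

Definition pair_weight (u v : V) : R := if u != v then w [set u; v] else 0.

Lemma pair_weightC u v : pair_weight u v = pair_weight v u.
Proof. by rewrite /pair_weight eq_sym setUC. Qed.

Lemma pair_weightxx v : pair_weight v v = 0.
Proof. by rewrite /pair_weight eqxx. Qed.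

Lemma pair_weight_range u v : (forall e : {set V}, #|e| == 2%N -> 0 <= w e <= 1) ->
  0 <= pair_weight u v <= 1.
Proof.
move=> w01; rewrite /pair_weight; case: ifP => [uv|_]; last by rewrite lexx ler01.
by apply: w01; rewrite cards2 uv.
Qed.

Lemma sum_pairs_of_edge (T : {set V}) x y (a : R) : x != y -> [set x; y] \subset T ->
  \sum_(p : V * V | [&& p.1 \in T, p.2 \in T & p.1 != p.2] && ([set p.1; p.2] == [set x; y])) a
    = 2 * a.
Proof.
move=> xy; rewrite subUset !sub1set => /andP[xT yT].
rewrite (eq_bigl (mem [set (x, y); (y, x)])) => [|[u v] /=]; last first.
  rewrite [RHS]inE !inE !xpair_eqE.
  apply/idP/idP => [/andP[/and3P[_ _ uv] /eqP eq_e]|/orP[]/andP[/eqP-> /eqP->]].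
  - have : (u \in [set x; y]) && (v \in [set x; y]) by rewrite -eq_e set21 set22.
    by move: uv; rewrite !inE => uv /andP[/orP[]/eqP Eu /orP[]/eqP Ev];
      move: uv; rewrite Eu Ev !eqxx ?orbT.
  - by rewrite xT yT xy eqxx.
  - by rewrite xT yT eq_sym xy setUC eqxx.
by rewrite sumr_const cards2 xpair_eqE (negPf xy) /= mulr_natl.
Qed.

Lemma den_pairs (k : nat) (T : {set V}) : #|T| = k ->
  den w T = pair_scale R k * pairs pair_weight T.
Proof.
move=> kT; rewrite /den kT /pair_scale.
suff -> : pairs pair_weight T =
    2 * \sum_(e : {set V} | (e \subset T) && (#|e| == 2)%N) w e.
  by set S := \sum_(e | _) _; rewrite !invfM invrK; ring.
transitivity (\sum_(p : V * V | [&& p.1 \in T, p.2 \in T & p.1 != p.2]) w [set p.1; p.2]).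
  rewrite /pairs pair_big /= big_mkcond [RHS]big_mkcond; apply: eq_bigr => p _ /=.
  by rewrite /pair_weight andbA; case: (_ && _).
rewrite (partition_big (fun p => [set p.1; p.2]) (fun e => (e \subset T) && (#|e| == 2)%N)) /=.
  rewrite mulr_sumr; apply: eq_bigr => e /andP[sT /cards2P[x [y [xy Ee]]]]; subst e.
  rewrite -(sum_pairs_of_edge (w [set x; y]) xy sT).
  by apply: eq_bigr => p /andP[_ /eqP->].
by move=> p /and3P[uT vT uv]; rewrite cards2 uv subUset !sub1set uT vT.
Qed.

End Density.

(** * The program *)

(* Arrays of natural numbers; those read only at index 0 are scalars. *)
Local Notation aOut := 0%N.
Local Notation aSet := 1%N.
Local Notation aCand := 2%N.      (* candidates of a maximisation *)
Local Notation aGuess := 3%N.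
Local Notation aCount := 4%N.     (* numerators of the fractional solution *)
Local Notation nArg := 5%N.
Local Notation nCard := 6%N.
Local Notation nLog := 7%N.
Local Notation nTmp := 8%N.
Local Notation nArity := 9%N.     (* number of guessed vertices *)
Local Notation nSteps := 10%N.
Local Notation nCodes := 11%N.    (* number of possible guesses *)
Local Notation nRest := 12%N.
Local Notation nCoin := 13%N.
Local Notation nSaved := 14%N.
Local Notation iVertex := 20%N.
Local Notation iInner := 21%N.
Local Notation iRound := 22%N.
Local Notation iStep := 23%N.
Local Notation iCode := 24%N.
(* Arrays of real numbers *)
Local Notation rScore := 0%N.
Local Notation rGain := 1%N.      (* sums of sampled gains *)
Local Notation rOracle := 2%N.
Local Notation rValue := 3%N.
Local Notation rBest := 4%N.
Local Notation rDecay := 5%N.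

Local Notation "'cell' a" := (NGet a (NLit 0)) (at level 10, a at level 9).
Local Notation "'rcell' a" := (RGet a (NLit 0)) (at level 10, a at level 9).
Local Notation "c1 ;; c2" := (Seq c1 c2) (at level 60, right associativity).
Local Notation "a '::=' e" := (SetNat a (NLit 0) e) (at level 50).
Local Notation "a ':r=' e" := (SetReal a (NLit 0) e) (at level 50).

Section Loops.
Variables (R : realType) (J : instance R) (U : nat).
Local Notation n := (nvert J).
Local Notation ensures := (ensures J U).
Local Notation memory := (memory R).
Hypothesis n_le_U : (n <= U)%N.

Lemma forall_ltnS m (v : 'I_m) (P : 'I_m -> Prop) :
  P v -> (forall u : 'I_m, (u < v)%N -> P u) -> forall u : 'I_m, (u < v.+1)%N -> P u.
Proof.
move=> Pv below u; rewrite ltnS leq_eqVlt => /orP[/eqP uv|]; last exact: below.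
by rewrite (ord_inj uv).
Qed.

Lemma ensures_vertices i c s (Inv : nat -> memory -> Prop) :
  i \notin nwrites c -> Inv 0%N (set_nat s i 0 0) ->
  (forall (v : 'I_n) s', agree (For i NVert c) s s' -> nmem s' i 0 = v -> Inv v s' ->
     ensures c s' (fun s'' => Inv v.+1 (set_nat s'' i 0 v.+1))) ->
  ensures (For i NVert c) s (Inv n).
Proof.
move=> fresh Inv0 body; apply: ensures_for => // j s' ag jn.
exact: (body (Ordinal jn)).
Qed.

Definition fill (a : nat) (e : nexp) : cmd := For iVertex NVert (SetNat a (cell iVertex) e).

Lemma fill_spec a e s (F : 'I_n -> nat) : iVertex != a ->
  (forall (v : 'I_n) s', agree (fill a e) s s' ->
     (forall u : 'I_n, (v <= u)%N -> nmem s' a u = nmem s a u) ->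
     nmem s' iVertex 0 = v -> neval J s' e = F v) ->
  ensures (fill a e) s (fun s' => forall v : 'I_n, nmem s' a v = F v).
Proof.
move=> counter_neq He; have a_neq : (a == iVertex) = false by rewrite eq_sym (negPf counter_neq).
apply: triple_post (ensures_vertices (Inv := fun j s' =>
  (forall v : 'I_n, (v < j)%N -> nmem s' a v = F v) /\
  (forall v : 'I_n, (j <= v)%N -> nmem s' a v = nmem s a v)) _ _ _) _.
- by rewrite inE.
- by split=> // v _; rewrite /= /update a_neq.
- move=> v s' ag Ev [filled kept]; apply: triple_set_nat => //=.
  rewrite Ev (He v) // /update a_neq eqxx /=; split=> [|u vu]; last first.
    by rewrite gtn_eqF // kept // ltnW.
  apply: forall_ltnS => [|u uv]; first by rewrite eqxx.
  by rewrite ltn_eqF // filled.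
by move=> s' [filled _] v; apply: filled.
Qed.

Definition nat_sum_loop (i : nat) (e : nexp) (a : nat) (t : nexp) : cmd :=
  For i e (a ::= NAdd (cell a) t).

Lemma nat_sum_loop_spec i e a t s m (F : nat -> nat) : (m <= U)%N -> i != a ->
  (forall s', agree (nat_sum_loop i e a t) s s' -> neval J s' e = m) ->
  (forall j s', agree (nat_sum_loop i e a t) s s' -> (j < m)%N -> nmem s' i 0 = j ->
     neval J s' t = F j) ->
  ensures (nat_sum_loop i e a t) s
    (fun s' => nmem s' a 0 = nmem s a 0 + \sum_(0 <= j < m) F j)%N.
Proof.
move=> le_m ia He Ht; have ai : (a == i) = false by rewrite eq_sym (negPf ia).
apply: (ensures_for (Inv := fun j s' =>
    nmem s' a 0 = nmem s a 0 + \sum_(0 <= l < j) F l)%N) => //.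
- by rewrite inE.
- by rewrite big_geq // addn0 /= /update ai.
- move=> j s' ag jm Ej Es; apply: triple_set_nat => //=.
  by rewrite /update ai !eqxx /= Es (Ht j) // big_nat_recr //= addnA.
Qed.

Definition real_sum_loop (i : nat) (e : nexp) (a : nat) (l : nexp) (t : rexp) : cmd :=
  For i e (SetReal a l (RAdd (RGet a l) t)).

Lemma real_sum_loop_spec i e a l t s m x (F : nat -> R) : (m <= U)%N ->
  (forall s', agree (real_sum_loop i e a l t) s s' -> neval J s' e = m /\ neval J s' l = x) ->
  (forall j s', agree (real_sum_loop i e a l t) s s' -> (j < m)%N -> nmem s' i 0 = j ->
     reval J s' t = F j) ->
  ensures (real_sum_loop i e a l t) s (fun s' =>
    rmem s' a x = rmem s a x + \sum_(0 <= j < m) F j /\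
    forall y, y != x -> rmem s' a y = rmem s a y).
Proof.
move=> le_m Hel Ht.
apply: (ensures_for (Inv := fun j s' => rmem s' a x = rmem s a x + \sum_(0 <= l < j) F l /\
    forall y, y != x -> rmem s' a y = rmem s a y)) => //.
- by move=> s' /Hel[].
- by split=> //; rewrite big_geq // addr0.
- move=> j s' ag jm Ej [Es kept]; have [_ El] := Hel s' ag.
  apply: triple_set_real => //=; rewrite /update /= El !eqxx /=; split=> [|y yx].
    by rewrite Es (Ht j) // big_nat_recr //= addrA.
  by rewrite (negPf yx) kept.
Qed.

End Loops.

Definition argmax : cmd :=
  nArg ::= NVert ;;
  For iVertex NVert
    (If (BNatLe (NGet aCand (cell iVertex)) (NLit 0)) Skip
      (If (BAnd (BNot (BNatLe NVert (cell nArg)))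
                (BRealLe (RGet rScore (cell iVertex)) (RGet rScore (cell nArg))))
        Skip (nArg ::= cell iVertex))).

Definition grow_round : cmd :=
  fill aCand (NSub (NLit 1) (NGet aSet (cell iVertex))) ;;
  argmax ;;
  SetNat aSet (cell nArg) (NLit 1).

Definition grow : cmd := For iRound (NSub NTarget (cell nCard)) grow_round.

Definition removal_values : cmd :=
  For iVertex NVert
    (SetNat aCand (cell iVertex) (NSub (NGet aSet (cell iVertex)) (NForced (cell iVertex))) ;;
     nSaved ::= NGet aSet (cell iVertex) ;;
     SetNat aSet (cell iVertex) (NLit 0) ;;
     Query rScore (cell iVertex) aSet ;;
     SetNat aSet (cell iVertex) (cell nSaved)).

Definition shrink_round : cmd :=
  removal_values ;; argmax ;; SetNat aSet (cell nArg) (NLit 0).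

Definition shrink : cmd := For iRound (NSub (cell nCard) NTarget) shrink_round.

Definition count_members : cmd :=
  nCard ::= NLit 0 ;; nat_sum_loop iVertex NVert nCard (NGet aSet (cell iVertex)).

Section Resizing.
Variables (R : realType) (J : instance R) (U : nat).
Local Notation n := (nvert J).
Local Notation k := (target J).
Local Notation I := (forced J).
Local Notation h := (reward J).
Local Notation ensures := (ensures J U).
Local Notation memory := (memory R).
Hypothesis n_le_U : (n <= U)%N.
Implicit Types (s : memory) (X T : {set 'I_n}).

Definition represents s (a : nat) X : Prop := forall v : 'I_n, nmem s a v = (v \in X).

Lemma vertex_set_represents s a X : represents s a X -> vertex_set J s a = X.
Proof. by move=> rX; apply/setP => v; rewrite inE rX; case: (v \in X). Qed.

Lemma represents_eq s s' a X :
  (forall v, nmem s' a v = nmem s a v) -> represents s a X -> represents s' a X.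
Proof. by move=> same rX v; rewrite same. Qed.

Lemma represents_add s a (b : 'I_n) X : represents s a X ->
  represents (set_nat s a b 1) a (b |: X).
Proof.
move=> rX v; rewrite /= /update eqxx /= rX !inE.
by rewrite -[val v == val b]/(v == b); case: eqP.
Qed.

Lemma represents_remove s a (b : 'I_n) X : represents s a X ->
  represents (set_nat s a b 0) a (X :\ b).
Proof.
move=> rX v; rewrite /= /update eqxx /= rX !inE.
by rewrite -[val v == val b]/(v == b); case: eqP.
Qed.

Lemma card_vertices_le X : (#|X| <= n)%N.
Proof. by rewrite -[X in (_ <= X)%N]card_ord max_card. Qed.

Lemma argmax_spec s (C : {set 'I_n}) : represents s aCand C -> C != set0 ->
  ensures argmax s (fun s' => exists b : 'I_n, [/\ nmem s' nArg 0 = b, b \in C &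
    {in C, forall u : 'I_n, rmem s rScore u <= rmem s rScore b}]).
Proof.
move=> rC C_neq0; apply: triple_seq_set_nat => /=; set s1 := set_nat _ _ _ _.
pose Inv (j : nat) s' :=
  (nmem s' nArg 0 = n /\ forall u : 'I_n, (u < j)%N -> u \notin C) \/
  exists b : 'I_n, [/\ nmem s' nArg 0 = b, b \in C &
    forall u : 'I_n, (u < j)%N -> u \in C -> rmem s rScore u <= rmem s rScore b].
apply: triple_post (ensures_vertices (Inv := Inv) n_le_U _ _ _) _ => //; first by left.
- move=> v s' ag Ev found; apply: triple_if; rewrite /= Ev.
  have -> : nmem s' aCand v = (v \in C) by frame.
  case: (boolP (v \in C)) => vC /=; last first.
    apply: triple_skip => //; case: found => [[Eb none]|[b [Eb bC bmax]]].
      by left; split=> //; apply: forall_ltnS.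
    by right; exists b; split=> //; apply: forall_ltnS => // vC'; rewrite vC' in vC.
  apply: triple_if => /=; rewrite Ev; frame.
  case: found => [[Eb none]|[b [Eb bC bmax]]].
    rewrite Eb leqnn /=; apply: triple_set_nat => //=; rewrite Ev; right; exists v.
    by split=> //; apply: forall_ltnS => // u uv uC; have := none u uv; rewrite uC.
  rewrite Eb leqNgt ltn_ord /=; case: ifP => [le_v|/negbT].
    by apply: triple_skip => //; right; exists b; split=> //; apply: forall_ltnS.
  rewrite -ltNge => /ltW le_b; apply: triple_set_nat => //=; rewrite Ev; right; exists v.
  by split=> //; apply: forall_ltnS => // u uv uC; apply: le_trans (bmax u uv uC) le_b.
move=> s' [[_ none]|[b [Eb bC bmax]]].
  by case/set0Pn: C_neq0 => u uC; have := none u (ltn_ord u); rewrite uC.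
by exists b; split=> // u; apply: bmax.
Qed.

Lemma grow_round_spec s X : represents s aSet X -> X != setT ->
  ensures grow_round s (fun s' => exists b : 'I_n, [/\ b \notin X, represents s' aSet (b |: X) &
    forall v : 'I_n, v \notin X -> rmem s rScore v <= rmem s rScore b]).
Proof.
move=> rX X_neqT.
apply: triple_seq_ensures (fill_spec n_le_U (F := fun v => v \notin X) _ _) _ => //.
  by move=> v s1 ag _ Ev /=; rewrite Ev; frame; rewrite rX; case: (v \in X).
move=> s1 ag1 rC; apply: triple_seq_ensures (argmax_spec (C := ~: X) _ _) _.
- by move=> v; rewrite rC inE.
- by apply: contra X_neqT => /eqP XC0; rewrite -[X]setCK XC0 setC0.
move=> s2 ag2 [b [Eb bX bmax]]; rewrite inE in bX.
apply: triple_set_nat => //=; rewrite Eb; exists b; split=> //.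
  by apply: represents_add; apply: represents_eq rX => v; frame.
by move=> v vX; have := bmax v; rewrite inE vX; frame; apply.
Qed.

Lemma grow_spec s X : (k <= U)%N -> represents s aSet X ->
  (#|X| + (k - nmem s nCard 0) <= n)%N ->
  ensures grow s (fun s' => exists T, [/\ represents s' aSet T, X \subset T,
    #|T| = (#|X| + (k - nmem s nCard 0))%N &
    forall u v, u \in T -> u \notin X -> v \notin T -> rmem s rScore v <= rmem s rScore u]).
Proof.
move=> kU rX le_n; apply: (ensures_for (Inv := fun t s' => exists T,
    [/\ represents s' aSet T, X \subset T, #|T| = (#|X| + t)%N &
    forall u v, u \in T -> u \notin X -> v \notin T -> rmem s rScore v <= rmem s rScore u])).
- exact: leq_trans (leq_subr _ _) kU.
- by [].
- by move=> s' ag /=; frame.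
- by exists X; rewrite addn0; split=> // u v ->.
move=> j s' ag jb _ [T [rT sXT cT top]].
have T_neqT : T != setT.
  by apply/eqP => ET; move: cT le_n; rewrite ET cardsT card_ord; lia.
apply: triple_post (grow_round_spec rT T_neqT) _ => s'' [b [bT rbT bmax]].
exists (b |: T); split=> //.
- by rewrite subsetU // sXT orbT.
- by rewrite cardsU1 bT cT addnS.
move=> u v; rewrite !inE negb_or => /orP[/eqP-> _|uT uX] /andP[vb vT]; last exact: top.
by have := bmax v vT; frame.
Qed.

Lemma removal_values_spec s X : represents s aSet X ->
  ensures removal_values s (fun s' => [/\ represents s' aSet X,
    forall v : 'I_n, nmem s' aCand v = (v \in X :\: I) &
    forall v : 'I_n, rmem s' rScore v = h (X :\ v)]).
Proof.
move=> rX; pose Inv (j : nat) s' := [/\ represents s' aSet X,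
  forall v : 'I_n, (v < j)%N -> nmem s' aCand v = (v \in X :\: I) &
  forall v : 'I_n, (v < j)%N -> rmem s' rScore v = h (X :\ v)].
apply: triple_post (ensures_vertices (Inv := Inv) n_le_U _ _ _) _ => //.
- move=> v s' ag Ev [rX' cand vals].
  do 3 apply: triple_seq_set_nat; apply: triple_seq_query; apply: triple_set_nat => //.
  rewrite /= /update /= Ev valK; set s1 := set_nat (set_nat s' _ _ _) _ _ _.
  have r1 : represents s1 aSet X by exact: rX'.
  rewrite (vertex_set_represents (represents_remove v r1)); split.
  - by move=> u; rewrite /= /update /=; case: eqP => [<-|_]; rewrite rX'.
  - apply: forall_ltnS => [|u uv]; rewrite /= /update /=.
      by rewrite eqxx rX' !inE; case: (v \in X); case: (v \in I).
    by rewrite ltn_eqF // cand.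
  - apply: forall_ltnS => [|u uv]; rewrite /= /update /= ?eqxx //.
    by rewrite ltn_eqF // vals.
by move=> s' [rX' cand vals]; split=> // v; [apply: cand|apply: vals].
Qed.

Lemma shrink_round_spec s X : represents s aSet X -> I \proper X ->
  ensures shrink_round s (fun s' => exists b : 'I_n, [/\ b \in X :\: I,
    represents s' aSet (X :\ b) & {in X :\: I, forall u, h (X :\ u) <= h (X :\ b)}]).
Proof.
move=> rX /properP[_ [v vX vI]].
apply: triple_seq_ensures (removal_values_spec rX) _ => s1 ag1 [rX1 rC vals].
apply: triple_seq_ensures (argmax_spec rC _) _.
  by apply/set0Pn; exists v; rewrite inE vI.
move=> s2 ag2 [b [Eb bXI bmax]]; apply: triple_set_nat => //=; rewrite Eb; exists b; split=> //.
  by apply: represents_remove; apply: represents_eq rX1 => u; frame.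
by move=> u uXI; rewrite -!vals; apply: bmax.
Qed.

Lemma shrink_spec s X : represents s aSet X -> I \subset X -> nmem s nCard 0 = #|X| ->
  ensures shrink s (fun s' => exists T, [/\ represents s' aSet T, T \subset X, I \subset T,
    #|T| = (#|X| - (#|X| - k))%N &
    (#|T| - #|I|)%:R * h X <= (#|X| - #|I|)%:R * h T]).
Proof.
move=> rX sIX cX; have /andP[Ik kn] := target_range J.
apply: (ensures_for (Inv := fun t s' => exists T, [/\ represents s' aSet T, T \subset X,
  I \subset T, #|T| = (#|X| - t)%N & (#|T| - #|I|)%:R * h X <= (#|X| - #|I|)%:R * h T])).
- exact: leq_trans (leq_subr _ _) (leq_trans (card_vertices_le X) n_le_U).
- by [].
- by move=> s' ag /=; frame; rewrite cX.
- by exists X; rewrite subn0.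
move=> j s' ag jb _ [T [rT sTX sIT cT ratio]].
have properI : I \proper T by rewrite properEcard sIT cT; move: jb Ik; lia.
apply: triple_post (shrink_round_spec rT properI) _ => s'' [b [bTI rbT best]].
have /setDP[bT bI] := bTI; exists (T :\ b); split=> //.
- exact: subset_trans (subsetDl _ _) sTX.
- by rewrite subsetD1 sIT bI.
- by rewrite subnS -cT (cardsD1 b T) bT.
- exact: (best_removal_ratio (@reward_monotone _ J) (@reward_submodular _ J) (@reward_ge0 _ J)).
Qed.

Lemma count_members_spec s X : represents s aSet X ->
  ensures count_members s (fun s' => nmem s' nCard 0 = #|X|).
Proof.
move=> rX; apply: triple_seq_set_nat.
apply: triple_post (nat_sum_loop_spec (m := n) (F := nmem s aSet) n_le_U _ _ _) _ => //.
  by move=> j s' ag jn Ej /=; rewrite Ej; frame.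
move=> s' ->; rewrite add0n big_mkord -sum1_card [RHS]big_mkcond.
by apply: eq_bigr => v _; rewrite rX; case: (v \in X).
Qed.

End Resizing.

Definition rone : rexp := RNat (NLit 1).

Definition pair_scale_exp : rexp :=
  RDiv rone (RMul (RNat NTarget) (RSub (RNat NTarget) rone)).

Definition evaluate : cmd :=
  Query rValue (NLit 0) aSet ;;
  For iVertex NVert
    (real_sum_loop iInner NVert rValue (NLit 0)
      (RMul pair_scale_exp
        (RMul (RMul (RNat (NGet aSet (cell iVertex))) (RNat (NGet aSet (cell iInner))))
          (RWeight (cell iVertex) (cell iInner))))).

Definition record_best : cmd :=
  If (BRealLe (rcell rValue) (rcell rBest)) Skip
    (fill aOut (NGet aSet (cell iVertex)) ;; rBest :r= rcell rValue).

Definition resize_and_record : cmd :=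
  count_members ;; shrink ;; grow ;; evaluate ;; record_best.

Section Recording.
Variables (R : realType) (J : instance R) (U : nat).
Local Notation n := (nvert J).
Local Notation k := (target J).
Local Notation I := (forced J).
Local Notation h := (reward J).
Local Notation w := (pair_weight (weight J)).
Local Notation ensures := (ensures J U).
Local Notation memory := (memory R).
Hypothesis n_le_U : (n <= U)%N.
Implicit Types (s : memory) (X T : {set 'I_n}).

Lemma weight_range (u v : 'I_n) : 0 <= w u v <= 1.
Proof. exact: pair_weight_range (@weight_itv _ J). Qed.

Lemma read_weightE (u v : 'I_n) : read_weight J u v = w u v.
Proof. by rewrite /read_weight !valK. Qed.

Lemma den_ge0 T : 0 <= den (weight J) T.
Proof.
rewrite (den_pairs _ (erefl _)) mulr_ge0 ?pair_scale_ge0 //.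
by apply: pairs_ge0; apply: weight_range.
Qed.

Lemma den_le1 T : den (weight J) T <= 1.
Proof.
rewrite (den_pairs _ (erefl _)); apply: pairs_le1; first exact: weight_range.
exact: pair_weightxx.
Qed.

Definition objective T : R := h T + den (weight J) T.

Lemma objective_ge0 T : 0 <= objective T.
Proof. by rewrite addr_ge0 ?reward_ge0 ?den_ge0. Qed.

Lemma evaluate_spec s X : represents s aSet X -> #|X| = k ->
  ensures evaluate s (fun s' => rmem s' rValue 0 = objective X).
Proof.
move=> rX cX; apply: triple_seq_query; rewrite (vertex_set_represents rX).
set s1 := set_real _ _ _ _.
pose t (u v : nat) : R :=
  pair_scale R k * ((nmem s aSet u)%:R * (nmem s aSet v)%:R * read_weight J u v).
apply: triple_post (ensures_vertices (Inv := fun j s' =>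
  rmem s' rValue 0 = h X + \sum_(0 <= u < j) \sum_(0 <= v < n) t u v) n_le_U _ _ _) _ => //.
- by rewrite big_geq // addr0.
- move=> u s2 ag Eu Es.
  apply: triple_post (real_sum_loop_spec (m := n) (x := 0%N) (F := t u) n_le_U _ _) _ => //.
    by move=> v s3 ag3 _ Ev /=; rewrite Ev; frame; rewrite Eu.
  by move=> s3 [Es3 _] /=; rewrite Es3 Es big_nat_recr //= addrA.
move=> s' ->; rewrite /objective (den_pairs _ cX); congr (_ + _).
rewrite pairs_quad /quad mulr_sumr big_mkord; apply: eq_bigr => u _.
rewrite mulr_sumr big_mkord; apply: eq_bigr => v _.
by rewrite /t !rX read_weightE.
Qed.

Definition recorded s : Prop := exists T,
  [/\ represents s aOut T, feasible J T & rmem s rBest 0 = objective T].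

(* A negative best value means that nothing has been recorded yet. *)
Definition incumbent s : Prop := recorded s \/ rmem s rBest 0 < 0.

Definition improved s s' : Prop := recorded s' /\ rmem s rBest 0 <= rmem s' rBest 0.

Lemma recorded_incumbent s : recorded s -> incumbent s.
Proof. by left. Qed.

Lemma improved_trans s s' s'' : improved s s' -> improved s' s'' -> improved s s''.
Proof. by case=> _ le1 [rec le2]; split=> //; apply: le_trans le2. Qed.

Lemma incumbent_agree c s s' : agree c s s' -> aOut \notin nwrites c -> rBest \notin rwrites c ->
  incumbent s -> incumbent s'.
Proof.
move=> ag out_kept best_kept; rewrite /incumbent (agree_rmem 0 ag best_kept).
case=> [[T [rT fT Eb]]|]; [left; exists T|by right].
by split=> //; [move=> v; rewrite (agree_nmem v ag)|rewrite (agree_rmem 0 ag best_kept)].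
Qed.

Lemma improved_agree c s s' s'' : agree c s s' -> rBest \notin rwrites c ->
  improved s' s'' -> improved s s''.
Proof. by move=> ag best_kept; rewrite /improved (agree_rmem 0 ag best_kept). Qed.

Lemma record_best_spec s X : represents s aSet X -> feasible J X ->
  rmem s rValue 0 = objective X -> incumbent s ->
  ensures record_best s (fun s' => improved s s' /\ objective X <= rmem s' rBest 0).
Proof.
move=> rX fX Ev inc; apply: triple_if; rewrite /= Ev; case: ifP => [le_b|/negbT lt_b].
  apply: triple_skip => //; split=> //; split=> //; case: inc => // lt0.
  by move: (lt_le_trans lt0 (le_trans (objective_ge0 X) le_b)); rewrite ltxx.
rewrite -ltNge in lt_b.
apply: triple_seq_ensures (fill_spec n_le_U (F := fun v => v \in X) _ _) _ => //.
  by move=> v s2 ag2 _ Ei /=; rewrite Ei; frame.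
move=> s2 ag2 rX2; apply: triple_set_real => //.
have Eb : rmem (set_real s2 rBest 0 (rmem s2 rValue 0)) rBest 0 = objective X by frame.
split; [split|]; rewrite ?Eb ?(ltW lt_b) //.
by exists X.
Qed.

Lemma resize_and_record_spec s X : represents s aSet X -> I \subset X -> incumbent s ->
  ensures resize_and_record s (fun s' => improved s s' /\
    exists T, [/\ resized h I k X T, feasible J T & objective T <= rmem s' rBest 0]).
Proof.
move=> rX sIX inc; have /andP[Ik kn] := target_range J; have cXn := card_vertices_le X.
apply: triple_seq_ensures (count_members_spec n_le_U rX) _ => s1 ag1 E1.
have r1 : represents s1 aSet X by move=> v; frame.
apply: triple_seq_ensures (shrink_spec n_le_U r1 sIX E1) _ => s2 ag2 [X2 [r2 s2X sI2 c2 ratio]].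
have E2 : nmem s2 nCard 0 = #|X| by frame.
apply: triple_seq_ensures (grow_spec n_le_U _ r2 _) _; first exact: leq_trans kn n_le_U.
  by rewrite E2 c2; lia.
move=> s3 ag3 [T [r3 s2T cT _]].
have kT : #|T| = k by rewrite cT E2 c2; lia.
have fT : feasible J T by rewrite /feasible kT eqxx (subset_trans sI2).
apply: triple_seq_ensures (evaluate_spec r3 kT) _ => s4 ag4 E4.
have r4 : represents s4 aSet T by move=> v; frame.
have inc4 : incumbent s4.
  by do !(apply: incumbent_agree; [eassumption|exact: isT|exact: isT|]).
apply: triple_post (record_best_spec r4 fT E4 inc4) _ => s5 [imp5 obj5]; split.
  by do !(apply: improved_agree; [eassumption|exact: isT|]).
exists T; split=> //; split=> //; first exact: (subset_trans sI2).
- move=> le_Xk; rewrite (_ : X = X2) //; apply/esym/eqP.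
  by rewrite eqEcard s2X c2; move: le_Xk; lia.
- move=> le_kX; have EX2 : X2 = T.
    by apply/eqP; rewrite eqEcard s2T kT c2; move: le_kX; lia.
  by rewrite EX2 kT in ratio s2X.
Qed.

End Recording.

Definition toss : cmd :=
  Draw nCoin (NLit 0) (NSub (cell nSteps) (NLit 1)) ;;
  If (BNatLe (NGet aCount (cell iVertex)) (cell nCoin))
    (SetNat aSet (cell iVertex) (NLit 0)) (SetNat aSet (cell iVertex) (NLit 1)).

Definition sample : cmd := For iVertex NVert toss.

Definition add_gains : cmd :=
  Query rOracle (NLit 0) aSet ;;
  For iVertex NVert
    (nSaved ::= NGet aSet (cell iVertex) ;;
     SetNat aSet (cell iVertex) (NLit 1) ;;
     Query rOracle (NLit 1) aSet ;;
     SetReal rGain (cell iVertex) (RAdd (RGet rGain (cell iVertex))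
       (RSub (RGet rOracle (NLit 1)) (rcell rOracle))) ;;
     SetNat aSet (cell iVertex) (cell nSaved)).

Definition clear_gains : cmd := For iVertex NVert (SetReal rGain (cell iVertex) (RNat (NLit 0))).

Definition gradient : cmd := clear_gains ;; For iRound (cell nSteps) (sample ;; add_gains).

Definition steps_left : nexp := NSub (NSub (cell nSteps) (cell iStep)) (NLit 1).

Definition compute_decay : cmd :=
  rDecay :r= rone ;;
  For iRound steps_left
    (rDecay :r= RMul (rcell rDecay) (RSub rone (RDiv rone (RNat (cell nSteps))))).

Definition score_vertex : cmd :=
  SetReal rScore (cell iVertex) (RNat (NLit 0)) ;;
  real_sum_loop iInner NVert rScore (cell iVertex)
    (RMul (RNat (NGet aCount (cell iInner))) (RWeight (cell iInner) (cell iVertex))) ;;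
  real_sum_loop iInner (cell nArity) rScore (cell iVertex)
    (RMul (RNat steps_left)
      (RMul (RDiv (RNat NTarget) (RNat (cell nArity)))
        (RWeight (NGet aGuess (cell iInner)) (cell iVertex)))) ;;
  SetReal rScore (cell iVertex)
    (RAdd (RMul (rcell rDecay) (RGet rGain (cell iVertex)))
      (RMul (RMul (RNat (NLit 2)) pair_scale_exp) (RGet rScore (cell iVertex)))).

Definition score_vertices : cmd := compute_decay ;; For iVertex NVert score_vertex.

Definition take_forced : cmd := fill aSet (NForced (cell iVertex)).

Definition select_best : cmd := take_forced ;; count_members ;; grow.

Definition greedy_step : cmd :=
  gradient ;; score_vertices ;; select_best ;;
  fill aCount (NAdd (NGet aCount (cell iVertex)) (NGet aSet (cell iVertex))).

Definition try_greedy : cmd :=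
  fill aCount (NLit 0) ;; For iStep (cell nSteps) greedy_step ;; sample ;; resize_and_record.

Section GreedyCommands.
Variables (R : realType) (J : instance R) (U N r B : nat).
Local Notation n := (nvert J).
Local Notation k := (target J).
Local Notation I := (forced J).
Local Notation h := (reward J).
Local Notation w := (pair_weight (weight J)).
Local Notation triple := (triple J U).
Local Notation ensures := (ensures J U).
Local Notation memory := (memory R).
Hypotheses (n_le_U : (n <= U)%N) (N_le_U : (N <= U)%N).
Hypothesis N_gt0 : (0 < n)%N -> (0 < N)%N.
Implicit Types (s : memory) (X Z O : {set 'I_n}) (c : {ffun 'I_n -> nat}) (j : nat).

Definition ready s : Prop :=
  [/\ nmem s nSteps 0 = N, nmem s nArity 0 = r & nmem s nCodes 0 = B].

Lemma ready_agree p s s' : agree p s s' ->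
  all (fun a => a \notin nwrites p) [:: nSteps; nArity; nCodes] -> ready s -> ready s'.
Proof.
move=> ag /and4P[kept1 kept2 kept3 _] [? ? ?].
by split; rewrite (agree_nmem 0 ag).
Qed.

Definition counts s : {ffun 'I_n -> nat} := [ffun v : 'I_n => nmem s aCount v].

Lemma eq_counts s s' : (forall v : 'I_n, nmem s' aCount v = nmem s aCount v) ->
  counts s' = counts s.
Proof. by move=> same; apply/ffunP => v; rewrite !ffunE same. Qed.

Lemma sum_lt_ord (m c : nat) (f : bool -> R) : (c <= m)%N ->
  \sum_(d < m) f (d < c)%N = c%:R * f true + (m - c)%:R * f false.
Proof.
move=> le_cm; rewrite -(big_mkord xpredT (fun d => f (d < c)%N)).
rewrite (big_cat_nat _ (n := c)) //=; congr (_ + _).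
  rewrite big_nat (eq_bigr (fun=> f true)) => [|d /andP[_ ->] //].
  by rewrite -big_nat sumr_const_nat subn0 mulr_natl.
rewrite big_nat (eq_bigr (fun=> f false)) => [|d /andP[le_cd _]]; last by rewrite ltnNge le_cd.
by rewrite -big_nat sumr_const_nat mulr_natl.
Qed.

Lemma toss_spec s (v : 'I_n) (c := nmem s aCount v) Q f (g : bool -> R) :
  nmem s nSteps 0 = N -> nmem s iVertex 0 = v -> (c <= N)%N ->
  (forall d : nat, (d < N)%N ->
     let s' := set_nat (set_nat s nCoin 0 d) aSet v (d < c)%N in Q s' /\ g (d < c)%N <= f s') ->
  triple toss s Q f (N%:R^-1 * c%:R * g true + (1 - N%:R^-1 * c%:R) * g false).
Proof.
move=> EN Ev cN outcome; have Npos : (0 < N)%N by apply/N_gt0/(leq_ltn_trans _ (ltn_ord v)).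
apply: (triple_seq (Q1 := fun s1 => exists2 d : nat, (d < N)%N & s1 = set_nat s nCoin 0 d)
  (f1 := fun s1 => g (nmem s1 nCoin 0 < c)%N)) => [|_ [d dN ->]].
  have EN1 : (neval J s (NSub (cell nSteps) (NLit 1))).+1 = N by rewrite /= EN subn1 prednK.
  apply: triple_draw => [d|]; first by exists d => //; rewrite -EN1 ltn_ord.
  rewrite EN1 /= /update /= sum_lt_ord // natrB // le_eqVlt; apply/orP; left; apply/eqP.
  by field; rewrite pnatr_eq0 -lt0n.
have [Qd gd] := outcome d dN; apply: triple_if; rewrite /= /update /= Ev -/c.
move: Qd gd; rewrite ltnNge; case: leqP => _ Qd gd.
all: by apply: triple_set_nat; rewrite /= /update /= ?Ev.
Qed.

Lemma sample_spec s (psi : {set 'I_n} -> R) : nmem s nSteps 0 = N ->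
  (forall v, counts s v <= N)%N ->
  triple sample s
    (fun s' => exists2 X, represents s' aSet X & forall v, (N <= counts s v)%N -> v \in X)
    (fun s' => psi (vertex_set J s' aSet)) (mean (fractional R N (counts s)) psi).
Proof.
move=> EN cN; set p := fractional R N (counts s).
pose Inv (j : nat) s' := forall v : 'I_n, (v < j)%N ->
  (nmem s' aSet v <= 1)%N /\ ((N <= counts s v)%N -> nmem s' aSet v = 1%N).
pose pinned (j : nat) s' (v : 'I_n) : R := if (v < j)%N then (nmem s' aSet v != 0%N)%:R else p v.
pose phi (j : nat) s' := mean (pinned j s') psi.
apply: (triple_conseq (triple_for (Inv := Inv) (phi := phi) n_le_U _ _ _ _)) => //.
- move=> j s' ag jn Ej Inv_j; pose v := Ordinal jn.
  have Ec : nmem s' aCount v = counts s v by rewrite ffunE; frame.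
  have pin_next d (b : bool) : pinned j.+1 (set_nat (set_nat (set_nat s' nCoin 0 d) aSet v b)
      iVertex 0 j.+1) =1 pin (pinned j s') v b%:R.
    move=> u; rewrite /pinned /pin /= /update /= -[val u == j]/(u == v) ltnS leq_eqVlt.
    by rewrite -[val u == j]/(u == v); case: eqVneq => //= _; case: b.
  have -> : phi j s' = N%:R^-1 * (nmem s' aCount v)%:R * mean (pin (pinned j s') v 1) psi +
      (1 - N%:R^-1 * (nmem s' aCount v)%:R) * mean (pin (pinned j s') v 0) psi.
    rewrite Ec /phi (mean_pin _ _ v) (_ : pinned j s' v = N%:R^-1 * (counts s v)%:R) //.
    by rewrite /pinned ltnn.
  apply: (toss_spec (g := fun b : bool => mean (pin (pinned j s') v b%:R) psi)) => //.
  + by frame.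
  + by rewrite Ec.
  move=> d dN; split; last by rewrite /phi (eq_mean (pin_next _ _) (frefl psi)).
  apply: (forall_ltnS (v := v)) => [|u uj]; rewrite /= /update /=.
    rewrite eqxx Ec; case: ltnP => // le_cd; split=> // /leq_trans/(_ le_cd).
    by rewrite leqNgt dN.
  by rewrite ltn_eqF //; apply: Inv_j.
- move=> s' Inv_n; split.
    exists (vertex_set J s' aSet) => [v|v Nc]; rewrite inE.
      by case: (Inv_n v (ltn_ord v)); case: (nmem _ _ _) => [|[]].
    by case: (Inv_n v (ltn_ord v)) => _ ->.
  rewrite -[X in _ <= X](mean_indicator (vertex_set J s' aSet)) le_eqVlt.
  by apply/orP; left; apply/eqP/eq_mean => // v; rewrite /pinned ltn_ord inE.
Qed.

Lemma add_gains_spec s X : represents s aSet X ->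
  ensures add_gains s
    (fun s' => forall v : 'I_n, rmem s' rGain v = rmem s rGain v + gain h X v).
Proof.
move=> rX; apply: triple_seq_query; rewrite (vertex_set_represents rX).
pose Inv (j : nat) s' := [/\ represents s' aSet X, rmem s' rOracle 0 = h X,
  forall u : 'I_n, (u < j)%N -> rmem s' rGain u = rmem s rGain u + gain h X u &
  forall u : 'I_n, (j <= u)%N -> rmem s' rGain u = rmem s rGain u].
apply: triple_post (ensures_vertices (Inv := Inv) n_le_U _ _ _) _ => //.
- move=> v s' _ Ev [rX' hX added kept].
  do 2 apply: triple_seq_set_nat; rewrite /= /update /= Ev.
  set s1 := set_nat (set_nat s' _ _ _) _ _ _.
  have r1 : represents s1 aSet (v |: X) by apply: represents_add.
  apply: triple_seq_query; rewrite (vertex_set_represents r1).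
  apply: triple_seq_set_real; apply: triple_set_nat; rewrite //= /update /= Ev; split=> //.
  + by move=> u; rewrite /= /update /=; case: eqP => [<-|_]; rewrite rX'.
  + apply: forall_ltnS => [|u uv]; rewrite /= /update /=.
      by rewrite eqxx kept // hX.
    by rewrite ltn_eqF // added.
  + by move=> u vu; rewrite /= /update /= gtn_eqF // kept // ltnW.
by move=> s' [_ _ added _] v; apply: added.
Qed.

Lemma clear_gains_spec s :
  ensures clear_gains s (fun s' => forall v : 'I_n, rmem s' rGain v = 0).
Proof.
apply: triple_post (ensures_vertices (Inv := fun j s' =>
  forall v : 'I_n, (v < j)%N -> rmem s' rGain v = 0) n_le_U _ _ _) _ => //.
  move=> v s' _ Ev cleared; apply: triple_set_real => //=; rewrite Ev.
  apply: forall_ltnS => [|u uv]; rewrite /= /update /= ?eqxx //.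
  by rewrite ltn_eqF // cleared.
by move=> s' cleared v; apply: cleared.
Qed.

Definition sqr_error s j (G : 'I_n -> R) : R :=
  \sum_(v < n) (rmem s rGain v - j%:R * G v) ^+ 2.

Lemma gradient_spec s (lam M : R) (G := mean_gain h (fractional R N (counts s))) :
  0 <= lam -> (forall X v, gain h X v <= M) -> nmem s nSteps 0 = N ->
  (forall v, counts s v <= N)%N ->
  triple gradient s (fun=> True) (fun s' => - (lam * sqr_error s' N G))
    (- (lam * (N%:R * n%:R) * M ^+ 2)).
Proof.
move=> lam0 gain_le EN cN; have p01 : unit_range (fractional R N (counts s)).
  by move=> v; apply: fractional_unit_range => //; apply/N_gt0/(leq_ltn_trans _ (ltn_ord v)).
apply: triple_seq_ensures (clear_gains_spec s) _ => s1 ag1 cleared.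
pose phi j s' := - (lam * (sqr_error s' j G + (N - j)%N%:R * n%:R * M ^+ 2)).
apply: (triple_conseq (triple_for (Inv := fun _ _ => True) (phi := phi) N_le_U _ _ _ _)) => //.
- by move=> s' ag /=; frame.
- move=> j s' ag jN Ej _.
  have Ec : counts s' = counts s by apply: eq_counts => v; frame.
  pose psi X : R := - (lam * (\sum_(v < n) (rmem s' rGain v + gain h X v - (j%:R + 1) * G v) ^+ 2
    + (N - j.+1)%N%:R * n%:R * M ^+ 2)).
  have phi_le : phi j s' <= mean (fractional R N (counts s)) psi.
    have -> : mean (fractional R N (counts s)) psi = - lam *
        mean (fractional R N (counts s)) (fun X =>
          \sum_(v < n) (rmem s' rGain v + gain h X v - (j%:R + 1) * G v) ^+ 2)
        + - (lam * ((N - j.+1)%N%:R * n%:R * M ^+ 2)).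
      rewrite -[X in _ = _ + X](mean_const (fractional R N (counts s))) -mean_lin.
      by apply: eq_mean => // X; rewrite /psi; ring.
    have := mean_sum_sqr_error (@reward_monotone _ J) gain_le (fun v => rmem s' rGain v) j%:R p01.
    move/(ler_wpM2l lam0); rewrite card_ord /phi /sqr_error -/G.
    have -> : (N - j)%N%:R = (N - j.+1)%N%:R + 1 :> R by rewrite natr1; congr (_%:R); lia.
    lra.
  have EN' : nmem s' nSteps 0 = N by frame.
  rewrite -Ec in phi_le cN.
  have sampled := triple_frame (sample_spec psi EN' cN).
  apply: triple_seq (triple_conseq sampled (fun _ q => conj q (lexx _)) phi_le) _.
  move=> s2 [[X r2 _] ag2]; rewrite (vertex_set_represents r2).
  apply: triple_post (triple_const (add_gains_spec r2) _) _ => // s3 added.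
  rewrite /psi /phi /sqr_error -natr1 lerN2 le_eqVlt; apply/orP; left; apply/eqP.
  by congr (_ * (_ + _)); apply: eq_bigr => v _; rewrite /= added; frame.
- move=> s' _; split=> //; rewrite /phi subnn; lra.
- rewrite /phi subn0 /sqr_error big1 ?add0r ?mulrA // => v _.
  by rewrite /= cleared mul0r subrr expr2 mul0r.
Qed.

End GreedyCommands.

Section GreedyRun.
Variables (R : realType) (J : instance R) (U N r B : nat).
Local Notation n := (nvert J).
Local Notation k := (target J).
Local Notation I := (forced J).
Local Notation h := (reward J).
Local Notation w := (pair_weight (weight J)).
Local Notation triple := (triple J U).
Local Notation ensures := (ensures J U).
Local Notation memory := (memory R).
Local Notation ready := (ready N r B).
Local Notation counts := (@counts R J).
Hypotheses (n_le_U : (n <= U)%N) (N_le_U : (N <= U)%N) (r_le_U : (r <= U)%N).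
Hypothesis N_gt0 : (0 < n)%N -> (0 < N)%N.
Implicit Types (s : memory) (X Z O : {set 'I_n}) (c : {ffun 'I_n -> nat}) (j : nat).

Definition guess_degree s (v : 'I_n) : R :=
  \sum_(0 <= t < r) k%:R / r%:R * read_weight J (nmem s aGuess t) v.

Lemma eq_guess_degree s s' : (forall t, nmem s' aGuess t = nmem s aGuess t) ->
  guess_degree s' =1 guess_degree s.
Proof. by move=> same v; apply: eq_bigr => t _; rewrite same. Qed.

Lemma compute_decay_spec s j : ready s -> nmem s iStep 0 = j ->
  ensures compute_decay s (fun s' => rmem s' rDecay 0 = decay R N j.+1).
Proof.
move=> [EN _ _] Ej; apply: triple_seq_set_real.
apply: triple_post (ensures_for (m := (N - j - 1)%N)
  (Inv := fun l s' => rmem s' rDecay 0 = (1 - N%:R^-1) ^+ l) _ _ _ _ _) _ => //.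
- by rewrite -subnDA (leq_trans (leq_subr _ _)).
- by move=> s' ag /=; frame; rewrite EN Ej.
- move=> l s' ag _ El Es; apply: triple_set_real => //=.
  by rewrite /update /= Es mul1r exprSr; frame; rewrite EN.
by move=> s' ->; rewrite /decay -subnDA addn1.
Qed.

Lemma score_vertex_spec s (v : 'I_n) j : ready s -> nmem s iStep 0 = j ->
  nmem s iVertex 0 = v -> rmem s rDecay 0 = decay R N j.+1 ->
  ensures score_vertex s (fun s' =>
    rmem s' rScore v =
      greedy_score w N k (guess_degree s) j (fun u => rmem s rGain u) (counts s) v /\
    forall x : nat, x != v -> rmem s' rScore x = rmem s rScore x).
Proof.
move=> [EN Er _] Ej Ev Ed; apply: triple_seq_set_real; rewrite /= Ev; set s1 := set_real _ _ _ _.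
apply: triple_seq_ensures (real_sum_loop_spec (m := n) (x := v)
  (F := fun u => (nmem s aCount u)%:R * read_weight J u v) n_le_U _ _) _.
- by move=> s' ag /=; frame.
- by move=> u s' ag _ Eu /=; rewrite Eu; frame; rewrite Ev.
move=> s2 ag2 [E2 kept2].
apply: triple_seq_ensures (real_sum_loop_spec (m := r) (x := v) (F := fun t =>
  (N - j - 1)%N%:R * (k%:R / r%:R * read_weight J (nmem s aGuess t) v)) r_le_U _ _) _.
- by move=> s' ag /=; frame; rewrite Er Ev.
- by move=> t s' ag _ Et /=; rewrite Et; frame; rewrite EN Ej Er Ev.
move=> s3 ag3 [E3 kept3].
have Ev3 : nmem s3 iVertex 0 = v by frame.
apply: triple_set_real => //=; rewrite /update /= Ev3; split=> [|x xv]; last first.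
  by rewrite (negPf xv) kept3 // kept2 // /s1 /= /update /= (negPf xv).
rewrite eqxx E3 E2 /s1; frame; rewrite eqxx Ed add0r.
rewrite /greedy_score /pair_score mulr_sumr; congr (_ + _ * (_ + _)).
by rewrite big_mkord; apply: eq_bigr => u _; rewrite read_weightE ffunE.
Qed.

Lemma score_vertices_spec s j : ready s -> nmem s iStep 0 = j ->
  ensures score_vertices s (fun s' => forall v : 'I_n, rmem s' rScore v =
    greedy_score w N k (guess_degree s) j (fun u => rmem s rGain u) (counts s) v).
Proof.
move=> rd Ej; apply: triple_seq_ensures (compute_decay_spec rd Ej) _ => s1 ag1 Ed.
pose score v := greedy_score w N k (guess_degree s) j (fun u => rmem s rGain u) (counts s) v.
apply: triple_post (ensures_vertices (Inv := fun l s' =>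
  forall v : 'I_n, (v < l)%N -> rmem s' rScore v = score v) n_le_U _ _ _) _ => //.
  move=> v s2 ag2 Ev scored.
  have rd2 : ready s2 by apply: (ready_agree ag2 isT); apply: (ready_agree ag1 isT).
  apply: triple_post (score_vertex_spec (j := j) rd2 _ Ev _) _; [by frame|by frame|].
  move=> s3 [E3 kept3]; apply: forall_ltnS => [|u uv]; rewrite /= ?E3.
    rewrite /score /greedy_score /pair_score (@eq_guess_degree s); last by move=> t; frame.
    by rewrite (@eq_counts _ _ s) => [|u]; frame.
  by rewrite kept3 ?scored // ltn_eqF.
by move=> s' scored v; apply: scored.
Qed.

Lemma take_forced_spec s : ensures take_forced s (fun s' => represents s' aSet I).
Proof.
by apply: (fill_spec n_le_U (F := fun v => v \in I)) => // v s' _ _ Ev; rewrite /= Ev valK.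
Qed.

Lemma select_best_spec s : ensures select_best s (fun s' => exists Z,
  [/\ represents s' aSet Z, feasible J Z & forall O, feasible J O ->
    \sum_(v in O) rmem s rScore v <= \sum_(v in Z) rmem s rScore v]).
Proof.
have /andP[Ik kn] := target_range J.
apply: triple_seq_ensures (take_forced_spec _) _ => s1 ag1 r1.
apply: triple_seq_ensures (count_members_spec n_le_U r1) _ => s2 ag2 E2.
have r2 : represents s2 aSet I by move=> v; frame.
apply: triple_post (grow_spec n_le_U (leq_trans kn n_le_U) r2 _) _; first by rewrite E2 subnKC.
move=> s3 [Z [r3 sIZ cZ top]]; exists Z; rewrite E2 subnKC // in cZ; split=> //.
  by rewrite /feasible cZ eqxx.
move=> O /andP[/eqP cO sIO]; apply: (sum_le_top sIO); first by rewrite cO cZ.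
by move=> u v uZ uI vZ; have := top u v uZ uI vZ; frame.
Qed.

Definition valid_counts j c : Prop :=
  [/\ forall v, (c v <= j)%N, (\sum_v c v = j * k)%N & forall v, v \in I -> c v = j].

Lemma valid_counts0 : valid_counts 0 [ffun=> 0%N].
Proof. by split=> [v||v _]; rewrite ?ffunE // big1 // => v _; rewrite ffunE. Qed.

Lemma valid_counts_add j c Z : valid_counts j c -> feasible J Z ->
  valid_counts j.+1 (add_set c Z).
Proof.
move=> [c_le sum_c c_forced] /andP[/eqP kZ sIZ]; split=> [v||v vI].
- by rewrite ffunE -addn1 leq_add ?leq_b1.
- under eq_bigr do rewrite ffunE.
  rewrite big_split /= sum_c mulSn addnC; congr (_ + _)%N.
  by rewrite -kZ -sum1_card [RHS]big_mkcond; apply: eq_bigr => v _; case: (v \in Z).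
- by rewrite ffunE c_forced // (subsetP sIZ) // addn1.
Qed.

(* The potential [phi], for which the greedy choice pays except for the sampling
   error of the gradient, whose expectation is at most [N * n * M ^+ 2]. *)
Variables (y : 'I_n -> R) (lam M : R) (phi : nat -> {ffun 'I_n -> nat} -> R).
Hypotheses (lam_ge0 : 0 <= lam) (gain_le : forall X v, gain h X v <= M).
Hypothesis phi_step : forall j c acc Z, (j < N)%N -> valid_counts j c -> feasible J Z ->
  (forall O, feasible J O -> \sum_(v in O) greedy_score w N k y j acc c v <=
                             \sum_(v in Z) greedy_score w N k y j acc c v) ->
  phi j c + lam * (N%:R * n%:R) * M ^+ 2 <= phi j.+1 (add_set c Z) +
    lam * \sum_v (acc v - N%:R * mean_gain h (fractional R N c) v) ^+ 2.

Lemma greedy_step_spec s j : ready s -> nmem s iStep 0 = j -> (j < N)%N ->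
  guess_degree s =1 y -> valid_counts j (counts s) ->
  triple greedy_step s (fun s' => valid_counts j.+1 (counts s'))
    (fun s' => phi j.+1 (counts s')) (phi j (counts s)).
Proof.
move=> rd Ej jN guess_y valid; have [c_le _ _] := valid; have [EN _ _] := rd.
have cN v : (counts s v <= N)%N := leq_trans (c_le v) (ltnW jN).
have sampled := triple_addr (phi j (counts s) + lam * (N%:R * n%:R) * M ^+ 2)
  (triple_frame (gradient_spec n_le_U N_le_U N_gt0 lam_ge0 gain_le EN cN)).
rewrite [X in triple _ _ _ _ X]addrC addrK in sampled.
apply: triple_seq sampled _ => s1 [_ ag1].
have rd1 : ready s1 := ready_agree ag1 isT rd.
have Ej1 : nmem s1 iStep 0 = j by frame.
apply: triple_seq_ensures (score_vertices_spec rd1 Ej1) _ => s2 ag2 scored.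
apply: triple_seq_ensures (select_best_spec s2) _ => s3 ag3 [Z [rZ fZ top]].
have added : ensures (fill aCount (NAdd (NGet aCount (cell iVertex)) (NGet aSet (cell iVertex))))
    s3 (fun s' => counts s' = add_set (counts s) Z).
  apply: triple_post (fill_spec n_le_U (F := add_set (counts s) Z) _ _) _ => //.
    by move=> v s' ag kept Ev; rewrite /= Ev kept // !ffunE; frame; rewrite rZ.
  by move=> s' E; apply/ffunP => v; rewrite ffunE E.
apply: triple_post (triple_const added _) _ => s' ->; last exact: valid_counts_add.
pose acc (v : 'I_n) := rmem s1 rGain v.
have scoreE (S : {set 'I_n}) : \sum_(v in S) rmem s2 rScore v =
    \sum_(v in S) greedy_score w N k y j acc (counts s) v.
  apply: eq_bigr => v _; rewrite scored /greedy_score /pair_score.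
  rewrite (@eq_counts _ _ s) => [|u]; last by frame.
  by rewrite (@eq_guess_degree s) ?guess_y // => t; frame.
have best O : feasible J O -> \sum_(v in O) greedy_score w N k y j acc (counts s) v <=
    \sum_(v in Z) greedy_score w N k y j acc (counts s) v.
  by move=> fO; rewrite -!scoreE; apply: top.
by have := phi_step jN valid fZ best; rewrite /sqr_error /acc; lra.
Qed.

Lemma try_greedy_spec s (psi : {set 'I_n} -> R) :
  ready s -> incumbent J s -> guess_degree s =1 y ->
  (forall c, valid_counts N c -> phi N c <= mean (fractional R N c) psi) ->
  (forall X T, I \subset X -> resized h I k X T -> feasible J T -> psi X <= objective T) ->
  triple try_greedy s (improved J s) (fun s' => rmem s' rBest 0) (phi 0%N [ffun=> 0%N]).
Proof.
move=> rd inc guess_y phi_end psi_le.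
apply: triple_seq_ensures (fill_spec n_le_U (F := fun=> 0%N) _ _) _ => // s1 ag1 cleared.
have [EN _ _] := rd; have rd1 := ready_agree ag1 isT rd.
have c0 : counts (set_nat s1 iStep 0 0) = [ffun=> 0%N].
  by apply/ffunP => v; rewrite !ffunE /= /update /= cleared.
rewrite -c0; apply: (triple_seq (triple_frame (triple_for (m := N)
  (Inv := fun j s' => valid_counts j (counts s')) (phi := fun j s' => phi j (counts s'))
  N_le_U _ _ _ _))) => //.
- by move=> s' ag /=; frame.
- by rewrite c0; apply: valid_counts0.
- move=> j s' ag jN Ej valid.
  have setE s'' : counts (set_nat s'' iStep 0 j.+1) = counts s''.
    by apply: eq_counts => v.
  have guess_y' : guess_degree s' =1 y.
    by move=> v; rewrite (@eq_guess_degree s) // => t; frame.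
  apply: triple_conseq (greedy_step_spec (ready_agree ag isT rd1) Ej jN guess_y' valid) _ (lexx _).
  by move=> s''; rewrite setE.
move=> s2 [valid ag2]; have [c_le _ c_forced] := valid.
have EN2 : nmem s2 nSteps 0 = N by frame.
have sampled := triple_frame (sample_spec n_le_U N_gt0 psi EN2 c_le).
apply: triple_seq (triple_conseq sampled (fun _ q => conj q (lexx _)) (phi_end _ valid)) _.
move=> s3 [[X rX forced_in] ag3]; rewrite (vertex_set_represents rX).
have sIX : I \subset X by apply/subsetP => v vI; rewrite forced_in // c_forced.
have inc3 : incumbent J s3.
  by do !(apply: incumbent_agree; [eassumption|exact: isT|exact: isT|]).
apply: triple_post (triple_const (resize_and_record_spec n_le_U rX sIX inc3) _) _.
  by move=> s4 [_ [T [rT fT le_T]]]; apply: le_trans le_T; apply: psi_le.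
move=> s4 [imp4 _]; do !(apply: improved_agree; [eassumption|exact: isT|]).
exact: imp4.
Qed.

End GreedyRun.

Definition divide : cmd :=
  nTmp ::= NLit 0 ;;
  For iInner (cell nCodes)
    (If (BNatLe NVert (cell nRest))
      (nRest ::= NSub (cell nRest) NVert ;; nTmp ::= NAdd (cell nTmp) (NLit 1)) Skip).

(* Guesses the vertices given by the base-n digits of the number of the round. *)
Definition decode : cmd :=
  nRest ::= cell iCode ;;
  For iRound (cell nArity)
    (divide ;; SetNat aGuess (cell iRound) (cell nRest) ;; nRest ::= cell nTmp).

Definition add_guess : cmd :=
  For iRound (cell nArity) (SetNat aSet (NGet aGuess (cell iRound)) (NLit 1)).

Definition try_guess : cmd := take_forced ;; add_guess ;; resize_and_record.

Definition attempt : cmd := decode ;; try_guess ;; try_greedy.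

Definition search : cmd := For iCode (NAdd (cell nCodes) (NLit 1)) attempt.

Definition digit (b q t : nat) : nat := q %/ b ^ t %% b.

Lemma exists_code (b r : nat) (f : nat -> nat) : (forall t, (t < r)%N -> (f t < b)%N) ->
  exists2 q, (q < b ^ r)%N & forall t, (t < r)%N -> digit b q t = f t.
Proof.
rewrite /digit; elim: r f => [|r IH] f f_lt; first by exists 0%N.
have [q qr digits] := IH (fun t => f t.+1) (fun t tr => f_lt t.+1 tr).
have f0 := f_lt 0%N isT; have b0 : (0 < b)%N by apply: leq_ltn_trans f0.
exists (q * b + f 0)%N.
  rewrite expnSr; apply: (@leq_trans (q.+1 * b)); last by rewrite leq_mul2r qr orbT.
  by rewrite mulSn addnC ltn_add2r.
case=> [_|t tr]; first by rewrite expn0 divn1 modnMDl modn_small.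
by rewrite expnS divnMA divnMDl // (divn_small f0) addn0 digits.
Qed.

Section Search.
Variables (R : realType) (J : instance R) (U N r B : nat).
Local Notation n := (nvert J).
Local Notation k := (target J).
Local Notation I := (forced J).
Local Notation h := (reward J).
Local Notation triple := (triple J U).
Local Notation ensures := (ensures J U).
Local Notation memory := (memory R).
Local Notation ready := (ready N r B).
Hypotheses (n_le_U : (n <= U)%N) (N_le_U : (N <= U)%N) (r_le_U : (r <= U)%N) (B_lt_U : (B < U)%N).
Hypothesis N_gt0 : (0 < n)%N -> (0 < N)%N.
Implicit Types (s : memory) (X T : {set 'I_n}) (g : R).

Lemma divide_spec s : ready s ->
  ensures divide s (fun s' => (0 < n)%N -> (nmem s nRest 0 <= B)%N ->
    nmem s' nTmp 0 = nmem s nRest 0 %/ n /\ nmem s' nRest 0 = nmem s nRest 0 %% n)%N.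
Proof.
move=> [_ _ EB]; apply: triple_seq_set_nat; set z := nmem s nRest 0.
pose Inv (l : nat) s' := z = (nmem s' nTmp 0 * n + nmem s' nRest 0)%N /\
  ((nmem s' nRest 0 < n)%N \/ nmem s' nTmp 0 = l).
apply: triple_post (ensures_for (m := B) (Inv := Inv) _ _ _ _ _) _ => //; first exact: ltnW.
- by move=> s' ag /=; frame.
- by split=> //; right.
- move=> l s' ag lB _ [Ez small]; apply: triple_if; rewrite /=; case: leqP => nz.
    apply: triple_seq_set_nat; apply: triple_set_nat => //=.
    rewrite /Inv /= /update /=; case: small => [|Et]; first by rewrite ltnNge nz.
    by split; [rewrite Ez mulnDl mul1n -addnA subnKC|right; rewrite Et addn1].
  by apply: triple_skip => //; split=> //; left.
move=> s' [Ez small] n0 zB; have lt_n : (nmem s' nRest 0 < n)%N.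
  case: small => // Et; have := leq_pmulr B n0; rewrite ltnNge; apply: contraL => le_n.
  by rewrite -ltnNge (leq_trans _ zB) // Ez Et -addn1 leq_add // (leq_trans n0).
by rewrite Ez divnMDl // divn_small // addn0 modnMDl modn_small.
Qed.

Definition decoded (q : nat) s : Prop := (0 < n)%N -> (q <= B)%N ->
  forall t, (t < r)%N -> nmem s aGuess t = digit n q t.

Lemma decode_spec s : ready s -> ensures decode s (decoded (nmem s iCode 0)).
Proof.
move=> rd; have [_ Er _] := rd; apply: triple_seq_set_nat; set q := nmem s iCode 0.
pose Inv (t : nat) s' := (0 < n)%N -> (q <= B)%N -> nmem s' nRest 0 = (q %/ n ^ t)%N /\
  forall i, (i < t)%N -> nmem s' aGuess i = digit n q i.
apply: triple_post (ensures_for (m := r) (Inv := Inv) _ _ _ _ _) _ => //.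
- by move=> s' ag /=; frame.
- by move=> _ _ /=; rewrite /update /= expn0 divn1.
- move=> t s1 ag1 tr Et Inv_t.
  have rd1 : ready s1 by move: rd => [? ? ?]; split; frame.
  apply: triple_seq_ensures (divide_spec rd1) _ => s2 ag2 divided.
  apply: triple_seq_set_nat; apply: triple_set_nat => //= n0 qB.
  have [Ez digits] := Inv_t n0 qB.
  have zB : (nmem s1 nRest 0 <= B)%N by rewrite Ez (leq_trans (leq_div _ _)).
  have [Eq Er2] := divided n0 zB.
  rewrite Ez in Eq Er2; rewrite /= /update /= (_ : nmem s2 iRound 0 = t); last by frame.
  split=> [|i]; first by rewrite Eq expnSr divnMA.
  rewrite ltnS leq_eqVlt => /orP[/eqP->|it]; first by rewrite eqxx Er2.
  by rewrite ltn_eqF //; frame; apply: digits.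
by move=> s' Inv_r n0 qB; case: (Inv_r n0 qB).
Qed.

Definition guessed s : {set 'I_n} :=
  [set v : 'I_n | [exists t : 'I_r, nmem s aGuess t == v :> nat]].

Lemma add_guess_spec s X : ready s -> represents s aSet X ->
  ensures add_guess s (fun s' => represents s' aSet (X :|: guessed s)).
Proof.
move=> [_ Er _] rX; pose part (t : nat) := X :|:
  [set v : 'I_n | [exists i : 'I_r, (i < t)%N && (nmem s aGuess i == v :> nat)]].
apply: triple_post (ensures_for (m := r) (Inv := fun t s' => represents s' aSet (part t))
  r_le_U _ _ _ _) _ => //.
- by move=> s' ag /=; frame.
- move=> v; rewrite /= /update /= rX !inE; congr (nat_of_bool _).
  by rewrite [X in _ || X](_ : _ = false) ?orbF //; apply/existsP => -[i].
- move=> t s2 ag tr Et r2; apply: triple_set_nat => // v; rewrite /= /update /= Et; frame.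
  have [Ev|nv] := eqVneq (v : nat) (nmem s aGuess t).
    rewrite !inE; have -> : [exists i : 'I_r, (i < t.+1)%N && (nmem s aGuess i == v)].
      by apply/existsP; exists (Ordinal tr); rewrite /= ltnSn Ev eqxx.
    by rewrite orbT.
  rewrite r2 !inE; congr (nat_of_bool (_ || _)); apply: eq_existsb => i.
  rewrite ltnS [in RHS]leq_eqVlt; have [Ei|//] := eqVneq (i : nat) t.
  by rewrite Ei ltnn /= eq_sym (negPf nv).
move=> s' rT v; rewrite rT !inE; congr (nat_of_bool (_ || _)).
by apply: eq_existsb => i; rewrite ltn_ord.
Qed.

Lemma try_guess_spec s : ready s -> incumbent J s ->
  ensures try_guess s (fun s' => improved J s s' /\
    (feasible J (I :|: guessed s) -> objective (I :|: guessed s) <= rmem s' rBest 0)).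
Proof.
move=> rd inc; apply: triple_seq_ensures (take_forced_spec n_le_U s) _ => s1 ag1 r1.
apply: triple_seq_ensures (add_guess_spec (ready_agree ag1 isT rd) r1) _ => s2 ag2.
have -> : guessed s1 = guessed s.
  by apply/setP => v; rewrite !inE; apply: eq_existsb => t; frame.
set X := I :|: guessed s => r2; have inc2 : incumbent J s2.
  by do !(apply: incumbent_agree; [eassumption|exact: isT|exact: isT|]).
apply: triple_post (resize_and_record_spec n_le_U r2 (subsetUl _ _) inc2) _.
move=> s3 [imp3 [T [[sIT kT up _] fT best]]]; split.
  by do !(apply: improved_agree; [eassumption|exact: isT|]).
move=> /andP[/eqP kX _]; suff -> : X = T by [].
by apply/eqP; rewrite eqEcard kX kT up ?kX /=.
Qed.

Definition improves c s g : Prop := triple c s (improved J s) (fun s' => rmem s' rBest 0) g.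

Lemma attempt_spec s g : ready s -> incumbent J s ->
  (forall s', ready s' -> recorded J s' -> decoded (nmem s iCode 0) s' ->
     (feasible J (I :|: guessed s') -> objective (I :|: guessed s') <= rmem s' rBest 0) ->
     improves try_greedy s' g) ->
  improves attempt s g.
Proof.
move=> rd inc greedy; apply: triple_seq_ensures (decode_spec rd) _ => s1 ag1 dec1.
have rd1 := ready_agree ag1 isT rd.
have inc1 : incumbent J s1 := incumbent_agree ag1 isT isT inc.
apply: triple_seq_ensures (try_guess_spec rd1 inc1) _ => s2 ag2 [imp2 best2].
have guessedE : guessed s2 = guessed s1.
  by apply/setP => v; rewrite !inE; apply: eq_existsb => t; frame.
rewrite -guessedE in best2.
have dec2 : decoded (nmem s iCode 0) s2.
  by move=> n0 qB t tr; rewrite -(dec1 n0 qB t tr); frame.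
apply: triple_post (greedy s2 (ready_agree ag2 isT rd1) imp2.1 dec2 best2) _ => s3 imp3.
by apply: improved_agree ag1 _ (improved_trans imp2 imp3).
Qed.

Lemma gain_le_total X v : gain h X v <= h setT.
Proof.
have : h (v |: X) <= h setT by apply: reward_monotone; apply: subsetT.
by have := reward_ge0 (i := J) X; rewrite /gain; lra.
Qed.

Lemma try_greedy_improves s g : ready s -> incumbent J s ->
  (forall s', improved J s s' -> g <= rmem s' rBest 0) -> improves try_greedy s g.
Proof.
move=> rd inc le_g; apply: triple_const le_g.
apply: (try_greedy_spec (lam := 0) (M := h setT) (phi := fun _ _ => 0) (psi := fun=> 0)
  n_le_U N_le_U r_le_U N_gt0 (lexx 0) gain_le_total _ rd inc (frefl _)).
- by move=> *; rewrite !mul0r.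
- by move=> c _; rewrite mean_const.
- by move=> X T _ _ _; apply: objective_ge0.
Qed.

Lemma attempt_improves s g : ready s -> incumbent J s ->
  (forall T, feasible J T -> g <= objective T) -> improves attempt s g.
Proof.
move=> rd inc le_g; apply: attempt_spec => // s' rd' rec' _ _.
apply: try_greedy_improves => // [|s'' [[T [_ fT ->]] _]]; last exact: le_g.
exact: recorded_incumbent.
Qed.

Lemma search_spec s q g : ready s -> rmem s rBest 0 < 0 -> (q <= B)%N ->
  (forall s', ready s' -> nmem s' iCode 0 = q -> incumbent J s' -> improves attempt s' g) ->
  triple search s (recorded J) (fun s' => rmem s' rBest 0) g.
Proof.
move=> rd best_lt0 qB good.
pose Inv (j : nat) s' := if j is 0%N then incumbent J s' else recorded J s'.
pose phi (j : nat) s' := if (j <= q)%N then g else rmem s' rBest 0.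
have [_ _ EB] := rd.
apply: (triple_conseq (triple_for (m := B.+1) (Inv := Inv) (phi := phi) B_lt_U _ _ _ _)) => //.
- by move=> s' ag /=; frame; rewrite EB addn1.
- by right.
- move=> j s1 ag1 jB Ej Inv_j; have rd1 := ready_agree ag1 isT rd.
  have inc1 : incumbent J s1 by case: j Inv_j {jB Ej} => // j; apply: recorded_incumbent.
  have [Ejq|neq_jq] := eqVneq j q.
    apply: (triple_conseq (good s1 rd1 (etrans Ej Ejq) inc1)) => [s2 [rec2 _]|].
      by split=> //; rewrite /phi Ejq ltnn.
    by rewrite /phi Ejq leqnn.
  have step := triple_ensures (attempt_improves (g := 0) rd1 inc1 (fun T _ => objective_ge0 T)).
  apply: triple_post (triple_const step _) _ => s2 [rec2 le2] //.
  by rewrite /phi ltn_neqAle neq_jq /=; case: (j <= q)%N.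
- by move=> s' rec'; split=> //; rewrite /phi ltnNge qB.
Qed.

End Search.

Definition round_log : cmd :=
  nLog ::= NLit 0 ;; nTmp ::= NLit 1 ;;
  For iVertex NVert (If (BNatLe NVert (cell nTmp)) Skip
    (nTmp ::= NAdd (cell nTmp) (cell nTmp) ;; nLog ::= NAdd (cell nLog) (NLit 1))).

Definition compute_codes : cmd :=
  nCodes ::= NLit 1 ;;
  For iRound (cell nArity)
    (nTmp ::= NLit 0 ;; nat_sum_loop iVertex NVert nTmp (cell nCodes) ;; nCodes ::= cell nTmp).

Definition init (K : nat) : cmd :=
  round_log ;;
  nArity ::= NLit 0 ;; nat_sum_loop iRound (NLit K) nArity (NAdd (cell nLog) (NLit 1)) ;;
  nRest ::= NLit 0 ;; nat_sum_loop iVertex NVert nRest NVert ;;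
  nSteps ::= NLit 0 ;; nat_sum_loop iRound (NLit K.+1) nSteps (cell nRest) ;;
  compute_codes ;;
  rBest :r= RSub (RNat (NLit 0)) rone.

Definition program (K : nat) : cmd := init K ;; search.

Definition arity (K n : nat) : nat := K * (up_log 2 n).+1.
Definition codes (K n : nat) : nat := n ^ arity K n.
Definition steps (K n : nat) : nat := K.+1 * (n * n).
Definition max_rounds (K n : nat) : nat := (n + K + steps K n + arity K n + codes K n).+1.

Lemma steps_gt0 K n : (0 < n)%N -> (0 < steps K n)%N.
Proof. by move=> n0; rewrite !muln_gt0 n0. Qed.

Section Program.
Variables (R : realType) (J : instance R) (K : nat).
Local Notation n := (nvert J).
Local Notation U := (max_rounds K n).
Local Notation triple := (triple J U).
Local Notation ensures := (ensures J U).
Local Notation memory := (memory R).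
Local Notation ready := (ready (steps K n) (arity K n) (codes K n)).
Implicit Types (s : memory).

Let n_le_U : (n <= U)%N.
Proof. by rewrite /max_rounds; lia. Qed.

Let arity_le_U : (arity K n <= U)%N.
Proof. by rewrite /max_rounds; lia. Qed.

Lemma round_log_spec s : ensures round_log s (fun s' => nmem s' nLog 0 = up_log 2 n).
Proof.
do 2 apply: triple_seq_set_nat.
pose Inv (j : nat) s' := [/\ nmem s' nTmp 0 = (2 ^ nmem s' nLog 0)%N,
  (nmem s' nLog 0 <= up_log 2 n)%N & (n <= nmem s' nTmp 0)%N \/ nmem s' nLog 0 = j].
apply: triple_post (ensures_vertices (Inv := Inv) n_le_U _ _ _) _ => //.
- by split=> //; right.
- move=> v s' ag Ev [Et le_log reached]; apply: triple_if => /=; case: leqP => n_le.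
    by apply: triple_skip => //; split=> //; left.
  apply: triple_seq_set_nat; apply: triple_set_nat => //=.
  rewrite /Inv /= /update /= addn1; split.
  + by rewrite Et expnS mul2n addnn.
  + rewrite ltnNge; apply: contraL n_le => log_le; rewrite -leqNgt Et.
    by rewrite (leq_trans (@up_logP 2 n isT)) ?leq_exp2l.
  + by right; case: reached => [|->] //; rewrite leqNgt n_le.
move=> s' [Et le_log reached]; apply/eqP; rewrite eqn_leq le_log /=.
apply: up_log_min => //; rewrite -Et; case: reached => // Elog.
by rewrite Et Elog ltnW // ltn_expl.
Qed.

Lemma compute_codes_spec s : nmem s nArity 0 = arity K n ->
  ensures compute_codes s (fun s' => nmem s' nCodes 0 = codes K n).
Proof.
move=> Er; apply: triple_seq_set_nat.
apply: (ensures_for (m := arity K n) (Inv := fun j s' => nmem s' nCodes 0 = n ^ j)%N) => //.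
- by move=> s' ag /=; frame.
- move=> j s' _ _ _ Es; apply: triple_seq_set_nat.
  apply: triple_seq_ensures (nat_sum_loop_spec (m := n) (F := fun=> n ^ j)%N n_le_U _ _ _) _ => //.
    by move=> u s2 ag2 _ _ /=; frame.
  move=> s2 ag2 E2; apply: triple_set_nat => //=.
  by rewrite /update /= E2 /= /update /= add0n sum_nat_const_nat subn0 expnS.
Qed.

Lemma init_spec s : ensures (init K) s (fun s' => ready s' /\ rmem s' rBest 0 = -1).
Proof.
apply: triple_seq_ensures (round_log_spec s) _ => s1 ag1 E1; apply: triple_seq_set_nat.
apply: triple_seq_ensures (nat_sum_loop_spec (m := K) (F := fun=> (up_log 2 n).+1) _ _ _ _) _ => //.
- by rewrite /max_rounds; lia.
- by move=> j s' ag _ _ /=; frame; rewrite E1 addn1.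
move=> s2 ag2 Er; apply: triple_seq_set_nat.
apply: triple_seq_ensures (nat_sum_loop_spec (m := n) (F := fun=> n) n_le_U _ _ _) _ => //.
move=> s3 ag3 En2; apply: triple_seq_set_nat.
apply: triple_seq_ensures (nat_sum_loop_spec (m := K.+1) (F := fun=> n * n)%N _ _ _ _) _ => //.
- by rewrite /max_rounds; lia.
- by move=> j s' ag _ _ /=; frame; rewrite En2 /= /update /= add0n sum_nat_const_nat subn0.
move=> s4 ag4 EN.
have Er4 : nmem s4 nArity 0 = arity K n.
  by frame; rewrite Er /= /update /= add0n sum_nat_const_nat subn0.
apply: triple_seq_ensures (compute_codes_spec Er4) _ => s5 ag5 Ec.
apply: triple_set_real => //=; split; last by rewrite /update /= sub0r.
split=> //=; last by frame; rewrite -Er4; frame.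
by rewrite (agree_nmem 0 ag5) // EN /= /update /= add0n sum_nat_const_nat subn0.
Qed.

Lemma program_spec q g : (q <= codes K n)%N ->
  (forall s, ready s -> nmem s iCode 0 = q -> incumbent J s ->
     improves J U attempt s g) ->
  triple (program K) (memory0 R) (fun s => feasible J (vertex_set J s 0))
    (fun s => objective (vertex_set J s 0)) g.
Proof.
move=> q_le good; apply: triple_seq_ensures (init_spec _) _ => s1 _ [rd best1].
apply: triple_conseq (search_spec n_le_U _ _ _ (@steps_gt0 K n) rd _ q_le good) _ (lexx _).
- by rewrite /max_rounds; lia.
- by rewrite /max_rounds; lia.
- by rewrite /max_rounds; lia.
- by rewrite best1 oppr_lt0 ltr01.
by move=> s2 [T [rT fT ->]]; rewrite (vertex_set_represents rT).
Qed.

End Program.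

(** * Quality of the output *)

Section InitialPotential.
Variables (R : realType) (V : finType) (h : {set V} -> R) (w : V -> V -> R).
Hypotheses (h_ge0 : forall X, 0 <= h X) (w01 : forall u v, 0 <= w u v <= 1).
Hypothesis wxx : forall v, w v v = 0.
Variables (N k s : nat) (y : V -> R) (O : {set V}) (H : R).
Hypotheses (s_gt0 : (0 < s)%N) (k_gt1 : (1 < k)%N) (k_le : (k <= #|V|)%N) (kO : #|O| = k).
Hypotheses (N_ge : (#|V| ^ 2 * s ^ 2 <= N)%N) (H_ge0 : 0 <= H).
Local Notation kappa := (pair_scale R k).
Local Notation n := #|V|.

(* Strictly above the maximum gain [H], since the tolerance must be positive. *)
Definition gain_bound : R := H + 1.
Definition degree_error : R := k%:R / s%:R.
Definition tolerance : R := N%:R * gain_bound / (n%:R * s%:R).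

Let s_ge1 : 1 <= s%:R :> R.
Proof. by rewrite ler1n. Qed.

Let n_ge1 : 1 <= n%:R :> R.
Proof. by rewrite ler1n (leq_trans _ k_le) // ltnW. Qed.

Let s_gt0R : 0 < s%:R :> R.
Proof. by rewrite ltr0n. Qed.

Let n_gt0R : 0 < n%:R :> R.
Proof. exact: lt_le_trans n_ge1. Qed.

Let N_geR : n%:R ^+ 2 * s%:R ^+ 2 <= N%:R :> R.
Proof. by rewrite -!natrX -natrM ler_nat. Qed.

Let N_gt0 : 0 < N%:R :> R.
Proof. by apply: lt_le_trans N_geR; rewrite mulr_gt0 ?exprn_gt0. Qed.

Let gain_bound_gt0 : 0 < gain_bound.
Proof. by rewrite /gain_bound ltr_wpDl. Qed.

Lemma tolerance_gt0 : 0 < tolerance.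
Proof. by rewrite divr_gt0 ?mulr_gt0. Qed.

Lemma total_step_error_le :
  N%:R * step_error V N k gain_bound degree_error tolerance <= (2 * H + 6) / s%:R.
Proof.
have -> : N%:R * step_error V N k gain_bound degree_error tolerance =
    2 * (kappa * k%:R ^+ 2) / s%:R + k%:R ^+ 2 * gain_bound / N%:R +
    gain_bound / (2 * s%:R) + n%:R ^+ 2 * s%:R * gain_bound / (2 * N%:R).
  rewrite /step_error /noise_rate /degree_error /tolerance.
  by field; rewrite !gt_eqF.
have pairs_error : 2 * (kappa * k%:R ^+ 2) / s%:R <= 4 / s%:R.
  by rewrite ler_wpM2r ?invr_ge0 //; have := pair_scale_sqr_le2 R k_gt1; lra.
have k_le_n : k%:R ^+ 2 <= n%:R ^+ 2 :> R by rewrite lerXn2r ?nnegrE // ler_nat.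
have n2s_le : n%:R ^+ 2 * s%:R <= N%:R / s%:R :> R.
  by rewrite ler_pdivlMr // -mulrA -expr2.
have n2_le : n%:R ^+ 2 <= N%:R / s%:R :> R.
  by apply: le_trans n2s_le; rewrite ler_peMr // sqr_ge0.
have curvature_error : k%:R ^+ 2 * gain_bound / N%:R <= gain_bound / s%:R.
  rewrite ler_pdivrMr //.
  by have := ler_wpM2r (ltW gain_bound_gt0) (le_trans k_le_n n2_le); lra.
have noise_error : n%:R ^+ 2 * s%:R * gain_bound / (2 * N%:R) <= gain_bound / (2 * s%:R).
  rewrite ler_pdivrMr ?mulr_gt0 // invfM.
  by have := ler_wpM2r (ltW gain_bound_gt0) n2s_le; lra.
have -> : (2 * H + 6) / s%:R = 4 / s%:R + gain_bound / s%:R + gain_bound / (2 * s%:R) +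
    gain_bound / (2 * s%:R) by rewrite /gain_bound; field; rewrite gt_eqF.
lra.
Qed.

Lemma initial_pairs_ge : kappa * pairs w O - 3 / s%:R <=
  (1 - N%:R^-1) * (kappa * (pairs w O - k%:R * degree_error)).
Proof.
have scaled_le1 : kappa * pairs w O <= 1 by rewrite -kO pairs_le1.
have error0 : 0 <= kappa * k%:R ^+ 2 / s%:R.
  by rewrite divr_ge0 // mulr_ge0 ?sqr_ge0 ?pair_scale_ge0.
have error_le : kappa * k%:R ^+ 2 / s%:R <= 2 / s%:R.
  by rewrite ler_wpM2r ?invr_ge0 // pair_scale_sqr_le2.
have i0 : 0 < N%:R^-1 :> R by rewrite invr_gt0.
have i_le : N%:R^-1 <= s%:R^-1 :> R.
  rewrite lef_pV2 ?posrE //; apply: le_trans N_geR.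
  have s_le : s%:R <= s%:R ^+ 2 :> R by rewrite expr2 ler_peMr // ltW.
  by apply: le_trans s_le _; rewrite ler_peMl ?sqr_ge0 ?exprn_ege1.
have -> : kappa * (pairs w O - k%:R * degree_error) =
    kappa * pairs w O - kappa * k%:R ^+ 2 / s%:R by rewrite /degree_error; ring.
have := ler_piMr (ltW i0) scaled_le1; have := mulr_ge0 (ltW i0) error0.
have -> : 3 / s%:R = s%:R^-1 + 2 / s%:R :> R by ring.
lra.
Qed.

Lemma potential_start_ge :
  (1 - (expR 1)^-1) * h O + kappa * pairs w O - (2 * H + 9) / s%:R <=
  potential h w N k y O gain_bound degree_error tolerance 0 [ffun=> 0%N].
Proof.
have N0 : (0 < N)%N by rewrite -(ltr_nat R).
apply: le_trans (potential_start w h_ge0 k y O gain_bound degree_error tolerance N0).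
have -> : (2 * H + 9) / s%:R = (2 * H + 6) / s%:R + 3 / s%:R by ring.
by have := initial_pairs_ge; have := total_step_error_le; lra.
Qed.

End InitialPotential.

Lemma exists_superset_card (V : finType) (X : {set V}) k : (#|X| <= k <= #|V|)%N ->
  exists2 T : {set V}, X \subset T & #|T| = k.
Proof.
move=> /andP[Xk kV]; have [d Ek] : exists d, k = (#|X| + d)%N by exists (k - #|X|)%N; lia.
elim: d X Xk Ek => [|d IH] X Xk Ek; first by exists X; rewrite // Ek addn0.
have /card_gt0P[v] : (0 < #|~: X|)%N by rewrite cardsCs setCK; lia.
rewrite inE => vX; have cX : #|v |: X| = #|X|.+1 by rewrite cardsU1 vX.
have [||T sT kT] := IH (v |: X); rewrite ?cX; [lia|lia|].
by exists T => //; apply: subset_trans sT; apply: subsetUr.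
Qed.

Section Quality.
Variables (R : realType) (J : instance R) (s : nat).
Local Notation n := (nvert J).
Local Notation k := (target J).
Local Notation I := (forced J).
Local Notation h := (reward J).
Local Notation w := (pair_weight (weight J)).
Local Notation K := (8 * s ^ 2)%N.
Local Notation N := (steps K n).
Local Notation r := (arity K n).
Local Notation B := (codes K n).
Local Notation U := (max_rounds K n).
Local Notation improves := (improves J U).
Local Notation memory := (memory R).
Local Notation ready := (ready N r B).
Hypothesis s_gt0 : (0 < s)%N.
Variables (O : {set 'I_n}) (H : R).
Hypotheses (fO : feasible J O) (h_le : forall T, feasible J T -> h T <= H).
Implicit Types (m : memory).

Definition guarantee : R :=
  (1 - (expR 1)^-1) * h O + den (weight J) O - (3 * H + 15) / s%:R.

Let le_max_rounds : [/\ n <= U, N <= U, r <= U & B < U]%N.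
Proof. by rewrite /max_rounds; split; lia. Qed.

Let H_ge0 : 0 <= H.
Proof. exact: le_trans (reward_ge0 O) (h_le fO). Qed.

Lemma guarantee_le : guarantee <= objective O.
Proof.
have : 0 <= (3 * H + 15) / s%:R by rewrite divr_ge0 // addr_ge0 // mulr_ge0.
have : 0 <= (expR 1)^-1 * h O by rewrite mulr_ge0 ?reward_ge0 // invr_ge0 expR_ge0.
by rewrite /guarantee /objective; lra.
Qed.

Lemma gain_le_feasible X v : (#|I| < k)%N -> gain h X v <= H.
Proof.
move=> Ik; have /andP[_ kn] := target_range J.
apply: le_trans (gain_antimono (@reward_monotone _ J) (@reward_submodular _ J) v (sub0set X)) _.
have [|T sT kT] := @exists_superset_card _ (v |: I) k.
  by rewrite card_ord kn andbT cardsU1; case: (v \notin I); rewrite ?add0n ?add1n // ltnW.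
have : h (v |: set0) <= h T.
  by apply: reward_monotone; rewrite setU0 (subset_trans _ sT) // subsetUl.
have : h T <= H by apply: h_le; rewrite /feasible kT eqxx (subset_trans _ sT) // subsetUr.
by have := reward_ge0 (i := J) set0; rewrite /gain; lra.
Qed.

Lemma try_greedy_quality m : (1 < k)%N -> (s ^ 2 <= k - #|I|)%N ->
  ready m -> incumbent J m ->
  (forall u, `|guess_degree r m u - \sum_(v in O) w u v| <= degree_error R k s) ->
  improves try_greedy m guarantee.
Proof.
move=> k_gt1 sk rd inc guess_error; have [nU NU rU BU] := le_max_rounds.
have /andP[Ik kn] := target_range J; have /andP[/eqP cO sIO] := fO.
have Ik' : (#|I| < k)%N.
  by rewrite -subn_gt0; apply: leq_trans sk; rewrite expn_gt0 s_gt0.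
have n_gt0 : (0 < n)%N by rewrite (leq_trans _ kn) // ltnW.
have N_gt0 := steps_gt0 K n_gt0; have NR : 0 < N%:R :> R by rewrite ltr0n.
have N_ge : (#|'I_n| ^ 2 * s ^ 2 <= N)%N.
  by rewrite card_ord /steps; move: (n * n)%N (mulnn n) => n2 <-; nia.
have k_le : (k <= #|'I_n|)%N by rewrite card_ord.
pose y := @guess_degree R J r m.
pose phi j c := potential h w N k y O (gain_bound H) (degree_error R k s)
  (tolerance 'I_n N s H) j c - (H + 6) / s%:R.
have gain_le X v : gain h X v <= gain_bound H.
  by apply: le_trans (gain_le_feasible X v Ik') _; rewrite lerDl.
have tau_gt0 := tolerance_gt0 s_gt0 k_gt1 k_le N_ge H_ge0.
apply: (triple_conseq (try_greedy_spec (y := y) (phi := phi)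
  (lam := noise_rate N (tolerance 'I_n N s H)) (M := gain_bound H)
  (psi := rounded_value h w I k H s) nU NU rU (fun=> N_gt0) _ gain_le _ rd inc (frefl y)
  _ _)) => //.
- by rewrite invr_ge0 mulr_ge0 ?sqr_ge0 // mulr_ge0 // ltW.
- move=> j c acc Z jN [c_le sum_c c_forced] /andP[/eqP kZ sIZ] top.
  have := potential_step (@reward_monotone _ J) (@reward_submodular _ J) (@weight_range _ J)
    (pair_weightC (weight J)) gain_le cO guess_error N_gt0 tau_gt0 jN c_le sum_c kZ (top O fO).
  by rewrite card_ord /phi; lra.
- move=> c [c_le sum_c c_forced]; rewrite /phi potential_end //.
  have sum_p : \sum_v fractional R N c v = k%:R.
    by rewrite -mulr_sumr -natr_sum sum_c natrM mulKf ?gt_eqF.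
  have p_forced v : v \in I -> fractional R N c v = 1.
    by move=> vI; rewrite /fractional c_forced // mulVf ?gt_eqF.
  have := mean_rounded_value_ge h (pair_weightxx (weight J)) H_ge0 s_gt0 Ik'
    (fractional_unit_range _ N_gt0 c_le) sum_p p_forced.
  by have := rounding_error_le H_ge0 s_gt0 Ik' k_gt1 sk; lra.
- move=> X T sIX rT fT; have /andP[/eqP kT _] := fT.
  rewrite /objective (den_pairs _ kT).
  exact: (rounded_value_le (@reward_monotone _ J) (@weight_range _ J) H_ge0 s_gt0 Ik' sIX rT
    (h_le fT)).
have -> : guarantee = (1 - (expR 1)^-1) * h O + pair_scale R k * pairs w O -
    (2 * H + 9) / s%:R - (H + 6) / s%:R by rewrite /guarantee (den_pairs _ cO); ring.
rewrite lerD2r; exact: (potential_start_ge (@reward_ge0 _ J) (@weight_range _ J)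
  (pair_weightxx (weight J)) y s_gt0 k_gt1 k_le cO N_ge H_ge0).
Qed.

Lemma decoded_guess q m (f : nat -> 'I_n) : (0 < n)%N -> (q <= B)%N ->
  (forall t, (t < r)%N -> digit n q t = f t) -> decoded J r B q m ->
  forall t, (t < r)%N -> nmem m aGuess t = f t.
Proof. by move=> n_gt0 qB code dec t tr; rewrite dec // code. Qed.

Lemma attempt_guesses_optimum : (k - #|I| <= r)%N -> exists2 q, (q <= B)%N &
  forall m, ready m -> nmem m iCode 0 = q -> incumbent J m -> improves attempt m guarantee.
Proof.
move=> k_small; have [nU NU rU BU] := le_max_rounds; have /andP[/eqP cO sIO] := fO.
have [O0|[o oO]] := set_0Vmem O.
  exists 0%N => // m rd _ inc; apply: (attempt_improves nU NU rU BU (@steps_gt0 K n)) => // T.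
  have k0 : k = 0%N by rewrite -cO O0 cards0.
  rewrite /feasible k0 cards_eq0 => /andP[/eqP-> _]; rewrite -O0; exact: guarantee_le.
have n_gt0 : (0 < n)%N := leq_ltn_trans (leq0n o) (ltn_ord o).
pose D := enum (O :\: I); pose f t := nth o D t.
have sD : (size D <= r)%N by rewrite -cardE cardsD (setIidPr sIO) cO.
have fO' t : f t \in O.
  case: (ltnP t (size D)) => tD; last by rewrite /f nth_default.
  by have := mem_nth o tD; rewrite mem_enum => /setDP[].
have [q qB code] := @exists_code n r (fun t => f t) (fun t _ => ltn_ord (f t)).
exists q => [|m rd Eq inc]; first exact: ltnW.
apply: (attempt_spec nU rU BU rd inc) => m' rd' rec' dec best; rewrite Eq in dec.
have guess_f := decoded_guess n_gt0 (ltnW qB) code dec.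
have EO : I :|: guessed J r m' = O.
  apply/setP => v; rewrite !inE; apply/orP/idP => [[/(subsetP sIO) //|/existsP[t /eqP Et]]|vO].
    by rewrite (_ : v = f t) //; apply: ord_inj; rewrite -Et guess_f.
  case: (boolP (v \in I)) => vI; [by left|right].
  have vD : v \in D by rewrite mem_enum inE vI.
  have lt_v : (index v D < r)%N by apply: leq_trans sD; rewrite index_mem.
  by apply/existsP; exists (Ordinal lt_v); rewrite guess_f // /f nth_index.
rewrite EO in best; apply: (try_greedy_improves nU NU rU (@steps_gt0 K n) rd').
  exact: recorded_incumbent.
by move=> m'' [_ le_best]; apply: le_trans guarantee_le (le_trans (best fO) le_best).
Qed.

Lemma attempt_guesses_sample : (r < k - #|I|)%N -> exists2 q, (q <= B)%N &
  forall m, ready m -> nmem m iCode 0 = q -> incumbent J m -> improves attempt m guarantee.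
Proof.
move=> k_large; have [nU NU rU BU] := le_max_rounds; have /andP[/eqP cO sIO] := fO.
have /andP[Ik kn] := target_range J.
have s2_gt0 : (0 < s ^ 2)%N by rewrite expn_gt0 s_gt0.
have r_ge : (8 * s ^ 2 <= r)%N by rewrite leq_pmulr.
have k_gt1 : (1 < k)%N by lia.
have n_gt0 : (0 < n)%N by rewrite (leq_trans _ kn) // ltnW.
have [||f fI f_close] := @sparse_neighbourhood R 'I_n O w r s (up_log 2 n)
  (@weight_range _ J) _ s_gt0 _ (leqnn _).
- by rewrite cO ltnW.
- by rewrite card_ord up_logP.
have r_gt0 : (0 < r)%N by lia.
pose g t := f (insubd (Ordinal r_gt0) t).
have [q qB code] := @exists_code n r (fun t => g t) (fun t _ => ltn_ord (g t)).
exists q => [|m rd Eq inc]; first exact: ltnW.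
apply: (attempt_spec nU rU BU rd inc) => m' rd' rec' dec _; rewrite Eq in dec.
have guess_g := decoded_guess n_gt0 (ltnW qB) code dec.
apply: try_greedy_quality => // [||u]; [by lia|exact: recorded_incumbent|].
have -> : guess_degree r m' u = k%:R / r%:R * \sum_(t < r) w (f t) u.
  rewrite /guess_degree big_mkord mulr_sumr; apply: eq_bigr => t _; congr (_ * _).
  by rewrite guess_g // read_weightE /g valKd.
rewrite (eq_bigr (fun v => w v u)) => [|v _]; last exact: pair_weightC.
by rewrite /degree_error -cO; apply: f_close.
Qed.

Lemma program_quality :
  triple J U (program K) (memory0 R) (fun m => feasible J (vertex_set J m 0))
    (fun m => objective (vertex_set J m 0)) guarantee.
Proof.
have [q qB good] : exists2 q, (q <= B)%N & forall m, ready m -> nmem m iCode 0 = q ->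
    incumbent J m -> improves attempt m guarantee.
  have [k_small|k_large] := leqP (k - #|I|) r; first exact: attempt_guesses_optimum.
  exact: attempt_guesses_sample.
exact: program_spec qB good.
Qed.

End Quality.

(** * Running time *)

Fixpoint loop_depth (c : cmd) : nat :=
  match c with
  | Seq c1 c2 | If _ c1 c2 => maxn (loop_depth c1) (loop_depth c2)
  | While _ c1 => (loop_depth c1).+1
  | _ => 0
  end.

Lemma loop_cost_le U c : (loop_cost U c <= loop_cost 0 c * U.+1 ^ loop_depth c)%N.
Proof.
have pos d : (0 < U.+1 ^ d)%N by rewrite expn_gt0.
have branches c1 c2 (d := maxn (loop_depth c1) (loop_depth c2)) :
    (loop_cost U c1 <= loop_cost 0 c1 * U.+1 ^ loop_depth c1)%N ->
    (loop_cost U c2 <= loop_cost 0 c2 * U.+1 ^ loop_depth c2)%N ->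
    (loop_cost U c1 + loop_cost U c2 <= (loop_cost 0 c1 + loop_cost 0 c2) * U.+1 ^ d)%N.
  move=> le1 le2; rewrite mulnDl leq_add //.
    by apply: leq_trans le1 _; rewrite leq_mul2l leq_pexp2l ?leq_maxl ?orbT.
  by apply: leq_trans le2 _; rewrite leq_mul2l leq_pexp2l ?leq_maxr ?orbT.
elim: c => [|c1 IH1 c2 IH2|a i e|a i e|b c1 IH1 c2 IH2|b c1 IH1|a i e|a i b] /=;
  rewrite ?expn0 ?muln1 //.
- by have := branches _ _ IH1 IH2; have := pos (maxn (loop_depth c1) (loop_depth c2)); nia.
- by have := branches _ _ IH1 IH2; have := pos (maxn (loop_depth c1) (loop_depth c2)); nia.
- rewrite mul1n expnS mulnCA leq_mul2l /=.
  by have := pos (loop_depth c1); move: IH1; nia.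
Qed.

Lemma loop_cost_program U K :
  (loop_cost U (program K) <= loop_cost 0 (program 0) * U.+1 ^ 4)%N.
Proof. exact: loop_cost_le. Qed.

Lemma max_rounds_le n K : (1 < n)%N ->
  ((max_rounds K n).+1 <= (2 * K + 6) * n ^ (arity K n + 2))%N.
Proof.
move=> n_gt1; rewrite /max_rounds /codes /steps; set r := arity K n.
have lt_r : (r < n ^ r)%N by apply: ltn_expl.
rewrite expnD -mulnn; set X := (n ^ r)%N in lt_r *.
have X_gt0 : (0 < X)%N by apply: leq_ltn_trans lt_r.
have sqr_le : (n * n <= X * (n * n))%N by rewrite leq_pmull.
have X_le : (4 * X <= X * (n * n))%N by rewrite mulnC leq_mul2l (leq_mul n_gt1 n_gt1) orbT.
have n_le : (2 * n <= n * n)%N by rewrite leq_mul2r n_gt1 orbT.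
nia.
Qed.

Section RunningTime.
Variable R : realType.

Lemma ln_ge_half (n : nat) : (1 < n)%N -> 2^-1 <= ln n%:R :> R.
Proof.
move=> n_gt1; have n0 : 0 < n%:R :> R by rewrite ltr0n ltnW.
have exp_half_le : expR (2^-1 : R) <= 2.
  have := expR_ge1Dx (- 2^-1 : R); rewrite expRN => inv_ge.
  have e0 := expR_gt0 (2^-1 : R).
  by have := ler_wpM2r (ltW e0) inv_ge; rewrite mulVf ?gt_eqF //; lra.
by rewrite -ler_expR lnK ?posrE // (le_trans exp_half_le) // ler_nat.
Qed.

Lemma up_log_le_ln (n : nat) : (1 < n)%N -> (up_log 2 n).+1%:R <= 6 * ln n%:R :> R.
Proof.
move=> n_gt1; have half := ln_ge_half n_gt1; have ln2 := ln_ge_half (n := 2) isT.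
set t := (up_log 2 n).-1.
have -> : (up_log 2 n).+1%:R = t%:R + 2 :> R.
  by rewrite -natrD addn2 prednK // up_log_gt0.
have pow_lt : (2 ^ t < n)%N by apply: up_log_gtn.
have : ln (2%:R ^+ t : R) <= ln n%:R.
  by rewrite ler_ln ?posrE ?exprn_gt0 ?ltr0n ?(ltnW n_gt1) // -natrX ler_nat ltnW.
rewrite lnXn // -[ln _ *+ _]mulr_natl.
by have := ler_wpM2l (ler0n R t) ln2; lra.
Qed.

Lemma le_powR_double (n : nat) (x : R) : (1 < n)%N -> 0 <= x -> x <= n%:R `^ (2 * x).
Proof.
move=> n_gt1 x0; have := ln_ge_half n_gt1 => half.
rewrite /powR pnatr_eq0 gtn_eqF 1?ltnW //.
apply: (@le_trans _ _ (expR x)); first by have := expR_ge1Dx x; lra.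
by rewrite ler_expR; nra.
Qed.

Lemma program_cost_le (n K : nat) (a M : R) (base_cost := (loop_cost 0 (program 0))%:R : R) :
  (1 < n)%N -> 1 <= M -> 0 <= a -> K%:R <= a * M -> (arity K n)%:R <= a * M ->
  (loop_cost (max_rounds K n) (program K))%:R <= n%:R `^ ((2 * base_cost + 20 * a + 56) * M).
Proof.
move=> n_gt1 M1 a0 K_le r_le; set r := arity K n in r_le *.
have n_ge1 : 1 <= n%:R :> R by rewrite ler1n ltnW.
have n_neq0 : n%:R != 0 :> R by rewrite pnatr_eq0 -lt0n ltnW.
have powD x y : n%:R `^ (x + y) = n%:R `^ x * n%:R `^ y :> R.
  by rewrite powRD // n_neq0 implybT.
have rounds_le : (max_rounds K n).+1%:R <= n%:R `^ (5 * (a * M) + 14) :> R.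
  apply: (@le_trans _ _ ((2 * K + 6)%:R * n%:R `^ (r + 2)%:R)).
    by rewrite powR_mulrn // -natrX -natrM ler_nat; apply: max_rounds_le.
  apply: le_trans (ler_wpM2r (powR_ge0 _ _) (le_powR_double n_gt1 (ler0n R (2 * K + 6)))) _.
  rewrite -powD; apply: ler_powR => //; rewrite [(2 * K + 6)%:R]natrD [(2 * K)%:R]natrM natrD.
  by move: r_le; set x : R := r%:R; lra.
apply: (@le_trans _ _ (n%:R `^ (2 * base_cost) * (n%:R `^ (5 * (a * M) + 14)) ^+ 4)).
  apply: (@le_trans _ _ (base_cost * (max_rounds K n).+1%:R ^+ 4)).
    by rewrite /base_cost -natrX -natrM ler_nat; apply: loop_cost_program.
  apply: ler_pM; rewrite ?exprn_ge0 ?le_powR_double // lerXn2r ?nnegrE ?powR_ge0 //.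
rewrite -powR_mulrn ?powR_ge0 // -powRrM -powD; apply: ler_powR => //.
by have : 0 <= base_cost * (M - 1); [rewrite mulr_ge0 // subr_ge0|lra].
Qed.

End RunningTime.

Section Accuracy.
Variable R : realType.

Definition accuracy (gamma : R) : nat := Num.truncn (250 / gamma).

Definition guess_rate (gamma : R) : nat := 8 * accuracy gamma ^ 2.

Variable gamma : R.
Hypothesis gamma_gt0 : 0 < gamma.
Local Notation s := (accuracy gamma).

Lemma accuracy_le : s%:R <= 250 / gamma.
Proof. by rewrite truncn_le divr_ge0 // ltW. Qed.

Lemma accuracy_ge : gamma < 1 -> 240 <= gamma * s%:R.
Proof.
move=> gamma_lt1.
have /andP[_] : s%:R <= 250 / gamma < s.+1%:R by rewrite truncn_itv // divr_ge0 // ltW.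
by rewrite ltr_pdivrMr // -natr1; lra.
Qed.

Lemma guess_rate_le : (guess_rate gamma)%:R <= 8 * 250 ^+ 2 * gamma ^- 2.
Proof.
rewrite natrM natrX -mulrA ler_pM2l // -exprVn -exprMn.
by rewrite lerXn2r ?nnegrE ?accuracy_le // divr_ge0 // ltW.
Qed.

Lemma program_time_le (n : nat) : (1 < n)%N ->
  (loop_cost (max_rounds (guess_rate gamma) n) (program (guess_rate gamma)))%:R <=
  n%:R `^ ((2 * (loop_cost 0 (program 0))%:R + 20 * (48 * 250 ^+ 2) + 56) *
           Num.max 1 (ln n%:R / gamma ^+ 2)).
Proof.
move=> n_gt1; have half := ln_ge_half R n_gt1; have K_le := guess_rate_le.
set M := Num.max _ _; have M1 : 1 <= M by rewrite le_max lexx.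
have lM : ln n%:R / gamma ^+ 2 <= M by rewrite le_max lexx orbT.
have inv_gt0 : 0 < gamma ^- 2 by rewrite invr_gt0 exprn_gt0.
apply: program_cost_le => //; first lra.
  have := ler_wpM2r (ltW inv_gt0) half; rewrite -/(ln n%:R / _); lra.
rewrite /arity natrM.
apply: (@le_trans _ _ (8 * 250 ^+ 2 * gamma ^- 2 * (6 * ln n%:R))).
  by apply: ler_pM => //; apply: up_log_le_ln.
by move: lM; set x := gamma ^- 2; lra.
Qed.

End Accuracy.

Section ExpectedQuality.
Variables (R : realType) (J : instance R).
Local Notation h := (reward J).
Local Notation d := (den (weight J)).

Lemma inv_expR1_le : (expR 1)^-1 <= 2^-1 :> R.
Proof. by rewrite lef_pV2 ?posrE ?expR_gt0 //; have := expR_ge1Dx (1 : R); lra. Qed.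

Lemma program_feasible K :
  triple J (max_rounds K (nvert J)) (program K) (memory0 R) (fun m => feasible J (vertex_set J m 0))
    (fun m => objective (vertex_set J m 0)) 0.
Proof.
apply: (program_spec (leq0n _)) => m rd _ inc.
apply: (attempt_improves _ _ _ _ (@steps_gt0 K _) rd inc) => [||||T _];
  last exact: objective_ge0.
all: by rewrite /max_rounds; lia.
Qed.

(* The optimum is compared with the output for gamma / 10, so that the maximum
   of [h] exceeds its value at the optimum by a constant only. *)
Lemma exists_reference (gamma : R) s Topt : 0 < gamma < 1 -> 240 <= gamma * s%:R ->
  feasible J Topt -> exists O H, [/\ feasible J O, forall T, feasible J T -> h T <= H &
    (1 - (expR 1)^-1 - gamma) * h Topt + d Topt - gamma <= guarantee s O H].
Proof.
move=> /andP[g0 g1] s_ge fT; have e_le := inv_expR1_le; have h_ge0 := @reward_ge0 _ J.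
pose a : R := 1 - (expR 1)^-1 - gamma / 10; have a_ge : 3^-1 <= a by rewrite /a; lra.
case: (arg_maxP (fun T => a * h T + d T) fT) => O fO /(_ _) O_max.
case: (arg_maxP h fT) => Th fTh /(_ _) h_max.
exists O, (h Th); split=> //.
have hTh_le : h Th <= h O + 3.
  have val_le : a * h Th + d Th <= a * h O + d O := O_max Th fTh.
  have d_ge := den_ge0 Th; have d_le := den_le1 (J := J) O.
  have [|gap] := leP (h Th - h O) 0; first by lra.
  by have := ler_wpM2r (ltW gap) a_ge; lra.
have s_gt0 : 0 < s%:R :> R by rewrite -(pmulr_rgt0 _ g0); lra.
have loss_le : (3 * h Th + 15) / s%:R <= gamma / 10 * (h O + 1).
  rewrite ler_pdivrMr //; have O1_ge0 : 0 <= h O + 1 by rewrite addr_ge0.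
  by have := ler_wpM2r O1_ge0 s_ge; have := h_ge0 O; lra.
have slack : 0 <= gamma * h Topt by rewrite mulr_ge0 // ltW.
have : a * h Topt + d Topt <= a * h O + d O := O_max Topt fT.
by rewrite /guarantee /a; lra.
Qed.

Lemma program_expected_value (gamma : R) (K := guess_rate gamma)
    (t := loop_cost (max_rounds K (nvert J)) (program K)) (Topt : {set 'I_(nvert J)}) :
  0 < gamma -> feasible J Topt ->
  (1 - (expR 1)^-1 - gamma) * h Topt + d Topt - gamma <=
  output_expect J (program K) t (fun T => h T + d T).
Proof.
move=> g0 fT; have [g_ge1|g_lt1] := leP 1 gamma.
  have [_ _ /(le_trans _)] := triple_output (program_feasible K); apply.
  have := den_le1 (J := J) Topt; have : 0 <= (gamma - 1 + (expR 1)^-1) * h Topt.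
    by rewrite mulr_ge0 ?reward_ge0 // addr_ge0 ?invr_ge0 ?expR_ge0 // subr_ge0.
  lra.
have s_ge := accuracy_ge g0 g_lt1.
have s_gt0 : (0 < accuracy gamma)%N by rewrite -(ltr_nat R) -(pmulr_rgt0 _ g0); lra.
have g01 : 0 < gamma < 1 by rewrite g0.
have [O [H [fO h_le le_g]]] := exists_reference g01 s_ge fT.
by have [_ _ /(le_trans _)] := triple_output (program_quality s_gt0 fO h_le); apply.
Qed.

End ExpectedQuality.

Theorem theorem18 (R : realType) :
  exists C : R, 0 < C /\
  forall gamma : R, 0 < gamma ->
  exists P : cmd,
  forall J : instance R,
  exists t : nat,
  [/\ (2 <= nvert J)%N ->
        t%:R <= (nvert J)%:R `^ (C * Num.max 1 (ln (nvert J)%:R / gamma ^+ 2)),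
      halts_within J P t,
      output_always J P t (fun T => feasible J T)
    & forall Topt : {set 'I_(nvert J)}, feasible J Topt ->
        (1 - (expR 1)^-1 - gamma) * reward J Topt + den (weight J) Topt - gamma
        <= output_expect J P t (fun T => reward J T + den (weight J) T)].
Proof.
exists (2 * (loop_cost 0 (program 0))%:R + 20 * (48 * 250 ^+ 2) + 56); split.
  by have : 0 <= (loop_cost 0 (program 0))%:R :> R by []; lra.
move=> gamma gamma_gt0; exists (program (guess_rate gamma)) => J.
exists (loop_cost (max_rounds (guess_rate gamma) (nvert J)) (program (guess_rate gamma))).
have [halts feasible_output _] := triple_output (program_feasible J (guess_rate gamma)).
split=> // [n_gt1|Topt fT]; first exact: program_time_le.
exact: program_expected_value.
Qed.
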